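(* Let $n\ge1$. The Green function (with pole at the north pole) of the conformal sub-Laplacian $-L+n^2$ on $\mathbb{S}^{2n+1}$ is given, for $(r,\theta)\neq(0,0)$ with $r\in[0,\pi/2)$, $\theta\in[-\pi,\pi]$, by $$G(r,\theta)=\frac{\Gamma\left(\frac n2\right)^2}{8\pi^{n+1}\left(1-2\cos r\cos\theta+\cos^2 r\right)^{n/2}}.$$
   Context: $\mathbb{S}^{2n+1}=\{z\in\mathbb{C}^{n+1}:\|z\|=1\}$ and the sub-Laplacian is $L=2\sum_{j=1}^{n+1}(T_j\overline{T_j}+\overline{T_j}T_j)$ with $T_j=\frac{\partial}{\partial z_j}-\overline{z_j}\mathcal{S}$, $\mathcal{S}=\sum_{k=1}^{n+1}z_k\frac{\partial}{\partial z_k}$; equivalently $L=\Delta-T^2$, where $\Delta$ is the Laplace-Beltrami operator of the round metric and $Tf(z)=\frac{d}{d\theta}f(e^{i\theta}z)|_{\theta=0}$. The uniform (Riemannian) measure $\mu$ is normalized so that $\mu(\mathbb{S}^{2n+1})=\frac{2\pi^{n+1}}{\Gamma(n+1)}$. Cylindrical coordinates: a point with $z_{n+1}\ne0$ is written $z=\frac{1}{\sqrt{1+\rho^2}}(w_1e^{i\theta},\dots,w_ne^{i\theta},e^{i\theta})$ with $w\in\mathbb{C}^n$, $\rho^2=\sum|w_j|^2$, and $r\in[0,\pi/2)$ is defined by $\rho=\tan r$, so $z_{n+1}=\cos r\,e^{i\theta}$. The north pole is $N=(0,\dots,0,1)$, i.e. $r=0,\theta=0$. The Green function is the kernel $G$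 of $(-L+n^2)^{-1}$ issued from $N$ with respect to $\mu$: $((-L+n^2)^{-1}f)(N)=\int G f\,d\mu$; equivalently $G(r,\theta)=\int_0^{+\infty}e^{-n^2t}p_t(r,\theta)\,dt$, where $p_t(r,\theta)$ is the kernel of $e^{tL}$ issued from $N$ with respect to $\mu$ (which depends only on $(r,\theta)$). *)

(* Defs.v *)
From HB Require Import structures.
From mathcomp Require Import all_boot all_order all_algebra.
From mathcomp Require Import complex.
From mathcomp Require Import all_classical all_reals all_analysis.
From mathcomp Require Import measurable_realfun.

Set Implicit Arguments.
Unset Strict Implicit.
Unset Printing Implicit Defensive.

Import Order.TTheory GRing.Theory Num.Theory.
Import numFieldNormedType.Exports.

Local Open Scope classical_set_scope.
Local Open Scope complex_scope.
Local Open Scope ring_scope.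

Definition Gamma (R : realType) (x : R) : R :=
  \int[lebesgue_measure]_(t in `]0, +oo[) (t `^ (x - 1) * expR (- t)).

(* C^m in real coordinates: the pair (x, y) is the point x + i y.  In this
   form C^m is a normed module over R, so that continuity and the real
   directional derivatives 'D_v are the ones of R^(2m). *)
Notation Cspace R m := ('rV[R]_m * 'rV[R]_m)%type.

Section Calculus.
Variables (R : realType) (m : nat).
Local Notation E := (Cspace R m).

Definition coordC (z : E) (j : 'I_m) : R[i] := z.1 0 j +i* z.2 0 j.

Definition of_coordC (c : 'I_m -> R[i]) : E :=
  (\row_j complex.Re (c j), \row_j complex.Im (c j)).

Definition sphere : set E :=
  [set z : E | \sum_(j < m) (z.1 0 j ^+ 2 + z.2 0 j ^+ 2) = 1].

Fixpoint Ck (k : nat) (f : E -> R) : Prop :=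
  if k is k'.+1 then
    continuous f /\
    forall v : E, (forall z, derivable f z v) /\ Ck k' (fun z => 'D_v f z)
  else continuous f.

Definition smooth (f : E -> R[i]) : Prop :=
  forall k, Ck k (fun z => complex.Re (f z)) /\
            Ck k (fun z => complex.Im (f z)).

Definition dirD (v : E) (f : E -> R[i]) (z : E) : R[i] :=
  'D_v (fun p => complex.Re (f p)) z +i* 'D_v (fun p => complex.Im (f p)) z.

Definition dx (j : 'I_m) := dirD (delta_mx 0 j, 0).
Definition dy (j : 'I_m) := dirD (0, delta_mx 0 j).

Definition dz (j : 'I_m) (f : E -> R[i]) (z : E) : R[i] :=
  (dx j f z - (0 +i* 1) * dy j f z) / 2.
Definition dzbar (j : 'I_m) (f : E -> R[i]) (z : E) : R[i] :=
  (dx j f z + (0 +i* 1) * dy j f z) / 2.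

Definition opS (f : E -> R[i]) (z : E) : R[i] :=
  \sum_(k < m) coordC z k * dz k f z.
Definition opSbar (f : E -> R[i]) (z : E) : R[i] :=
  \sum_(k < m) conjc (coordC z k) * dzbar k f z.

Definition opT (j : 'I_m) (f : E -> R[i]) (z : E) : R[i] :=
  dz j f z - conjc (coordC z j) * opS f z.
Definition opTbar (j : 'I_m) (f : E -> R[i]) (z : E) : R[i] :=
  dzbar j f z - coordC z j * opSbar f z.

(* Functions on the sphere are represented by functions on C^m.  The vector
   fields opT and opTbar are tangent to the sphere, hence the values of
   sublaplacian f on the sphere depend only on those of f on the sphere. *)
Definition sublaplacian (f : E -> R[i]) (z : E) : R[i] :=
  2 * \sum_(j < m) (opT j (opTbar j f) z + opTbar j (opT j f) z).

End Calculus.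

(* The k-fold product measure on k-tuples. *)
Section PowerMeasure.
Local Open Scope ereal_scope.
Context d (T : measurableType d) (R : realType).
Variable m : {sigma_finite_measure set T -> \bar R}.

Definition tcons (k : nat) (p : T * k.-tuple T) : k.+1.-tuple T :=
  [tuple of p.1 :: p.2].

Lemma measurable_tcons k : measurable_fun setT (@tcons k).
Proof. by apply: measurable_cons. Qed.

Section step.
Variables (k : nat) (nu : {sigma_finite_measure set (k.-tuple T) -> \bar R}).

Definition pow_step : set (k.+1.-tuple T) -> \bar R :=
  pushforward (m \x nu) (@tcons k).

HB.instance Definition _ := Measure.copy pow_step
  (measure_function_pushforward__canonical__measure_function_Measure (m \x nu) (@measurable_tcons k)).

Lemma pow_step_sigma_finite : sigma_finite setT pow_step.
Proof.
have /sigma_finiteP[F [TF ndF Foo]] := sigma_finiteT m.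
have /sigma_finiteP[G [TG ndG Goo]] := sigma_finiteT nu.
pose h (v : k.+1.-tuple T) : T * k.-tuple T := (thead v, [tuple of behead v]).
have mh : measurable_fun setT h.
  by apply/measurable_fun_pairP; split; [exact: measurable_tnth|
    exact: measurable_behead].
have hK : h \o @tcons k = id.
  apply/funext => -[x t]; rewrite /h /= /tcons theadE; congr pair.
  exact/val_inj.
exists (fun n => h @^-1` (F n `*` G n)).
  rewrite predeqE => v; split=> // _.
  have [i _ Fi] : (\bigcup_n F n) (h v).1 by rewrite -TF.
  have [j _ Gj] : (\bigcup_n G n) (h v).2 by rewrite -TG.
  exists (maxn i j) => //; split.
  - by move: (h v).1 Fi; exact/subsetPset/ndF/leq_maxl.
  - by move: (h v).2 Gj; exact/subsetPset/ndG/leq_maxr.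
move=> n; have [? ?] := Foo n; have [? ?] := Goo n.
split.
  by rewrite -[X in measurable X]setTI; apply: mh => //; exact: measurableX.
rewrite /pow_step /pushforward -comp_preimage hK preimage_id.
by rewrite product_measure1E// lte_mul_pinfty// ge0_fin_numE.
Qed.

HB.instance Definition _ :=
  Measure_isSigmaFinite.Build _ _ _ pow_step pow_step_sigma_finite.
End step.

Fixpoint power_measure (k : nat) : {sigma_finite_measure set (k.-tuple T) -> \bar R} :=
  if k is k'.+1 then pow_step (power_measure k') else dirac [tuple].
End PowerMeasure.

Section SphereMeasure.
Variables (R : realType) (m : nat).
Local Notation V := ((m + m).-tuple (measurableTypeR R)).

(* The first m coordinates are the real parts, the last m the imaginary
   parts. *)
Definition pt (v : V) : Cspace R m :=
  (\row_j tnth v (lshift m j), \row_j tnth v (rshift m j)).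

Definition lebesgueV : {measure set V -> \bar R} :=
  power_measure (@lebesgue_measure R) (m + m).

Definition sqnormV (v : V) : R := \sum_(i < m + m) (tnth v i : R) ^+ 2.

Definition unit_ballV : set V := [set v | sqnormV v <= 1].

Definition normalizeV (v : V) : V :=
  [tuple (tnth v i : R) / Num.sqrt (sqnormV v) | i < m + m].

Lemma measurable_sqnormV : measurable_fun setT sqnormV.
Proof.
apply: measurable_sum => i; apply: measurable_funX.
exact: measurable_tnth.
Qed.

Lemma measurable_unit_ballV : measurable unit_ballV.
Proof.
rewrite (_ : unit_ballV = setT `&` sqnormV @^-1` `]-oo, 1]%classic).
  exact: measurable_sqnormV.
by rewrite setTI; apply/seteqP; split => v /=; rewrite in_itv.
Qed.

Lemma measurable_normalizeV : measurable_fun setT normalizeV.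
Proof.
apply/measurable_fun_tnthP => i.
rewrite (_ : _ \o _ =
    (fun v : V => (tnth v i : R) * sqnormV v `^ (- 2^-1))); last first.
  apply/funext => v /=; rewrite tnth_mktuple powRN powR12_sqrt//.
  by apply: sumr_ge0 => j _; exact: sqr_ge0.
apply: measurable_funM; first exact: measurable_tnth.
apply: (measurableT_comp (measurable_powR _)); exact: measurable_sqnormV.
Qed.

Definition total_mass : R := 2 * pi ^+ m / Gamma m%:R.

Lemma mass_ratio_ge0 : 0 <= total_mass / fine (lebesgueV unit_ballV).
Proof.
rewrite divr_ge0 ?fine_ge0 ?measure_ge0// divr_ge0//.
  by rewrite mulr_ge0// exprn_ge0// pi_ge0.
by apply: Rintegral_ge0 => t _; rewrite mulr_ge0 ?powR_ge0 ?expR_ge0.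
Qed.

(* The uniform measure: the image of Lebesgue measure on the unit ball under
   radial projection, scaled so as to have total mass
   2 pi^m / Gamma(m).  It is carried by pt @^-1` sphere. *)
Definition sphere_measure : set V -> \bar R :=
  mscale (NngNum mass_ratio_ge0)
    (measure_function_pushforward__canonical__measure_function_Measure
       (mrestr lebesgueV measurable_unit_ballV) measurable_normalizeV).

HB.instance Definition _ := Measure.on sphere_measure.

Definition sphere_integral (g : Cspace R m -> R[i]) : R[i] :=
  (\int[sphere_measure]_(v in pt @^-1` @sphere R m) complex.Re (g (pt v))) +i*
  (\int[sphere_measure]_(v in pt @^-1` @sphere R m) complex.Im (g (pt v))).

End SphereMeasure.

Section Green.
Variables (R : realType) (n : nat).
Local Notation E := (Cspace R n.+1).

Definition north_pole : E := of_coordC (fun j => (j == ord_max)%:R).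

(* u = (- L + n^2)^-1 f, for smooth functions on the sphere. *)
Definition is_resolvent (f u : E -> R[i]) : Prop :=
  [/\ smooth f, smooth u & forall z, sphere z ->
    - sublaplacian u z + n%:R ^+ 2 * u z = f z].

(* The integral kernel G of (- L + n^2)^-1 issued from the north pole, i.e.
   ((- L + n^2)^-1 f)(N) = \int G f dmu.  This determines G only almost
   everywhere; continuity away from the pole selects the representative given
   by \int_0^oo exp(- n^2 t) p_t dt. *)
Definition is_Green_function (G : E -> R) : Prop :=
  [/\ (@sphere_measure R n.+1).-integrable (@pt R n.+1 @^-1` @sphere R n.+1)
        (fun v => (G (pt v))%:E),
      {within @sphere R n.+1 `\ north_pole, continuous G} &
      forall f u, is_resolvent f u ->
        u north_pole = sphere_integral (fun z => (G z)%:C * f z)].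

Definition rho (w : 'I_n -> R[i]) : R :=
  Num.sqrt (\sum_(j < n) (complex.Re (w j) ^+ 2 + complex.Im (w j) ^+ 2)).

Definition expi (theta : R) : R[i] := cos theta +i* sin theta.

(* (w_1 e^(i theta), ..., w_n e^(i theta), e^(i theta)) / sqrt (1 + rho^2) *)
Definition cylindrical (w : 'I_n -> R[i]) (theta : R) : E :=
  of_coordC (fun j =>
    (Num.sqrt (1 + rho w ^+ 2))^-1%:C *
    (if unlift ord_max j is Some k then w k else 1) * expi theta).

End Green.

(* Main.v *)
(* For P on the sphere let zeta be the Hermitian product of z and P.  For e > 0
   the function h_e = (e + |1 - zeta|^2) ^ (- n/2) is smooth on all of C^(n+1),
   and a carre du champ computation shows that (- L + n^2) h_e is a nonnegative
   function which concentrates at P as e tends to 0.  Integrating by parts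
   against u with (- L + n^2) u = f and letting e tend to 0,
     n^2 c u(P) = int |1 - zeta|^(-n) f,   c = int |1 - zeta|^(-n).
   At the north pole this is existence.  At another point P the pair
   (h_e, (- L + n^2) h_e) is itself a resolvent pair, so the difference of two
   Green functions integrates to 0 against an approximate identity at P, and
   hence vanishes at P.

   The constant c is the limit, as s increases to 1, of
   int |1 - s zeta|^(-n) = sum_k b_k^2 s^(2k) m_k, where the b_k are the
   coefficients of (1 - x)^(- n/2) and m_k = int |zeta|^(2k): distinct powers of
   zeta are orthogonal since T zeta^k = i k zeta^k.  An integration by parts
   gives (n + k + 1) m_(k+1) = (k + 1) m_k, the sum at s = 1 telescopes, and
   its limit comes from Gamma (x + n/2)^2 ~ Gamma x Gamma (x + n). *)
From HB Require Import structures.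
Require Import Defs.
From mathcomp Require Import all_boot all_order all_algebra.
From mathcomp Require Import complex.
From mathcomp Require Import all_classical all_reals all_analysis.
From mathcomp Require Import measurable_realfun ring lra.
Import Order.TTheory GRing.Theory Num.Theory.
Import numFieldNormedType.Exports.
Set Implicit Arguments.
Unset Strict Implicit.
Unset Printing Implicit Defensive.
Local Open Scope classical_set_scope.
Local Open Scope ring_scope.

(** * Rotation invariance of the sphere measure *)

(** The sphere measure is a radial projection of an iterated product of Lebesgue measures, whose
    evident symmetry is the translation of one coordinate. Tonelli turns this into invariance under
    shears, hence under plane rotations. Differentiating in the angle kills the integral of every
    field x_a d_b - x_b d_a, and all integrations by parts reduce to this, without charts: L is the
    sum of squares of the 2n + 2 coordinate fields projected off the complex line of z, which make
    sense on all of C^(n+1).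

    The exponent - n/2 has a reason: zeta is horizontally conformal, so L h_e involves only |1 -
    zeta|^2, |zeta|^2 and e, and for this exponent the terms without a factor e cancel. The factor
    n^2 c is the limiting mass of (- L + n^2) h_e, found by testing against u = 1.

    Integrability of |1 - zeta|^(-n) is not known in advance. It follows by Fatou from a bound,
    uniform in s < 1, on the integrals of |1 - s zeta|^(-n); the same bound shows that the pole is a
    null set. Uniqueness rests on explicit resolvent pairs, since the defining property of a Green
    function speaks only of right-hand sides f that come with a smooth solution u. *)

Section translation.
Context {R : realType}.
Local Notation leb := (@lebesgue_measure R).

Lemma measurable_addr (c : R) :
  measurable_fun [set: measurableTypeR R] (fun x : measurableTypeR R => x + c :
    measurableTypeR R).
Proof. exact: measurable_funD. Qed.

Lemma lebesgue_measure_translation (c : R) (A : set (measurableTypeR R)) :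
  measurable A -> leb A = pushforward leb (fun x : measurableTypeR R => x + c :
    measurableTypeR R) A.
Proof.
pose mu := measure_function_pushforward__canonical__measure_function_Measure leb
  (measurable_addr c).
move=> mA; rewrite -[RHS]/(mu A); apply: lebesgue_measure_unique => // X [[a b] _ <-].
rewrite /= /pushforward.
rewrite (_ : _ @^-1` _ = `]a - c, b - c]%classic); last first.
  by apply/seteqP; split => x /=; rewrite !in_itv/= ltrBlDr lerBrDr.
rewrite !lebesgue_measure_itv/= !lte_fin ltrD2r.
by case: ifP => // _; rewrite -!EFinB; congr EFin; ring.
Qed.

Lemma integral_translation (c : R) (f : measurableTypeR R -> \bar R) :
  measurable_fun setT f -> (forall x, 0 <= f x)%E ->
  (\int[leb]_x f (x + c)%R = \int[leb]_x f x)%E.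
Proof.
move=> mf f0.
pose mu := measure_function_pushforward__canonical__measure_function_Measure leb
  (measurable_addr c).
rewrite [RHS](@eq_measure_integral _ _ _ _ mu); last first.
  by move=> A mA _; exact: lebesgue_measure_translation.
by rewrite ge0_integral_pushforward//; [exact: measurable_addr].
Qed.
End translation.

Section shear.
Context {R : realType}.
Local Notation T := (measurableTypeR R).
Local Notation leb := (@lebesgue_measure R).
Local Notation mu k := (power_measure leb k).

Definition add_coord k (i : 'I_k) (c : R) (v : k.-tuple T) : k.-tuple T :=
  [tuple (tnth v j : R) + (if j == i then c else 0) | j < k].

Lemma measurable_add_coord k (i : 'I_k) (c : k.-tuple T -> R) :
  measurable_fun setT c -> measurable_fun setT (fun v => add_coord i (c v) v).
Proof.
move=> mc; apply/measurable_fun_tnthP => j.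
rewrite (_ : _ \o _ = fun v => (tnth v j : R) + (if j == i then c v else 0)).
  apply: measurable_funD; first exact: measurable_tnth.
  by case: (j == i).
by apply/funext => v /=; rewrite tnth_mktuple.
Qed.

Lemma integral_power_measureS k (f : k.+1.-tuple T -> \bar R) :
  measurable_fun setT f -> (forall v, 0 <= f v)%E ->
  (\int[mu k.+1]_v f v = \int[leb \x mu k]_p f (tcons p))%E.
Proof.
by move=> mf f0; rewrite ge0_integral_pushforward//; exact: measurable_tcons.
Qed.

Lemma add_coord0 k (c : R) (x : T) (w : k.-tuple T) :
  add_coord ord0 c (tcons (x, w)) = tcons ((x + c : R) : T, w).
Proof.
apply: eq_from_tnth => j; rewrite tnth_mktuple.
case: (unliftP ord0 j) => [i ->|->]; last by rewrite eqxx.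
by rewrite eq_sym (negbTE (neq_lift _ _)) addr0 !tnthS.
Qed.

Lemma add_coord_lift k (i : 'I_k) (c : R) (x : T) (w : k.-tuple T) :
  add_coord (lift ord0 i) c (tcons (x, w)) = tcons (x, add_coord i c w).
Proof.
apply: eq_from_tnth => j; rewrite tnth_mktuple.
case: (unliftP ord0 j) => [l ->|->]; last first.
  by rewrite (negbTE (neq_lift _ _)) addr0.
by rewrite !tnthS tnth_mktuple (inj_eq lift_inj).
Qed.

Lemma measurable_tcons_pair1 k (x : T) :
  measurable_fun [set: k.-tuple T] (fun w => tcons (x, w)).
Proof.
apply: (measurableT_comp (@measurable_tcons _ _ _)).
exact: measurable_pair1.
Qed.

Lemma measurable_tcons_pair2 k (w : k.-tuple T) :
  measurable_fun [set: T] (fun x => tcons (x, w)).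
Proof.
apply: (measurableT_comp (@measurable_tcons _ _ _)).
exact: measurable_pair2.
Qed.

(* By induction on k with Tonelli: on the sheared coordinate this is the
   translation invariance of Lebesgue measure. *)
Lemma integral_shear k (i : 'I_k) (c : k.-tuple T -> R)
    (f : k.-tuple T -> \bar R) :
  measurable_fun setT c -> (forall s v, c (add_coord i s v) = c v) ->
  measurable_fun setT f -> (forall v, 0 <= f v)%E ->
  (\int[mu k]_v f (add_coord i (c v) v) = \int[mu k]_v f v)%E.
Proof.
elim: k i c f => [[]//|k IH] i c f mc ci mf f0.
have mfc : measurable_fun setT (fun v => f (add_coord i (c v) v)).
  by apply: measurableT_comp => //; exact: measurable_add_coord.
rewrite !integral_power_measureS//.
have mft : measurable_fun setT (fun p => f (@tcons _ T k p)).
  by apply: measurableT_comp => //; exact: measurable_tcons.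
have mfct : measurable_fun setT
    (fun p => f (add_coord i (c (@tcons _ T k p)) (tcons p))).
  by apply: (measurableT_comp mfc); exact: measurable_tcons.
case: (unliftP ord0 i) => [j ij|i0]; subst i.
- rewrite !fubini_tonelli1//.
  apply: eq_integral => x _; rewrite /fubini_F.
  under eq_integral do rewrite add_coord_lift.
  apply: (IH j (fun w => c (tcons (x, w))) (fun w => f (tcons (x, w)))).
  + by apply: measurableT_comp => //; exact: measurable_tcons_pair1.
  + by move=> s v; rewrite -add_coord_lift ci.
  + by apply: measurableT_comp => //; exact: measurable_tcons_pair1.
  + by [].
- rewrite !fubini_tonelli1// !fubini_tonelli//.
  apply: eq_integral => w _; rewrite /fubini_G.
  pose d := c (tcons ((0 : R) : T, w)).
  under eq_integral => x _.
    rewrite add_coord0 (_ : c (tcons (x, w)) = d); last first.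
      by rewrite /d -[RHS](ci x) add_coord0 add0r.
    over.
  rewrite /= (@integral_translation _ d (fun x => f (tcons (x, w))))//.
  by apply: measurableT_comp => //; exact: measurable_tcons_pair2.
Qed.

Definition rot_plane k (a b : 'I_k) (co si : R) (v : k.-tuple T) : k.-tuple T :=
  [tuple if j == a then co * tnth v a - si * tnth v b
         else if j == b then si * tnth v a + co * tnth v b
         else tnth v j : R | j < k].

Lemma measurable_rot_plane k (a b : 'I_k) (co si : R) :
  measurable_fun setT (@rot_plane k a b co si).
Proof.
apply/measurable_fun_tnthP => j.
rewrite (_ : _ \o _ = fun v : k.-tuple T => if j == a then co * tnth v a - si * tnth v b
         else if j == b then si * tnth v a + co * tnth v b
         else tnth v j : R); last first.
  by apply/funext => v /=; rewrite tnth_mktuple.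
case: (j == a) => /=.
  by apply: measurable_funB; apply: measurable_funM => //; exact: measurable_tnth.
case: (j == b) => /=; last exact: measurable_tnth.
by apply: measurable_funD; apply: measurable_funM => //; exact: measurable_tnth.
Qed.

(* A plane rotation by an angle t is a product of three shears, with slopes
   - tan (t/2), sin t, - tan (t/2); here s = tan (t/2). *)
Lemma rot_plane_shears k (a b : 'I_k) (s : R) (v : k.-tuple T) : a != b ->
  let S1 v := add_coord a (- s * tnth v b) v in
  let S2 v := add_coord b (2 * s / (1 + s ^+ 2) * tnth v a) v in
  S1 (S2 (S1 v)) =
  rot_plane a b ((1 - s ^+ 2) / (1 + s ^+ 2)) (2 * s / (1 + s ^+ 2)) v.
Proof.
move=> ab S1 S2.
have s0 : 1 + s ^+ 2 != 0 by rewrite gt_eqF// ltr_pwDl// sqr_ge0.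
have ba : (b == a) = false by rewrite eq_sym (negbTE ab).
apply: eq_from_tnth => j; rewrite !tnth_mktuple.
have [->|ja] := eqVneq j a.
  by rewrite ?(eqxx, ba, negbTE ab, addr0); field.
have [->|jb] := eqVneq j b; last by rewrite ?addr0.
by rewrite ?(eqxx, ba, negbTE ab, addr0); field.
Qed.

Lemma integral_rot_plane k (a b : 'I_k) (s : R) (f : k.-tuple T -> \bar R) :
  a != b -> measurable_fun setT f -> (forall v, 0 <= f v)%E ->
  (\int[mu k]_v f (rot_plane a b ((1 - s ^+ 2) / (1 + s ^+ 2))
                             (2 * s / (1 + s ^+ 2)) v) =
   \int[mu k]_v f v)%E.
Proof.
move=> ab mf f0.
pose c1 (v : k.-tuple T) := - s * tnth v b.
pose c2 (v : k.-tuple T) := 2 * s / (1 + s ^+ 2) * tnth v a.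
have mc1 : measurable_fun setT c1.
  by apply: measurable_funM => //; exact: measurable_tnth.
have mc2 : measurable_fun setT c2.
  by apply: measurable_funM => //; exact: measurable_tnth.
have ci1 u v : c1 (add_coord a u v) = c1 v.
  by rewrite /c1 tnth_mktuple eq_sym (negbTE ab) addr0.
have ci2 u v : c2 (add_coord b u v) = c2 v.
  by rewrite /c2 tnth_mktuple (negbTE ab) addr0.
have mS1 := measurable_add_coord a mc1.
have mS2 := measurable_add_coord b mc2.
under eq_integral do rewrite -rot_plane_shears//.
have mf1 := measurableT_comp mf mS1.
have mf2 := measurableT_comp mf1 mS2.
rewrite (integral_shear (f := fun v => f (add_coord a (c1 (add_coord b (c2 v) v)) (add_coord b
  (c2 v) v))) mc1 ci1)//.
rewrite (integral_shear (f := fun v => f (add_coord a (c1 v) v)) mc2 ci2)//.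
exact: integral_shear.
Qed.

End shear.

(** * Volumes of cubes *)

Section cube.
Context {R : realType}.
Local Notation T := (measurableTypeR R).
Local Notation leb := (@lebesgue_measure R).
Local Notation mu k := (power_measure leb k).

Definition cube k (a b : R) : set (k.-tuple T) :=
  [set v | forall i, a <= tnth v i <= b].
Arguments cube k a b : clear implicits.

Lemma measurable_cube k a b : measurable (cube k a b).
Proof.
rewrite (_ : cube k a b = \bigcap_(i in [set: 'I_k])
    ((fun v : k.-tuple T => tnth v i) @^-1` `[a, b]%classic)).
  apply: fin_bigcap_measurable; first exact: finite_finset.
  by move=> i _; rewrite -[X in measurable X]setTI; apply: measurable_tnth.
by apply/seteqP; split => v /= h i; have := h i; rewrite /= in_itv//= => ->.
Qed.

(** Cubes are the sets whose volume is computed explicitly: one contains the unit ball and one lies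
    inside it, so the normalizing factor is finite and nonzero, and the degenerate cube is the
    origin. *)
Lemma power_measure_cube k (a b : R) : a <= b ->
  mu k (cube k a b) = ((b - a) ^+ k)%:E.
Proof.
move=> ab; elim: k => [|k IH].
  rewrite /= diracE expr0 mem_set//; by case.
rewrite /= /pow_step /pushforward.
rewrite (_ : _ @^-1` _ = `[a, b]%classic `*` cube k a b); last first.
  apply/seteqP; split; case=> x w /=.
    move=> h; split; first by have := h ord0; rewrite in_itv.
    by move=> i; have := h (lift ord0 i); rewrite tnthS.
  move=> [/= + h] i; rewrite in_itv/= => xab.
  by case: (unliftP ord0 i) => [j ->|->]; rewrite ?tnthS.
rewrite product_measure1E//; last exact: measurable_cube.
have e : leb `[a, b]%classic = (b - a)%:E.
  have /= -> := lebesgue_measure_itv `[a, b]; rewrite lte_fin.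
  case: ltP => [_|ba]; first by rewrite -EFinB.
  have -> : b = a by apply/eqP; rewrite eq_le ab ba.
  by rewrite subrr.
rewrite IH exprS EFinM; congr (_ * _)%E; exact: e.
Qed.
End cube.
Arguments cube {R} k a b.

(** * The uniform measure: total mass and invariance *)

Section sphere_measure_theory.
Context {R : realType} (m : nat).
Local Notation T := (measurableTypeR R).
Local Notation V := ((m + m).-tuple (measurableTypeR R)).
Local Notation leb := (lebesgueV R m).
Local Notation B := (@unit_ballV R m).
Local Notation N := (m + m)%N.

Lemma sqnormV_ge0 (v : V) : 0 <= sqnormV v.
Proof. by apply: sumr_ge0 => i _; exact: sqr_ge0. Qed.

Lemma lebesgueV_ball_lty : (leb B < +oo)%E.
Proof.
have : B `<=` cube N (-1) 1.
  move=> v Bv i; rewrite -ler_norml -(@ler_pXn2r _ 2)// ?nnegrE//.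
  rewrite real_normK ?num_real// expr1n; apply: le_trans Bv.
  by rewrite /sqnormV (bigD1 i)//= lerDl sumr_ge0// => j _; exact: sqr_ge0.
move=> /le_measure -/(_ R leb) h; apply: le_lt_trans (h _ _) _.
- by rewrite inE; exact: measurable_unit_ballV.
- by rewrite inE; exact: measurable_cube.
- have le11 : -1 <= 1 :> R by rewrite (le_trans (lerN10 _)).
  have e : leb (cube N (-1) 1) = _ := power_measure_cube N le11.
  suff : (leb (cube N (-1) 1)%R < +oo)%E by [].
  by rewrite e ltry.
Qed.

Lemma lebesgueV_ball_gt0 : (0 < leb B)%E.
Proof.
(* A side for which N c^2 <= N c <= 1. *)
pose c : R := N.+1%:R^-1.
have c0 : 0 < c by rewrite invr_gt0.
have c1 : c <= 1 by rewrite invf_le1// ler1n.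
have : cube N 0 c `<=` B.
  move=> v vc; rewrite /unit_ballV/= /sqnormV.
  apply: (@le_trans _ _ (\sum_(i < N) c)).
    apply: ler_sum => i _; have /andP[v0 v1] := vc i.
    rewrite -[leRHS]mulr1 expr2 ler_pM// (le_trans v1)//.
  rewrite sumr_const card_ord -mulr_natl ler_pdivrMr// mul1r.
  by rewrite ler_nat.
move=> /le_measure -/(_ R leb) h; apply: lt_le_trans (h _ _).
- have e : leb (cube N 0 c) = _ := power_measure_cube N (ltW c0).
  suff : (0%R < leb (cube N 0 c))%E by [].
  by rewrite e subr0 lte_fin exprn_gt0.
- by rewrite inE; exact: measurable_cube.
- by rewrite inE; exact: measurable_unit_ballV.
Qed.

Lemma lebesgueV_set0v : (0 < m)%N -> leb [set v | sqnormV v = 0] = 0%E.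
Proof.
move=> m0; rewrite (_ : [set v | _] = cube N 0 0).
  rewrite /lebesgueV; have := @power_measure_cube R N 0 0 (lexx 0) => /= ->.
  by rewrite subrr expr0n addn_eq0; case: (m) m0.
apply/seteqP; split => v /=.
  move=> /eqP; rewrite psumr_eq0; last by move=> i _; exact: sqr_ge0.
  by move=> /allP h i; have := h i (mem_index_enum _); rewrite /= sqrf_eq0 => /eqP ->;
    rewrite lexx.
move=> h; rewrite /sqnormV big1// => i _.
by have := h i; rewrite -eq_le => /eqP <-; rewrite expr0n.
Qed.

Lemma sphere_measureE (A : set V) :
  sphere_measure A = ((total_mass R m / fine (leb B))%:E * leb (@normalizeV R m @^-1` A `&`
    B))%E.
Proof. by []. Qed.

Lemma sphere_measureT : sphere_measure [set: V] = (total_mass R m)%:E.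
Proof.
rewrite sphere_measureE preimage_setT setTI.
have fB : leb B \is a fin_num by rewrite ge0_fin_numE ?lebesgueV_ball_lty.
rewrite -[X in (_ * X)%E]fineK// -EFinM divfK//.
by rewrite fine_eq0// gt_eqF// lebesgueV_ball_gt0.
Qed.

Lemma preimage_sphereE : @pt R m @^-1` @sphere R m = [set v | sqnormV v = 1].
Proof.
apply/seteqP; split => v; rewrite /sphere/= /sqnormV big_split_ord/= big_split/=;
  by move=> <-; congr (_ + _); apply: eq_bigr => j _; rewrite mxE.
Qed.

Lemma measurable_preimage_sphere : measurable (@pt R m @^-1` @sphere R m).
Proof.
rewrite preimage_sphereE (_ : [set v | _] = @sqnormV R m @^-1` [set 1])//.
by rewrite -[X in measurable X]setTI; apply: measurable_sqnormV.
Qed.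

Lemma sqnormV_normalize (v : V) : sqnormV v != 0 -> sqnormV (normalizeV v) = 1.
Proof.
move=> v0; rewrite /sqnormV; under eq_bigr do rewrite tnth_mktuple exprMn exprVn.
rewrite -mulr_suml sqr_sqrtr ?sqnormV_ge0//; exact: divff.
Qed.

(** Normalization misses the sphere only at the origin, where division by 0 gives 0, and the origin
    is Lebesgue null once [m] is positive. *)
Lemma sphere_measureC : (0 < m)%N ->
  sphere_measure (~` (@pt R m @^-1` @sphere R m)) = 0%E.
Proof.
move=> m0; rewrite sphere_measureE.
set A := _ `&` B; suff -> : leb A = 0%E by rewrite mule0.
apply/eqP; rewrite eq_le [X in _ && X]measure_ge0 andbT.
rewrite -(lebesgueV_set0v m0); apply: le_measure.
- rewrite inE; apply: measurableI; last exact: measurable_unit_ballV.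
  rewrite -[X in measurable X]setTI; apply: measurable_normalizeV => //.
  apply: measurableC; exact: measurable_preimage_sphere.
- rewrite inE (_ : [set v | _] = @sqnormV R m @^-1` [set 0])//.
  by rewrite -[X in measurable X]setTI; apply: measurable_sqnormV.
- move=> v [/= + _]; rewrite -[sphere (pt _)]/((@pt R m @^-1` @sphere R m) _).
  rewrite preimage_sphereE; apply: contra_notP => /eqP.
  exact: sqnormV_normalize.
Qed.

Lemma sphere_measure_sphere : (0 < m)%N ->
  sphere_measure (@pt R m @^-1` @sphere R m) = (total_mass R m)%:E.
Proof.
move=> m0; rewrite -sphere_measureT -[in RHS](setUv (@pt R m @^-1` @sphere R m)).
have mS := measurable_preimage_sphere.
rewrite measureU//; [|exact: measurableC|exact: setICr].
by have /= -> := sphere_measureC m0; rewrite adde0.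
Qed.

Lemma sqnormV_rot (a b : 'I_N) (co si : R) (v : V) : a != b ->
  co ^+ 2 + si ^+ 2 = 1 -> sqnormV (rot_plane a b co si v) = sqnormV v.
Proof.
move=> ab cs; rewrite /sqnormV (bigD1 a)//= [RHS](bigD1 a)//=.
have ba : b != a by rewrite eq_sym.
rewrite (bigD1 b)//= [X in _ = _ + X](bigD1 b)//= !addrA; congr (_ + _).
  rewrite !tnth_mktuple eqxx (negbTE ba) eqxx.
  by rewrite -[RHS]mul1r -cs; ring.
apply: eq_bigr => i /andP[ia ib].
by rewrite tnth_mktuple (negbTE ia) (negbTE ib).
Qed.

Lemma normalizeV_rot (a b : 'I_N) (co si : R) (v : V) : a != b ->
  co ^+ 2 + si ^+ 2 = 1 ->
  normalizeV (rot_plane a b co si v) = rot_plane a b co si (normalizeV v).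
Proof.
move=> ab cs; apply: eq_from_tnth => i.
rewrite !tnth_mktuple sqnormV_rot//.
by case: ifP => _; last case: ifP => _; rewrite // -?mulrA -?mulrBl -?mulrDl -?mulrA //; ring.
Qed.

(** Radial projection commutes with the rotation and the ball is invariant, so the invariance of
    Lebesgue measure carries over. *)
Lemma sphere_measure_rot (a b : 'I_N) (co si : R) (A : set V) : a != b ->
  co ^+ 2 + si ^+ 2 = 1 -> 1 + co != 0 -> measurable A ->
  sphere_measure A = pushforward (@sphere_measure R m) (rot_plane a b co si) A.
Proof.
move=> ab cs co1 mA; rewrite /pushforward !sphere_measureE; congr (_ * _)%E.
(* The tangent of the half angle, which parametrizes every rotation but the half turn. Small angles
   are enough later, where only the derivative at angle 0 is taken. *)
pose s := si / (1 + co).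
have s1 : 1 + s ^+ 2 != 0 by rewrite gt_eqF// ltr_pwDl// sqr_ge0.
have Ds : (1 + s ^+ 2) * (1 + co) = 2.
  have -> : (1 + s ^+ 2) * (1 + co) = ((1 + co) ^+ 2 + si ^+ 2) / (1 + co).
    by rewrite /s; field.
  have -> : si ^+ 2 = 1 - co ^+ 2 by rewrite -cs; ring.
  by field.
have Es : (1 + s ^+ 2) = 2 / (1 + co) by rewrite -Ds mulfK.
have s2 : s ^+ 2 = 2 / (1 + co) - 1 by rewrite -Es; ring.
have Ec : co = (1 - s ^+ 2) / (1 + s ^+ 2).
  by apply: (canRL (mulfK s1)); rewrite Es s2; field.
have Esi : si = 2 * s / (1 + s ^+ 2) by rewrite Es /s; field.
set C := @normalizeV R m @^-1` A `&` B.
have mC : measurable C.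
  apply: measurableI; last exact: measurable_unit_ballV.
  by rewrite -[X in measurable X]setTI; apply: measurable_normalizeV.
set D := normalizeV (m:=m) @^-1` (rot_plane a b co si @^-1` A) `&` B.
have CD : rot_plane a b co si @^-1` C = D.
  by apply/seteqP; split => v; rewrite /C/D/= /unit_ballV/= normalizeV_rot// sqnormV_rot.
have mr := @measurable_rot_plane R _ a b co si.
have mD : measurable D by rewrite -CD -[X in measurable X]setTI; apply: mr.
have eC : (\int[leb]_v (\1_C v)%:E = leb C)%E by rewrite integral_indic// setIT.
have eD : (\int[leb]_v (\1_D v)%:E = leb D)%E by rewrite integral_indic// setIT.
rewrite -eC -eD -CD.
have := @integral_rot_plane R _ a b s (fun v => (\1_C v)%:E) ab.
by rewrite -Ec -Esi => <- //; exact/measurable_EFinP.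
Qed.
End sphere_measure_theory.

(** * Calculus on the sphere *)

Section coordinates.
Context {R : realType} {m : nat}.
Local Notation E := (Cspace R m).
Local Notation J := ('I_m + 'I_m)%type.
Implicit Types (c d : J) (z w : E).

(** A single index set for the 2m real coordinates, so that sums over [c] treat real and imaginary
    parts alike. *)
Definition crd c z : R := match c with inl j => z.1 0 j | inr j => z.2 0 j end.

Definition bas c : E :=
  match c with inl j => (delta_mx 0 j, 0) | inr j => (0, delta_mx 0 j) end.

Lemma crd_bas c d : crd c (bas d) = (c == d)%:R.
Proof. by case: c d => [i|i] [j|j] /=; rewrite !mxE ?eqxx. Qed.

Lemma crdD c z w : crd c (z + w) = crd c z + crd c w.
Proof. by case: c => j /=; rewrite mxE. Qed.

Lemma crdN c z : crd c (- z) = - crd c z.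
Proof. by case: c => j /=; rewrite mxE. Qed.

Lemma crdB c z w : crd c (z - w) = crd c z - crd c w.
Proof. by rewrite crdD crdN. Qed.

Lemma crdZ c k z : crd c (k *: z) = k * crd c z.
Proof. by case: c => j /=; rewrite mxE. Qed.

Lemma crd0 c : crd c 0 = 0.
Proof. by case: c => j /=; rewrite mxE. Qed.

Lemma crd_sum c (I : Type) (r : seq I) (P : pred I) (F : I -> E) :
  crd c (\sum_(i <- r | P i) F i) = \sum_(i <- r | P i) crd c (F i).
Proof.
elim/big_ind2 : _ => //; first exact: crd0.
by move=> x x' y y' <- <-; rewrite crdD.
Qed.

Lemma crd_inj z w : (forall c, crd c z = crd c w) -> z = w.
Proof.
case: z w => [z1 z2] [w1 w2] h; congr pair; apply/rowP => j.
  by have := h (inl j).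
by have := h (inr j).
Qed.

Lemma sum_basE z : z = \sum_c crd c z *: bas c.
Proof.
apply: crd_inj => d; rewrite crd_sum (bigD1 d)//= crdZ crd_bas eqxx mulr1.
rewrite big1 ?addr0// => c cd.
by rewrite crdZ crd_bas eq_sym (negbTE cd) mulr0.
Qed.

Lemma crd_norm c z : `|crd c z| <= `|z|.
Proof.
have h n (x : 'rV[R]_n) j : `|x 0 j| <= `|x|.
  rewrite [leRHS]/Num.norm/= mx_normrE.
  by apply/bigmax_geP; right => /=; exists (0, j).
rewrite prod_normE; case: c => j /=; rewrite le_max h ?orbT//.
Qed.

Lemma crd_norm_lt z (e : R) : 0 < e -> (forall c, `|crd c z| < e) -> `|z| < e.
Proof.
move=> e0 h; rewrite prod_normE gt_max; apply/andP; split;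
  rewrite [ltLHS]/Num.norm/= mx_normrE; apply/bigmax_ltP; split => //= -[i j] _;
  rewrite (ord1 i); [exact: (h (inl j))|exact: (h (inr j))].
Qed.

Lemma crd_continuous c : continuous (crd c).
Proof.
case: c => j z /=.
- apply: (@continuous_comp _ _ _ fst (fun x : 'rV[R]_m => x 0 j)).
    exact: cvg_fst.
  exact: coord_continuous.
- apply: (@continuous_comp _ _ _ snd (fun x : 'rV[R]_m => x 0 j)).
    exact: cvg_snd.
  exact: coord_continuous.
Qed.

Lemma sphere_crdP z : sphere z <-> \sum_c crd c z ^+ 2 = 1.
Proof. by rewrite /sphere/= big_sumType big_split. Qed.

Lemma sphere_crd_le1 c z : sphere z -> `|crd c z| <= 1.
Proof.
move=> /sphere_crdP z1; rewrite -(@ler_pXn2r _ 2)// ?nnegrE//.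
rewrite real_normK ?num_real// expr1n -z1 (bigD1 c)//= lerDl.
by apply: sumr_ge0 => d _; exact: sqr_ge0.
Qed.

Lemma sphere_bounded (g : E -> R) : continuous g ->
  exists2 M : R, 0 <= M & forall z, sphere z -> `|g z| <= M.
Proof.
move=> cg.
pose B : set E := [set v : 'rV[R]_m | forall i, v ord0 i \in `[(-1 : R), 1]%classic] `*`
  [set v : 'rV[R]_m | forall i, v ord0 i \in `[(-1 : R), 1]%classic].
have cB : compact B.
  have cI : compact [set v : 'rV[R]_m | forall i, v ord0 i \in `[(-1 : R), 1]%classic].
    have := @rV_compact _ m (fun=> `[(-1 : R), 1]%classic)
      (fun _ => @segment_compact _ _ _).
    by congr compact; apply/seteqP; split => v /= h i; have := h i; rewrite inE.
  exact: compact_setX.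
have B0 : B !=set0.
  exists 0; split => i /=; rewrite inE/= in_itv/= !mxE; rewrite lerN10 ler01//.
have sB z : sphere z -> z \in B.
  move=> z1; rewrite inE; split => i /=; rewrite inE/= in_itv/= -ler_norml.
    exact: (sphere_crd_le1 (inl i)).
  exact: (sphere_crd_le1 (inr i)).
have [|z0 _ h] := @compact_EVT_max _ _ (fun z => `|g z|) B B0 cB.
  apply: continuous_subspaceT => z.
  by apply: (@continuous_comp _ _ _ g (@Num.norm _ R)); [exact: cg|exact: norm_continuous].
exists `|g z0| => // z /sB; exact: h.
Qed.

Local Notation V := ((m + m).-tuple (measurableTypeR R)).
Local Notation mu := (@sphere_measure R m).
Local Notation S := (@pt R m @^-1` @sphere R m).

Lemma crd_pt c (v : V) : crd c (pt v) = tnth v (unsplit c).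
Proof. by case: c => j /=; rewrite mxE. Qed.

(* The values at the points of finer and finer grids are measurable, having
   countably many level sets. *)
Lemma measurable_continuous_pt (g : E -> R) : continuous g ->
  measurable_fun setT (fun v : V => g (pt v)).
Proof.
move=> cg.
pose fl k (x : R) : int := Num.floor (k.+1%:R * x).
pose grid k (w : (m + m).-tuple int) : V := [tuple (tnth w i)%:~R / k.+1%:R : R | i < m + m].
pose rd k (v : V) : (m + m).-tuple int := [tuple fl k (tnth v i) | i < m + m].
apply: (@measurable_fun_cvg _ _ _ _ (fun k (v : V) => g (pt (grid k (rd k v))))); last first.
  move=> v _; suff h : pt (grid k (rd k v)) @[k --> \oo] --> pt v.
    refine (@cvg_comp _ _ _ (fun k => pt (grid k (rd k v))) g _ _ _ h _).
    exact: cg.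
  apply/cvgrPdist_lt => e e0; near=> k.
  apply: crd_norm_lt => // c; rewrite crdB !crd_pt !tnth_mktuple.
  rewrite distrC; set x : R := tnth v (unsplit c).
  have k0 : (0 : R) < k.+1%:R by [].
  have /andP[h1 h2] := floor_itv (k.+1%:R * x).
  have h3 : `|(fl k x)%:~R / k.+1%:R - x| <= k.+1%:R^-1.
    rewrite -[X in _ - X](mulKf (lt0r_neq0 k0)) [X in _ - X]mulrC -mulrBl.
    rewrite normrM normfV (ger0_norm (ltW k0)) ler_piMl ?invr_ge0//.
    rewrite ler_norml; rewrite intrD in h2; move: h1 h2; rewrite /fl; lra.
  apply: le_lt_trans h3 _; near: k; exact: near_infty_natSinv_lt (PosNum e0).
move=> k; move=> _ Y mY; rewrite setTI.
rewrite (_ : _ @^-1` _ = \bigcup_(w in [set: (m + m).-tuple int])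
    [set v : V | g (pt (grid k w)) \in Y /\ rd k v = w]); last first.
  apply/seteqP; split => v /=; first by move=> Yv; exists (rd k v) => //=; rewrite inE.
  by move=> [w _ /= [+ ->]]; rewrite inE.
apply: countable_bigcupT_measurable => [|w]; first exact: countableP.
have [Yw|Yw] := boolP (g (pt (grid k w)) \in Y); last first.
  by rewrite (_ : [set v | _] = set0)//; apply/seteqP; split => // v /= [].
rewrite (_ : [set v | _] = \bigcap_(i in [set: 'I_(m + m)]) ((fun v : V => tnth v i) @^-1`
    [set x : R | (tnth w i)%:~R <= k.+1%:R * x < (tnth w i + 1)%:~R])); last first.
  apply/seteqP; split => v /=.
    by move=> [_ <-] i _ /=; rewrite tnth_mktuple; exact: floor_itv.
  move=> h; split => //; apply: eq_from_tnth => i; rewrite tnth_mktuple.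
  exact: (floor_def (h i Logic.I)).
apply: fin_bigcap_measurable => // i _.
rewrite -[X in measurable X]setTI; apply: measurable_tnth => //.
rewrite (_ : [set x | _] = (fun x : R => k.+1%:R * x) @^-1`
   `[(tnth w i)%:~R, (tnth w i + 1)%:~R[%classic); last first.
  by apply/seteqP; split => x /=; rewrite in_itv.
by rewrite -[X in measurable X]setTI; apply: measurable_funM.
Unshelve. all: by end_near. Qed.

End coordinates.

Lemma linear_approx_differentiable (K : numFieldType) (V W : normedModType K)
    (f : V -> W) (z : V) (df : {linear V -> W}) : continuous df ->
  (forall e : K, 0 < e ->
    \forall h \near 0, `|f (h + z) - f z - df h| <= e * `|h|) ->
  differentiable f z.
Proof.
move=> cdf H.
have key : f = (fun y => f z + df (y - z)) +o_ z (fun y => y - z).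
  apply/eqaddoP => e e0; rewrite [\forall x \near _, _ <= _](near_shift 0 z) subr0.
  near=> h; rewrite /= !fctE/= addrK opprD addrA.
  by near: h; exact: H.
apply/diffP => /=.
(* The differential is a chosen map with this property, so one witness is enough. *)
apply: (@getPex _ (fun (df : {linear V -> W}) => continuous df /\
  forall y, f y = f (lim (nbhs z)) + df (y - lim (nbhs z))
                  +o_(y \near z) (y - lim (nbhs z)))).
exists df; split=> // y; rewrite lim_id //.
exact: (congr1 (fun F => F y) key).
Unshelve. all: by end_near. Qed.

(** * The classes [Ck]: algebra, powers, differentiability *)

Section Ck_theory.
Context {R : realType} {m : nat}.
Local Notation E := (Cspace R m).
Local Notation J := ('I_m + 'I_m)%type.
Implicit Types (f g : E -> R) (z v : E) (c : J).

Lemma Ck_continuous k f : Ck k f -> continuous f.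
Proof. by case: k => [//|k []]. Qed.

Lemma Ck_derivable k f v z : Ck k.+1 f -> derivable f z v.
Proof. by move=> [_ /(_ v)[]]. Qed.

Arguments Ck_derivable {k f} v z.

Lemma Ck_derive k f v : Ck k.+1 f -> Ck k (fun z => 'D_v f z).
Proof. by move=> [_ /(_ v)[]]. Qed.

Arguments Ck_derive {k f} v.

Lemma CkS k f : Ck k.+1 f -> Ck k f.
Proof.
elim: k f => [f []//|k IH f [cf df]]; split => // v.
by have [? ?] := df v; split => //; exact: IH.
Qed.

Lemma Ck_cst k (a : R) : Ck k (fun _ : E => a).
Proof.
elim: k a => [a|k IH a]; first exact: cst_continuous.
split; first exact: cst_continuous.
move=> v; split; first by move=> z; exact: derivable_cst.
by under eq_fun do rewrite derive_cst.
Qed.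

Lemma CkD k f g : Ck k f -> Ck k g -> Ck k (fun z => f z + g z).
Proof.
elim: k f g => [f g cf cg z|k IH f g kf kg]; first by apply: continuousD; [exact: cf|exact: cg].
split.
  by move=> z; apply: continuousD; [exact: (Ck_continuous kf)|exact: (Ck_continuous kg)].
move=> v; have df z : derivable f z v := Ck_derivable v z kf.
have dg z : derivable g z v := Ck_derivable v z kg.
split; first by move=> z; exact: derivableD.
under eq_fun do rewrite deriveD//.
by apply: IH; exact: Ck_derive.
Qed.

Lemma CkM k f g : Ck k f -> Ck k g -> Ck k (fun z => f z * g z).
Proof.
elim: k f g => [f g cf cg z|k IH f g kf kg]; first by apply: continuousM; [exact: cf|exact: cg].
split.
  by move=> z; apply: continuousM; [exact: (Ck_continuous kf)|exact: (Ck_continuous kg)].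
move=> v; have df z : derivable f z v := Ck_derivable v z kf.
have dg z : derivable g z v := Ck_derivable v z kg.
split; first by move=> z; exact: derivableM.
under eq_fun do rewrite deriveM//.
by apply: CkD; apply: IH; (exact: Ck_derive || exact: CkS).
Qed.

Lemma CkZ k (a : R) f : Ck k f -> Ck k (fun z => a * f z).
Proof. by move=> kf; apply: CkM => //; exact: Ck_cst. Qed.

Lemma CkN k f : Ck k f -> Ck k (fun z => - f z).
Proof. by move=> /(CkZ (-1)); under eq_fun do rewrite mulN1r. Qed.

Lemma CkB k f g : Ck k f -> Ck k g -> Ck k (fun z => f z - g z).
Proof. by move=> kf kg; apply: CkD => //; exact: CkN. Qed.

Lemma Ck_sum k (I : Type) (r : seq I) (P : pred I) (F : I -> E -> R) :
  (forall i, Ck k (F i)) -> Ck k (fun z => \sum_(i <- r | P i) F i z).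
Proof.
move=> kF; elim: r => [|i r IH].
  by under eq_fun do rewrite big_nil; exact: Ck_cst.
under eq_fun do rewrite big_cons; case: (P i) => //.
exact: CkD.
Qed.

Lemma CkX k f n : Ck k f -> Ck k (fun z => f z ^+ n).
Proof.
move=> kf; elim: n => [|n IH]; first by under eq_fun do rewrite expr0; exact: Ck_cst.
by under eq_fun do rewrite exprS; exact: CkM.
Qed.

Lemma is_derive_crd c z v : is_derive z v (fun w : E => crd c w) (crd c v).
Proof.
have h : (fun h : R => h^-1 *: (crd c (h *: v + z) - crd c z)) @ 0^' --> crd c v.
  apply: cvg_near_cst; near=> h.
  rewrite crdD crdZ addrK /GRing.scale/= mulKf//.
  by near: h; exact: nbhs_dnbhs_neq.
by apply: DeriveDef; [apply/cvg_ex; exists (crd c v)|exact: cvg_lim].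
Unshelve. all: by end_near. Qed.

Lemma Ck_crd k c : Ck k (fun z : E => crd c z).
Proof.
case: k => [|k]; first exact: crd_continuous.
split; first exact: crd_continuous.
move=> v; split; first by move=> z; have [] := is_derive_crd c z v.
under eq_fun => z do rewrite (@derive_val _ _ _ _ _ _ _ (is_derive_crd c z v)).
exact: Ck_cst.
Qed.

Lemma is_derive_line f z v (t : R) : derivable f (z + t *: v) v ->
  is_derive t (1 : R) (fun s : R => f (z + s *: v)) ('D_v f (z + t *: v)).
Proof.
have e : (fun h : R => h^-1 *: ((fun s : R => f (z + s *: v)) (h *: 1 + t)
     - (fun s : R => f (z + s *: v)) t)) =
   (fun h : R => h^-1 *: (f (h *: v + (z + t *: v)) - f (z + t *: v))).
  by apply/funext => h; rewrite [h *: 1]mulr1 scalerDl addrCA.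
move=> df; apply: DeriveDef; first by rewrite /derivable e.
by rewrite /derive e.
Qed.

(** Restriction to the line through [z] makes this a one-variable chain rule, so the derivative of
    [f] in the single direction [v] is enough. *)
Lemma is_derive_powR_comp f z v (p : R) : 0 < f z -> derivable f z v ->
  is_derive z v (fun w => f w `^ p) (p * f z `^ (p - 1) * 'D_v f z).
Proof.
move=> f0 df.
pose g (t : R) : R := f (z + t *: v).
have dg : is_derive (0 : R) (1 : R) g ('D_v f z).
  have := @is_derive_line f z v 0; rewrite scale0r addr0; exact.
have g0 : g 0 = f z by rewrite /g scale0r addr0.
have := is_derive1_powR p f0; rewrite -g0 => dp.
have d := @is_derive1_comp R (fun x : R => x `^ p) g _ _ _ dp dg.
have e : (fun h : R => h^-1 *: (((fun x : R => x `^ p) \o g) (h *: 1 + 0) - ((fun x : R => x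
  `^ p) \o g) 0)) =
   (fun h : R => h^-1 *: (f (h *: v + z) `^ p - f z `^ p)).
  by apply/funext => h; rewrite /= /g [h *: 1]mulr1 addr0 scale0r addr0 [z + h *: v]addrC.
case: d => d1 d2; apply: DeriveDef; first by move: d1; rewrite /derivable e.
by move: d2; rewrite /derive e => ->; rewrite g0.
Qed.

Lemma Ck_powR k f (p : R) : (forall z, 0 < f z) -> Ck k f ->
  Ck k (fun z => f z `^ p).
Proof.
move=> f0; have cp g : (forall z, 0 < g z) -> continuous g ->
    forall q : R, continuous (fun z : E => g z `^ q).
  move=> g0 cg q z; refine (@cvg_comp _ _ _ g (fun x : R => x `^ q) _ _ _ (cg z) _).
  have /derivable1_diffP h : derivable (fun x : R => x `^ q) (g z) 1.
    by have [] := is_derive1_powR q (g0 z).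
  exact: (differentiable_continuous h).
elim: k p => [p|k IH p kf]; first by move=> cf; exact: cp.
split; first by apply: cp => //; exact: Ck_continuous kf.
move=> v; have d z := is_derive_powR_comp p (f0 z) (Ck_derivable v z kf).
split; first by move=> z; have [] := d z.
under eq_fun => z do rewrite (@derive_val _ _ _ _ _ _ _ (d z)).
apply: CkM; last exact: Ck_derive.
by apply: CkZ; apply: IH; exact: CkS.
Qed.

Lemma MVT_line f z v (h : R) : (forall w, derivable f w v) ->
  exists2 s : R, `|s| <= `|h| & f (z + h *: v) - f z = h * 'D_v f (z + s *: v).
Proof.
move=> df; have d t := is_derive_line (df (z + t *: v)).
have cd : continuous (fun s : R => f (z + s *: v)).
  move=> s; apply: differentiable_continuous; apply/derivable1_diffP.
  by have [] := d s.
have [h0|h0] := leP 0 h.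
  have [s] := MVT_segment h0 (fun t _ => d t) (continuous_subspaceT cd).
  rewrite in_itv/= => /andP[s0 sh]; rewrite scale0r addr0 subr0 => ->.
  by exists s; [rewrite !ger0_norm|rewrite mulrC].
have [s] := MVT_segment (ltW h0) (fun t _ => d t) (continuous_subspaceT cd).
rewrite in_itv/= => /andP[sh s0]; rewrite scale0r addr0 sub0r => e.
exists s; first by rewrite !ler0_norm ?lerN2// ltW.
by rewrite -opprB e mulrN opprK mulrC.
Qed.

(** [Ck] only speaks of directional derivatives; differentiability makes them linear in the
    direction, as fields with variable coefficients require. The coordinates of the increment are
    added one at a time, and the mean value theorem on each leg compares a partial derivative near
    [z] with its value at [z]. *)
Lemma Ck_differentiable f z : Ck 1 f -> differentiable f z.
Proof.
move=> kf; pose df (h : E) : R := \sum_c crd c h * 'D_(bas c) f z.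
have ldf : linear df.
  move=> a h h'; rewrite /df /GRing.scale/= mulr_sumr -big_split/=.
  by apply: eq_bigr => c _; rewrite crdD crdZ mulrDl mulrA.
pose ldf_ := GRing.isLinear.Build _ _ _ _ df ldf.
pose dfL : {linear E -> R} := HB.pack df ldf_.
have cdf : continuous dfL.
  apply: (@Ck_continuous 0); apply: Ck_sum => c.
  by apply: CkM; [exact: Ck_crd|exact: Ck_cst].
apply: (linear_approx_differentiable cdf) => e e0.
(* One more than the number of coordinates: [N] is positive even without coordinates, and the errors
   [e / N] still add up to at most [e]. *)
pose N : R := #|{: J}|.+1%:R.
have N0 : 0 < N by [].
have eN0 : 0 < e / N by rewrite divr_gt0.
have cD c : \forall w \near z, `|'D_(bas c) f z - 'D_(bas c) f w| < e / N.
  have /cvgrPdist_lt := Ck_continuous (Ck_derive (bas c) kf) (x := z).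
  exact.
have /nbhs_ballP[d /= d0 dP] : \forall w \near z, forall c,
    `|'D_(bas c) f z - 'D_(bas c) f w| < e / N.
  exact: (@filter_forall _ _ (fun c w => `|'D_(bas c) f z - 'D_(bas c) f w| < e / N) (nbhs z)
    _ cD).
near=> h.
have hd : `|h| < d by near: h; apply/nbhs_ballP; exists d => // y;
    by rewrite -ball_normE/= sub0r normrN.
have step (s : seq J) : uniq s ->
    `|f (z + \sum_(c <- s) crd c h *: bas c) - f z -
      \sum_(c <- s) crd c h * 'D_(bas c) f z| <= \sum_(c <- s) `|crd c h| * (e / N).
  elim: s => [|c s IH] /=; first by rewrite !big_nil addr0 subrr subr0 normr0.
  move=> /andP[cs us]; rewrite !big_cons.
  set w := \sum_(j <- s) crd j h *: bas j.
  set T := \sum_(j <- s) crd j h * 'D_(bas j) f z.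
  have [t th] := MVT_line (z + w) (crd c h) (fun w => Ck_derivable (bas c) w kf).
  rewrite -addrA [w + _]addrC => e1.
  rewrite (_ : _ - _ - _ = (f (z + w) - f z - T) +
     crd c h * ('D_(bas c) f (z + w + t *: bas c) - 'D_(bas c) f z)); last first.
    by rewrite mulrBr -e1; ring.
  rewrite addrC (le_trans (ler_normD _ _))// lerD ?IH//.
  rewrite normrM ler_wpM2l// distrC ltW//; apply: dP.
  rewrite -ball_normE/= opprD addrA (opprD z) addrA subrr sub0r -opprD normrN.
  apply: crd_norm_lt => // b; rewrite crdD crdZ crd_bas /w crd_sum.
  under eq_bigr do rewrite crdZ crd_bas.
  rewrite big_uniq//= ; have [bc|bc] := eqVneq b c.
    subst c; rewrite mulr1 big1 ?add0r; last first.
      move=> i si; case: eqP => [bi|]; last by rewrite mulr0.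
      by move: cs; rewrite bi si.
    by rewrite (le_lt_trans th)// (le_lt_trans (crd_norm _ _)).
  rewrite mulr0 addr0; have [bs|bs] := boolP (b \in s).
    rewrite (bigD1 b)//= eqxx mulr1 big1 ?addr0.
      by rewrite (le_lt_trans (crd_norm _ _)).
    by move=> i /andP[_ ib]; rewrite eq_sym (negbTE ib) mulr0.
  rewrite big1 ?normr0// => i si; case: eqP => [bi|]; last by rewrite mulr0.
  by move: bs; rewrite bi si.
have := step _ (index_enum_uniq _); rewrite -sum_basE => hle.
rewrite [h + z]addrC; apply: (le_trans hle).
apply: (@le_trans _ _ (\sum_(c : J) `|h| * (e / N))).
  by apply: ler_sum => c _; rewrite ler_wpM2r ?crd_norm// ltW.
rewrite sumr_const -mulr_natl mulrCA [leRHS]mulrC ler_wpM2l//.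
rewrite mulrCA ler_piMr ?(ltW e0)// ler_pdivrMr// mul1r /N ler_nat.
exact: leqnSn.
Unshelve. all: by end_near. Qed.

Lemma derive_bas f z v : Ck 1 f ->
  'D_v f z = \sum_c crd c v * 'D_(bas c) f z.
Proof.
move=> kf; have df := Ck_differentiable z kf.
rewrite deriveE// [in LHS](sum_basE v) linear_sum.
by apply: eq_bigr => c _; rewrite linearZ deriveE.
Qed.

Lemma is_derive_curve f (g : R -> E) (t : R) (w : E) : Ck 1 f ->
  is_derive t (1 : R) g w ->
  is_derive t (1 : R) (f \o g) (\sum_c crd c w * 'D_(bas c) f (g t)).
Proof.
move=> kf [/derivable1_diffP dg gw].
have df := Ck_differentiable (g t) kf.
have dfg : differentiable (f \o g) t by exact: differentiable_comp.
apply: DeriveDef; first exact: diff_derivable.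
by rewrite deriveE// diff_comp//= -derive_bas// deriveE// -gw deriveE.
Qed.

End Ck_theory.
Arguments Ck_derivable {R m k f} v z.
Arguments Ck_derive {R m k f} v.

(** * Integration over the sphere and rotation generators *)

Section sphere_integral_theory.
Context {R : realType} {m : nat}.
Local Notation E := (Cspace R m).
Local Notation J := ('I_m + 'I_m)%type.
Local Notation V := ((m + m).-tuple (measurableTypeR R)).
Local Notation mu := (@sphere_measure R m).
Local Notation S := (@pt R m @^-1` @sphere R m).
Implicit Types (f g : E -> R) (a b c : J).

Definition sint g : R := \int[mu]_(v in S) g (pt v).

Definition sintegrable g := mu.-integrable S (fun v => (g (pt v))%:E).

Lemma sphere_measure_lty : (mu S < +oo)%E.
Proof.
apply: (@le_lt_trans _ _ (mu setT)).
  by apply: le_measure; rewrite ?inE//; exact: measurable_preimage_sphere.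
by have e : mu setT = _ := @sphere_measureT R m; rewrite e ltry.
Qed.

Lemma eq_sint f g : (forall z, sphere z -> f z = g z) -> sint f = sint g.
Proof. by move=> fg; apply: eq_Rintegral => v; rewrite inE => /fg. Qed.

Lemma bounded_sintegrable g (M : R) : measurable_fun S (fun v => g (pt v)) ->
  (forall z, sphere z -> `|g z| <= M) -> sintegrable g.
Proof.
move=> mg gM; apply: measurable_bounded_integrable => //.
- exact: measurable_preimage_sphere.
- exact: sphere_measure_lty.
- exists M; split; first exact: num_real.
  by move=> x Mx v Sv; rewrite /= (le_trans (gM _ Sv))// ltW.
Qed.

Lemma continuous_sintegrable g : continuous g -> sintegrable g.
Proof.
move=> cg; have [M _ gM] := sphere_bounded cg.
apply: (bounded_sintegrable _ gM); apply: measurable_funTS.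
exact: measurable_continuous_pt.
Qed.
Hint Resolve continuous_sintegrable : core.

Let mS := @measurable_preimage_sphere R m.

Lemma sintD f g : sintegrable f -> sintegrable g ->
  sint (fun z => f z + g z) = sint f + sint g.
Proof. by move=> *; rewrite /sint RintegralD. Qed.

Lemma sintB f g : sintegrable f -> sintegrable g ->
  sint (fun z => f z - g z) = sint f - sint g.
Proof. by move=> *; rewrite /sint RintegralB. Qed.

Lemma sintZ (k : R) g : sintegrable g -> sint (fun z => k * g z) = k * sint g.
Proof. by move=> *; rewrite /sint RintegralZl. Qed.

Lemma sint_cst (k : R) : sint (fun=> k) = k * fine (mu S).
Proof. by rewrite /sint Rintegral_cst. Qed.

Lemma le_sint f g : sintegrable f -> sintegrable g ->
  (forall z, sphere z -> f z <= g z) -> sint f <= sint g.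
Proof. by move=> If Ig fg; apply: le_Rintegral => // v; exact: fg. Qed.

Lemma sint_ge0 f : (forall z, sphere z -> 0 <= f z) -> 0 <= sint f.
Proof. by move=> f0; apply: Rintegral_ge0 => v; exact: f0. Qed.

Lemma le_norm_sint f : sintegrable f -> `|sint f| <= sint (fun z => `|f z|).
Proof. by move=> If; exact: le_normr_Rintegral. Qed.

Lemma sintegrableM f g (M : R) : sintegrable f ->
  measurable_fun S (fun v => g (pt v)) -> (forall z, sphere z -> `|g z| <= M) ->
  sintegrable (fun z => f z * g z).
Proof.
move=> If mg gM; rewrite /sintegrable; under eq_fun do rewrite EFinM.
apply: (@integrableMl _ _ _ _ _ mS) => //.
exists M; split; first exact: num_real.
by move=> x Mx v Sv; rewrite /= (le_trans (gM _ Sv))// ltW.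
Qed.

Lemma sint_sum (I : Type) (r : seq I) (F : I -> E -> R) :
  (forall i, continuous (F i)) ->
  sint (fun z => \sum_(i <- r) F i z) = \sum_(i <- r) sint (F i).
Proof.
move=> cF; elim: r => [|i r IH].
  by rewrite big_nil; under eq_sint do rewrite big_nil; rewrite sint_cst mul0r.
rewrite big_cons -IH -sintD; [|exact: continuous_sintegrable|].
  by apply: eq_sint => z _; rewrite big_cons.
by apply: continuous_sintegrable; apply: (@Ck_continuous _ _ 0); exact: Ck_sum.
Qed.

(** The rotation as [z] plus corrections along two basis vectors, a form that is differentiated term
    by term in the angle. *)
Definition rotE a b (co si : R) (z : E) : E :=
  z + ((co - 1) * crd a z - si * crd b z) *: bas a
    + (si * crd a z + (co - 1) * crd b z) *: bas b.

Lemma unsplit_inj : injective (@unsplit m m).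
Proof. exact: (can_inj (@unsplitK m m)). Qed.

Lemma pt_rot a b co si (v : V) : a != b ->
  pt (rot_plane (unsplit a) (unsplit b) co si v) = rotE a b co si (pt v).
Proof.
move=> ab; have ba : (b == a) = false by rewrite eq_sym (negbTE ab).
apply: crd_inj => c; rewrite crd_pt tnth_mktuple !(inj_eq unsplit_inj).
rewrite /rotE !crdD !crdZ !crd_bas !crd_pt.
have [->|ca] := eqVneq c a; first by rewrite (negbTE ab) /=; ring.
have [->|cb] := eqVneq c b; first by rewrite /=; ring.
by rewrite /=; ring.
Qed.

Lemma sphere_rotE a b co si z : a != b -> co ^+ 2 + si ^+ 2 = 1 ->
  sphere (rotE a b co si z) <-> sphere z.
Proof.
move=> ab cs; have ba : b != a by rewrite eq_sym.
suff e : \sum_c crd c (rotE a b co si z) ^+ 2 = \sum_c crd c z ^+ 2.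
  by rewrite !sphere_crdP e.
rewrite (bigD1 a)//= [RHS](bigD1 a)//= (bigD1 b)//= [X in _ = _ + X](bigD1 b)//=.
rewrite !addrA; congr (_ + _).
  rewrite /rotE !crdD !crdZ !crd_bas !eqxx (negbTE ab) (negbTE ba) /=.
  have -> : forall x y : R,
    (x + ((co - 1) * x - si * y) * 1 + (si * x + (co - 1) * y) * 0) ^+ 2 +
    (y + ((co - 1) * x - si * y) * 0 + (si * x + (co - 1) * y) * 1) ^+ 2 =
    (co ^+ 2 + si ^+ 2) * (x ^+ 2 + y ^+ 2) by move=> x y; ring.
  by rewrite cs mul1r.
apply: eq_bigr => c /andP[ca cb]; congr (_ ^+ 2).
by rewrite /rotE !crdD !crdZ !crd_bas (negbTE ca) (negbTE cb) /=; ring.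
Qed.

Lemma continuous_rotE a b co si : continuous (rotE a b co si).
Proof.
move=> z; apply/cvgrPdist_lt => e e0.
have h c : \forall w \near z, `|crd c (rotE a b co si z) - crd c (rotE a b co si w)| < e.
  have H k : Ck k (fun z => crd c (rotE a b co si z)).
    rewrite /rotE; under eq_fun do rewrite !crdD !crdZ ![_ * crd c _]mulrC.
    apply: CkD; [apply: CkD|]; first exact: Ck_crd.
      by apply: CkZ; apply: CkB; apply: CkZ; exact: Ck_crd.
    by apply: CkZ; apply: CkD; apply: CkZ; exact: Ck_crd.
  by move: (Ck_continuous (H 0%N)) => /(_ z)/cvgrPdist_lt; apply.
have hh : \forall w \near z, forall c,
    `|crd c (rotE a b co si z) - crd c (rotE a b co si w)| < e.
  exact: (@filter_forall _ _ (fun c w => `|crd c (rotE a b co si z) -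
    crd c (rotE a b co si w)| < e) (nbhs z) _ h).
near=> w; apply: crd_norm_lt => // c; rewrite crdB; move: c; near: w.
exact: hh.
Unshelve. all: by end_near. Qed.

Lemma continuous_comp_rotE a b co si g : continuous g ->
  continuous (fun z => g (rotE a b co si z)).
Proof.
move=> cg z; refine (@cvg_comp _ _ _ _ g _ _ _ (@continuous_rotE a b co si z) _).
exact: cg.
Qed.

Lemma sint_rotE a b (co si : R) g : a != b -> continuous g ->
  co ^+ 2 + si ^+ 2 = 1 -> 1 + co != 0 ->
  sint (g \o rotE a b co si) = sint g.
Proof.
move=> ab cg cs co1; rewrite /sint /Rintegral; congr fine.
pose rot := @rot_plane R _ (unsplit a) (unsplit b) co si.
have mr : measurable_fun setT rot by exact: measurable_rot_plane.
have ab' : unsplit a != unsplit b by rewrite (inj_eq unsplit_inj).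
pose nu := measure_function_pushforward__canonical__measure_function_Measure mu mr.
rewrite [RHS](@eq_measure_integral _ _ _ _ nu); last first.
  by move=> A mA _; exact: sphere_measure_rot.
have rS : rot @^-1` S = S.
  apply/seteqP; split => v; rewrite /= /rot pt_rot// => h.
    by apply/(sphere_rotE _ ab cs).
  by apply/(sphere_rotE _ ab cs).
rewrite [RHS](@integral_pushforward _ _ _ _ _ rot)//.
- rewrite rS; apply: eq_integral => v _ /=; rewrite /rot pt_rot//.
- by apply/measurable_EFinP; exact: measurable_continuous_pt.
- rewrite rS /comp /rot; under eq_fun do rewrite pt_rot//.
  exact: (continuous_sintegrable (continuous_comp_rotE cg)).
Qed.

(** The infinitesimal generator of the rotations [rotE a b]. *)
Definition Xop a b g z : R := crd a z * 'D_(bas b) g z - crd b z * 'D_(bas a) g z.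

Lemma is_derive_rotE a b g z (t : R) : a != b -> Ck 1 g ->
  is_derive t (1 : R) (fun s => g (rotE a b (cos s) (sin s) z))
    (Xop a b g (rotE a b (cos t) (sin t) z)).
Proof.
move=> ab kg; have ba : b != a by rewrite eq_sym.
pose k1 (s : R) : R := (cos s - 1) * crd a z - sin s * crd b z.
pose k2 (s : R) : R := sin s * crd a z + (cos s - 1) * crd b z.
have d1 : is_derive t (1 : R) k1 (- sin t * crd a z - cos t * crd b z).
  by apply: is_derive_eq; rewrite /GRing.scale/=; ring.
have d2 : is_derive t (1 : R) k2 (cos t * crd a z - sin t * crd b z).
  by apply: is_derive_eq; rewrite /GRing.scale/=; ring.
have dl k (dk : R) (w : E) : is_derive t (1 : R) k dk ->
    is_derive t (1 : R) (fun s => k s *: w) (dk *: w).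
  move=> [/derivable1_diffP hk hk']; have := differentiableZl w hk => h.
  apply: DeriveDef; first exact: diff_derivable.
  by rewrite deriveE// diffZl// -deriveE// hk'.
have dg : is_derive t (1 : R) (fun s => rotE a b (cos s) (sin s) z)
    ((- sin t * crd a z - cos t * crd b z) *: bas a +
     (cos t * crd a z - sin t * crd b z) *: bas b).
  have D1 := dl _ _ (bas a) d1; have D2 := dl _ _ (bas b) d2.
  have D0 : is_derive t (1 : R) (fun s : R => z) 0 by exact: is_derive_cst.
  have := is_deriveD (is_deriveD D0 D1) D2; rewrite add0r.
  exact.
have := is_derive_curve kg dg; rewrite /comp => h; apply: is_derive_eq h _.
rewrite (bigD1 a)//= (bigD1 b)//= big1 ?addr0; last first.
  move=> c /andP[ca cb]; rewrite crdD !crdZ !crd_bas (negbTE ca) (negbTE cb).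
  by rewrite !mulr0 addr0 mul0r.
rewrite /Xop /rotE !crdD !crdZ !crd_bas !eqxx (negbTE ab) (negbTE ba) /=.
ring.
Qed.

Lemma continuous_Xop a b g : Ck 1 g -> continuous (Xop a b g).
Proof.
move=> kg; apply: (@Ck_continuous _ _ 0); apply: CkB; apply: CkM;
  by [exact: Ck_crd|exact: Ck_derive].
Qed.

(* The rotation flow preserves the measure: differentiate its integral. *)
Lemma sint_Xop a b g : Ck 1 g -> sint (Xop a b g) = 0.
Proof.
move=> kg; have [->|ab] := eqVneq a b.
  under eq_sint => z _ do rewrite /Xop subrr.
  by rewrite sint_cst mul0r.
have cX : continuous (Xop a b g) by exact: continuous_Xop.
have cg := Ck_continuous kg.
have [M M0 XM] := sphere_bounded cX.
pose f (t : R) (v : V) := g (rotE a b (cos t) (sin t) (pt v)).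
have df t v := is_derive_rotE (pt v) t ab kg.
have Sr t z : sphere z -> sphere (rotE a b (cos t) (sin t) z).
  by move=> ?; apply/sphere_rotE => //; exact: cos2Dsin2.
have I0 : `](-1 : R), 1[%classic 0 by rewrite /= in_itv/= ltr01 ltrN10.
have := @cvg_differentiation_under_integral R _ V mu f S mS 0 (-1) 1 I0.
have p1 (t : R) y : partial1of2 f t y = Xop a b g (rotE a b (cos t) (sin t) (pt y)).
  by rewrite partial1of2E; have [_ ->] := df t y.
move=> /(_ _ _ (fun _ => M)) h.
have {h} h := h _ _ (fun _ => M0) _ _.
have {h} : h^-1 *: ((\int[mu]_(y in S) f (h + 0) y) - \int[mu]_(y in S) f 0 y) @[h --> (0 :
  R)^'] -->
   \int[mu]_(y in S) partial1of2 f 0 y.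
  apply: h.
  - move=> x _; exact: (continuous_sintegrable (continuous_comp_rotE cg)).
  - by move=> x y _ _; have [] := df x y.
  - have := @continuous_sintegrable (fun=> M); apply; exact: cst_continuous.
  - by move=> x y _ Sy; rewrite p1; apply: XM; exact: Sr.
have -> : \int[mu]_(y in S) partial1of2 f 0 y = sint (Xop a b g).
  apply: eq_Rintegral => v _; rewrite p1 cos0 sin0; congr (Xop _ _ _ _).
  by rewrite /rotE subrr !mul0r subrr addr0 !scale0r !addr0.
move=> h; apply/esym; move: h; apply: cvg_unique; first exact: norm_hausdorff.
apply: cvg_near_cst; near=> t.
suff -> : \int[mu]_(y in S) f (t + 0) y = \int[mu]_(y in S) f 0 y by rewrite subrr scaler0.
have st (s : R) : `|s| < 1 -> \int[mu]_(y in S) f s y = sint g.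
  move=> s1; apply: sint_rotE => //; first exact: cos2Dsin2.
  rewrite gt_eqF// ltr_wpDl// cos_gt0_pihalf//.
  move: s1; rewrite ltr_norml => /andP[s1 s2].
  by have h1 := @pihalf_ge1 R; apply/andP; split; lra.
rewrite !st ?normr0// addr0.
near: t; apply: dnbhs0_lt; exact: ltr01.
Unshelve. all: by end_near. Qed.

End sphere_integral_theory.

(** * Complex structure and horizontal projection *)

Section inner_product.
Context {R : realType} {m : nat}.
Local Notation E := (Cspace R m).
Local Notation J := ('I_m + 'I_m)%type.
Implicit Types (w z : E) (c : J).

Definition dot w z : R := \sum_c crd c w * crd c z.

(** Multiplication by i. Thus [Jv z] is the velocity of e^(i theta) z at theta = 0, and the
    derivative along it is the field T. *)
Definition Jv z : E := (- z.2, z.1).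

Lemma dotC w z : dot w z = dot z w.
Proof. by apply: eq_bigr => c _; rewrite mulrC. Qed.

Lemma dotDr w z z' : dot w (z + z') = dot w z + dot w z'.
Proof. by rewrite /dot -big_split; apply: eq_bigr => c _; rewrite crdD mulrDr. Qed.

Lemma dotZr w k z : dot w (k *: z) = k * dot w z.
Proof. by rewrite /dot mulr_sumr; apply: eq_bigr => c _; rewrite crdZ mulrCA. Qed.

Lemma dotNr w z : dot w (- z) = - dot w z.
Proof. by rewrite -scaleN1r dotZr mulN1r. Qed.

Lemma dotBr w z z' : dot w (z - z') = dot w z - dot w z'.
Proof. by rewrite dotDr dotNr. Qed.

Lemma dotZl w k z : dot (k *: w) z = k * dot w z.
Proof. by rewrite dotC dotZr dotC. Qed.

Lemma dotBl w w' z : dot (w - w') z = dot w z - dot w' z.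
Proof. by rewrite dotC dotBr !(dotC z). Qed.

Lemma dot_basr w c : dot w (bas c) = crd c w.
Proof.
rewrite /dot (bigD1 c)//= crd_bas eqxx mulr1 big1 ?addr0// => d dc.
by rewrite crd_bas (negbTE dc) mulr0.
Qed.

Lemma JvK z : Jv (Jv z) = - z.
Proof. by case: z. Qed.

Lemma crd_Jv_inl j z : crd (inl j) (Jv z) = - crd (inr j) z.
Proof. by rewrite /= mxE. Qed.

Lemma crd_Jv_inr j z : crd (inr j) (Jv z) = crd (inl j) z.
Proof. by []. Qed.

Lemma dot_JvJv w z : dot (Jv w) (Jv z) = dot w z.
Proof.
rewrite /dot !big_sumType/= addrC; congr (_ + _).
by apply: eq_bigr => j _; rewrite !mxE mulrNN.
Qed.

Lemma dot_Jvl w z : dot (Jv w) z = - dot w (Jv z).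
Proof.
have e : z = - Jv (Jv z) by rewrite JvK opprK.
by rewrite {1}e dotNr dot_JvJv.
Qed.

Lemma dot_Jv z : dot z (Jv z) = 0.
Proof.
by have := dot_Jvl z z; rewrite dotC; move/eqP; rewrite -subr_eq0 opprK -mulr2n mulrn_eq0/= =>
  /eqP.
Qed.

Lemma sphere_dotP z : sphere z <-> dot z z = 1.
Proof.
rewrite sphere_crdP /dot.
by under eq_bigr do rewrite expr2.
Qed.

(** On the sphere, the orthogonal projection of [bas c] onto the horizontal space at [z]. These 2m
    fields are not independent, but they span the horizontal space at each point of the sphere. *)
Definition zvec c z : E := bas c - crd c z *: z - crd c (Jv z) *: Jv z.

(* The orthogonal projection away from the complex line spanned by z, when z
   is on the sphere. *)
Definition hproj z w : E := w - dot w z *: z - dot w (Jv z) *: Jv z.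

(** [hproj z] is a symmetric operator, also at points off the sphere. *)
Lemma dot_zvec w c z : dot w (zvec c z) = crd c (hproj z w).
Proof.
by rewrite /zvec /hproj !dotBr !dotZr dot_basr !crdB !crdZ ![dot w _ * _]mulrC.
Qed.

Lemma dot_hproj z w w' : sphere z ->
  dot (hproj z w) (hproj z w') = dot w w' - dot w z * dot w' z - dot w (Jv z) * dot w' (Jv z).
Proof.
move=> /sphere_dotP z1; rewrite /hproj !(dotBl, dotBr, dotZl, dotZr).
rewrite dot_JvJv z1 dot_Jv [dot (Jv z) z]dotC dot_Jv.
by rewrite [dot z w']dotC [dot (Jv z) w']dotC; ring.
Qed.

Lemma Ck_dot k w : Ck k (fun z : E => dot w z).
Proof. by apply: Ck_sum => c; apply: CkZ; exact: Ck_crd. Qed.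

Lemma Ck_crd_Jv k c : Ck k (fun z : E => crd c (Jv z)).
Proof.
case: c => j; last exact: (Ck_crd k (inl j)).
under eq_fun do rewrite crd_Jv_inl.
exact: (CkN (Ck_crd k (inr j))).
Qed.

Lemma Ck_crd_zvec k c d : Ck k (fun z : E => crd d (zvec c z)).
Proof.
rewrite /zvec; under eq_fun do rewrite !crdB !crdZ.
apply: CkB; [apply: CkB|]; first exact: Ck_cst.
  by apply: CkM; exact: Ck_crd.
by apply: CkM; exact: Ck_crd_Jv.
Qed.

Lemma derive_crd v z c : 'D_v (fun z : E => crd c z) z = crd c v.
Proof. by have [_ ->] := is_derive_crd c z v. Qed.

Lemma derive_dot v z w : 'D_v (fun z : E => dot w z) z = dot w v.
Proof.
apply: cvg_lim => //; apply: cvg_near_cst; near=> h.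
rewrite /= dotDr dotZr addrK /GRing.scale/= mulKf//.
by near: h; exact: nbhs_dnbhs_neq.
Unshelve. all: by end_near. Qed.

End inner_product.

(** * Horizontal fields and integration by parts *)

Section horizontal_fields.
Context {R : realType} {m : nat}.
Local Notation E := (Cspace R m).
Local Notation J := ('I_m + 'I_m)%type.
Local Notation N := (m + m)%:R.
Implicit Types (f g : E -> R) (v w z : E) (c : J).

Definition Zop c g z : R := 'D_(zvec c z) g z.

(** The sub-Laplacian on real functions; [sublaplacianE] identifies the two, at every point of
    C^m. *)
Definition Lap g z : R := \sum_c Zop c (Zop c g) z.

Lemma Zop_Ck k c g : Ck k.+1 g -> Ck k (Zop c g).
Proof.
move=> kg; have k1 : Ck 1 g.
  by elim: k kg => // k IH /CkS.
rewrite (_ : Zop c g = fun z => \sum_d crd d (zvec c z) * 'D_(bas d) g z).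
  apply: Ck_sum => d; apply: CkM; first exact: Ck_crd_zvec.
  exact: Ck_derive.
by apply/funext => z; rewrite /Zop derive_bas.
Qed.

Lemma Lap_Ck k g : Ck k.+2 g -> Ck k (Lap g).
Proof. by move=> kg; apply: Ck_sum => c; do 2 apply: Zop_Ck. Qed.

Lemma ZopD c f g z : Ck 1 f -> Ck 1 g ->
  Zop c (fun z => f z + g z) z = Zop c f z + Zop c g z.
Proof. by move=> kf kg; rewrite /Zop deriveD//; [exact: (Ck_derivable _ _ kf)|exact:
  (Ck_derivable _ _ kg)]. Qed.

Lemma ZopM c f g z : Ck 1 f -> Ck 1 g ->
  Zop c (fun z => f z * g z) z = f z * Zop c g z + g z * Zop c f z.
Proof. by move=> kf kg; rewrite /Zop deriveM//; [exact: (Ck_derivable _ _ kf)|exact: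
  (Ck_derivable _ _ kg)]. Qed.

Lemma Zop_cst c (k : R) z : Zop c (fun=> k) z = 0.
Proof. by rewrite /Zop derive_cst. Qed.

Lemma ZopZ c (k : R) g z : Ck 1 g -> Zop c (fun z => k * g z) z = k * Zop c g z.
Proof.
move=> kg; have := @ZopM c (fun=> k) g z (Ck_cst 1 k) kg.
by rewrite Zop_cst mulr0 addr0.
Qed.

Lemma ZopB c f g z : Ck 1 f -> Ck 1 g ->
  Zop c (fun z => f z - g z) z = Zop c f z - Zop c g z.
Proof. by move=> kf kg; rewrite /Zop deriveB//; [exact: (Ck_derivable _ _ kf)|exact:
  (Ck_derivable _ _ kg)]. Qed.

Lemma Zop_powR c f (p : R) z : (forall z, 0 < f z) -> Ck 1 f ->
  Zop c (fun z => f z `^ p) z = p * f z `^ (p - 1) * Zop c f z.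
Proof.
move=> f0 kf.
by have [_ h] := is_derive_powR_comp p (f0 z) (Ck_derivable (zvec c z) z kf); exact: h.
Qed.

Lemma Zop_dot c w z : Zop c (fun z => dot w z) z = crd c (hproj z w).
Proof. by rewrite /Zop derive_dot dot_zvec. Qed.

Lemma ZopE c g z : Ck 1 g ->
  Zop c g z = 'D_(bas c) g z - crd c z * 'D_z g z - crd c (Jv z) * 'D_(Jv z) g z.
Proof.
move=> kg; have d := Ck_differentiable z kg.
by rewrite /Zop /zvec !deriveE// !linearB/= !linearZ.
Qed.

(** The same combination of the vectors [zvec c z] is the horizontal projection of [z] itself, which
    is 0. *)
Lemma sum_crd_Zop g z : Ck 1 g -> sphere z -> \sum_c crd c z * Zop c g z = 0.
Proof.
move=> kg /sphere_dotP z1; under eq_bigr do rewrite ZopE// !mulrBr !mulrA.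
rewrite !sumrB -!mulr_suml -[X in _ - X - _]/(dot z z * _).
by rewrite -[X in _ - _ - X]/(dot z (Jv z) * _) z1 dot_Jv mul1r mul0r subr0 -derive_bas// subrr.
Qed.

(** The circle action rotates all the complex coordinate planes at once, so its generator is a sum
    of generators [Xop]. *)
Lemma sint_Top g : Ck 1 g -> sint (fun z => 'D_(Jv z) g z) = 0.
Proof.
move=> kg; rewrite (@eq_sint _ _ _ (fun z => \sum_(j < m) Xop (inl j) (inr j) g z)).
  rewrite sint_sum; last by move=> j; exact: continuous_Xop.
  by rewrite big1// => j _; exact: sint_Xop.
move=> z _; rewrite derive_bas// big_sumType/= -big_split/=.
by apply: eq_bigr => j _; rewrite /Xop /= mxE addrC mulNr.
Qed.

(** The sum over b of [Xop b c] applied to x_b g restores on the sphere the part of [Zop c g]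
    without its T component, up to a term (N - 1) x_c g. The T component is the T derivative of a
    product, up to a term that takes back one x_c g. Both derivatives integrate to 0, which leaves
    the factor N - 2. *)
Lemma sint_Zop c g : Ck 1 g ->
  sint (Zop c g) = (N - 2) * sint (fun z => crd c z * g z).
Proof.
move=> kg; have kc b : Ck 1 (fun z : E => crd b z * g z).
  by apply: CkM => //; exact: Ck_crd.
have kJ : Ck 1 (fun z : E => crd c (Jv z) * g z).
  by apply: CkM => //; exact: Ck_crd_Jv.
have Ic b : continuous (Xop b c (fun z => crd b z * g z)) by exact: continuous_Xop.
pose X z := \sum_b Xop b c (fun z => crd b z * g z) z.
have cX : continuous X by apply: (@Ck_continuous _ _ 0); exact: Ck_sum.
have cT : continuous (fun z => 'D_(Jv z) (fun z => crd c (Jv z) * g z) z).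
  under eq_fun do rewrite derive_bas//.
  apply: (@Ck_continuous _ _ 0).
  by apply: Ck_sum => d; apply: CkM; [exact: Ck_crd_Jv|exact: Ck_derive].
rewrite (@eq_sint _ _ _ (fun z => X z - 'D_(Jv z) (fun z => crd c (Jv z) * g z) z +
  (N - 2) * (crd c z * g z))).
  rewrite sintD; last 2 first.
  - apply: continuous_sintegrable; apply: (@Ck_continuous _ _ 0); exact: CkB.
  - apply: continuous_sintegrable; apply: (@Ck_continuous _ _ 0); apply: CkZ.
    exact: Ck_continuous (kc c).
  rewrite sintB; [|exact: continuous_sintegrable|exact: continuous_sintegrable].
  rewrite sint_Top// sint_sum// big1 ?subr0 ?add0r; last by move=> b _; exact: sint_Xop.
  by rewrite sintZ//; apply: continuous_sintegrable; exact: Ck_continuous (kc c).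
move=> z /sphere_dotP z1; rewrite ZopE//.
have dg v : derivable g z v := Ck_derivable v z kg.
have dM v (f : E -> R) : Ck 1 f ->
  'D_v (fun z => f z * g z) z = f z * 'D_v g z + g z * 'D_v f z.
  by move=> kf; rewrite deriveM//; exact: (Ck_derivable _ _ kf).
rewrite dM; last exact: Ck_crd_Jv.
have -> : 'D_(Jv z) (fun z => crd c (Jv z)) z = - crd c z.
  rewrite (_ : (fun z => _) = fun z : E => dot (- Jv (bas c)) z); last first.
    by apply/funext => w; rewrite -dotC dotNr dotC dot_Jvl opprK dotC dot_basr.
  by rewrite derive_dot dotC dotNr dotC dot_JvJv dotC dot_basr.
have -> : X z = 'D_(bas c) g z + crd c z * g z - crd c z * 'D_z g z - N * (crd c z * g z).
  have XE b : Xop b c (fun z => crd b z * g z) z =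
      crd b z * crd b z * 'D_(bas c) g z + crd b z * (b == c)%:R * g z
      - crd c z * (crd b z * 'D_(bas b) g z) - crd c z * g z.
    rewrite /Xop !dM; [|exact: Ck_crd|exact: Ck_crd].
    by rewrite !derive_crd !crd_bas eqxx /=; ring.
  rewrite /X; under eq_bigr do rewrite XE.
  rewrite !sumrB big_split/= -!mulr_suml -mulr_sumr -derive_bas// sumr_const.
  rewrite -[\sum_i crd i z * crd i z]/(dot z z) z1 mul1r.
  rewrite (bigD1 c)//= eqxx mulr1 big1 ?addr0; last by move=> b bc; rewrite (negbTE bc) mulr0.
  by rewrite card_sum card_ord -(mulr_natl (crd c z)) -mulrA.
move: (N : R) ('D_(bas c) g z) ('D_z g z) ('D_(Jv z) g z) (crd c (Jv z)) (crd c z) (g z) => *.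
ring.
Qed.

(** The difference of the integrands is the sum over c of [Zop c (W c)]. By [sint_Zop] its integral
    is a multiple of that of the sum of x_c [W c], which vanishes on the sphere by [sum_crd_Zop]. *)
Lemma Lap_sym f g : Ck 2 f -> Ck 2 g ->
  sint (fun z => g z * Lap f z) = sint (fun z => f z * Lap g z).
Proof.
move=> kf kg; have kf1 := CkS kf; have kg1 := CkS kg.
have kZ h c : Ck 2 h -> Ck 1 (Zop c h) by exact: Zop_Ck.
pose W c z := g z * Zop c f z - f z * Zop c g z.
have kW c : Ck 1 (W c) by apply: CkB; apply: CkM => //; exact: kZ.
have cL h : Ck 2 h -> continuous (Lap h).
  by move=> kh; apply: (@Ck_continuous _ _ 0); exact: Lap_Ck.
have cML h k : Ck 2 h -> Ck 2 k -> sintegrable (fun z => h z * Lap k z).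
  move=> kh kk; apply: continuous_sintegrable; apply: (@Ck_continuous _ _ 0); apply: CkM.
    exact: Ck_continuous kh.
  exact: cL.
apply/eqP; rewrite -subr_eq0 -sintB; [|exact: cML|exact: cML].
rewrite (@eq_sint _ _ _ (fun z => \sum_c Zop c (W c) z)); last first.
  move=> z _; rewrite /Lap !mulr_sumr -sumrB; apply: eq_bigr => c _.
  rewrite ZopB; [|by apply: CkM => //; exact: kZ|by apply: CkM => //; exact: kZ].
  rewrite (ZopM c z kg1 (kZ f c kf)) (ZopM c z kf1 (kZ g c kg)).
  by move: (Zop c (Zop c f) z) (Zop c (Zop c g) z) (Zop c f z) (Zop c g z) (f z) (g z) => *;
    ring.
have cZW c : continuous (Zop c (W c)).
  by apply: (@Ck_continuous _ _ 0); exact: Zop_Ck.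
rewrite sint_sum//; under eq_bigr do rewrite sint_Zop//.
rewrite -mulr_sumr -sint_sum; last first.
  move=> c; apply: (@Ck_continuous _ _ 1); apply: CkM => //; exact: Ck_crd.
rewrite (@eq_sint _ _ _ (fun=> 0)) ?sint_cst ?mul0r ?mulr0//.
move=> z z1; rewrite /W; under eq_bigr => c _.
  rewrite mulrBr !mulrA (mulrC _ (g z)) (mulrC _ (f z)) -!mulrA; over.
by rewrite sumrB -!mulr_sumr !sum_crd_Zop// !mulr0 subr0.
Qed.

End horizontal_fields.

(** * The regularized Green kernel *)

Section carre_du_champ.
Local Opaque Zop dot crd derive.
Context {R : realType} {m : nat}.
Local Notation E := (Cspace R m).
Local Notation J := ('I_m + 'I_m)%type.
Local Notation N := ((m + m)%:R : R).
Implicit Types (f g : E -> R) (v w z P : E) (c : J).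

(** The carre du champ, half the defect of the Leibniz rule for [Lap] (see [LapM]). *)
Definition gam f g z : R := \sum_c Zop c f z * Zop c g z.

Lemma Lap_cst (k : R) z : Lap (fun=> k) z = 0.
Proof.
rewrite /Lap big1// => c _; rewrite (_ : Zop c (fun=> k) = fun=> 0) ?Zop_cst//.
by apply/funext => w; rewrite Zop_cst.
Qed.

Lemma LapD f g z : Ck 2 f -> Ck 2 g ->
  Lap (fun z => f z + g z) z = Lap f z + Lap g z.
Proof.
move=> kf kg; rewrite /Lap -big_split/=; apply: eq_bigr => c _.
rewrite -ZopD; [|exact: Zop_Ck|exact: Zop_Ck]; congr Zop.
by apply/funext => w; rewrite ZopD//; exact: CkS.
Qed.

Lemma LapM f g z : Ck 2 f -> Ck 2 g ->
  Lap (fun z => f z * g z) z = f z * Lap g z + g z * Lap f z + 2 * gam f g z.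
Proof.
move=> kf kg; have kf1 := CkS kf; have kg1 := CkS kg.
rewrite /Lap /gam !mulr_sumr -!big_split/=; apply: eq_bigr => c _.
rewrite (_ : Zop c (fun z => f z * g z) = fun z => f z * Zop c g z + g z * Zop c f z);
  last first.
  by apply/funext => w; rewrite ZopM.
have kZf : Ck 1 (Zop c f) by exact: Zop_Ck.
have kZg : Ck 1 (Zop c g) by exact: Zop_Ck.
rewrite ZopD; [|exact: CkM|exact: CkM].
rewrite (ZopM _ _ kf1 kZg) (ZopM _ _ kg1 kZf).
move: (Zop c (Zop c f) z) (Zop c (Zop c g) z) (Zop c f z) (Zop c g z) (f z) (g z).
move=> *; ring.
Qed.

Lemma LapZ (k : R) g z : Ck 2 g -> Lap (fun z => k * g z) z = k * Lap g z.
Proof.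
move=> kg; have := @LapM (fun=> k) g z (Ck_cst 2 k) kg.
rewrite Lap_cst mulr0 addr0 /gam big1 ?mulr0 ?addr0// => c _.
by rewrite Zop_cst mul0r.
Qed.

Lemma Lap_powR f (p : R) z : (forall z, 0 < f z) -> Ck 2 f ->
  Lap (fun z => f z `^ p) z =
  p * (p - 1) * f z `^ (p - 1 - 1) * gam f f z + p * f z `^ (p - 1) * Lap f z.
Proof.
move=> f0 kf; have kf1 := CkS kf.
rewrite /Lap /gam !mulr_sumr -!big_split/=; apply: eq_bigr => c _.
rewrite (_ : Zop c (fun z => f z `^ p) = fun z => p * f z `^ (p - 1) * Zop c f z); last first.
  by apply/funext => w; rewrite Zop_powR.
have kP : Ck 1 (fun z => f z `^ (p - 1)) by exact: Ck_powR.
rewrite ZopM; [|by apply: CkZ|exact: Zop_Ck].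
rewrite ZopZ// Zop_powR//; move: (Zop c (Zop c f) z) (Zop c f z) => *; ring.
Qed.

Lemma dot_hproj0 z w : sphere z -> dot z (hproj z w) = 0.
Proof.
move=> /sphere_dotP z1; rewrite /hproj !dotBr !dotZr z1 dot_Jv mulr0 subr0 mulr1.
by rewrite dotC subrr.
Qed.

Lemma dot_Jv_hproj0 z w : sphere z -> dot (Jv z) (hproj z w) = 0.
Proof.
move=> /sphere_dotP z1; rewrite /hproj !dotBr !dotZr dot_JvJv z1.
by rewrite [dot (Jv z) z]dotC dot_Jv mulr0 subr0 mulr1 dotC subrr.
Qed.

(** [Zop c] of a linear function is a constant minus a quadratic function. Differentiating again
    brings out the trace N - 2 of the horizontal projection; the trace of its product with [Jv] is
    0, and the remaining terms pair [z] or [Jv z] with horizontal vectors. *)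
Lemma Lap_dot w z : sphere z -> Lap (fun z => dot w z) z = - (N - 2) * dot w z.
Proof.
move=> zS; have z1 := (sphere_dotP z).1 zS.
have e c : Zop c (fun z => dot w z) = fun z =>
    crd c w - (dot w z * dot (bas c) z + dot (Jv w) z * dot (Jv (bas c)) z).
  apply/funext => v; rewrite Zop_dot /hproj !crdB !crdZ !dot_Jvl opprD addrA.
  by rewrite [dot (bas c) v]dotC [dot (bas c) _]dotC !dot_basr mulrNN.
pose hp c u := crd c (hproj z u).
have e2 c : Zop c (Zop c (fun z => dot w z)) z =
    - (dot w z * hp c (bas c) + crd c z * hp c w
      + (dot (Jv w) z * hp c (Jv (bas c)) - crd c (Jv z) * hp c (Jv w))).
  have kd u : Ck 1 (fun z : E => dot u z) by exact: Ck_dot.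
  rewrite e ZopB; [|exact: Ck_cst|by apply: CkD; apply: CkM].
  rewrite Zop_cst sub0r ZopD; [|exact: CkM|exact: CkM].
  rewrite !ZopM// !Zop_dot -!/(hp _ _) [dot (bas c) z]dotC dot_basr.
  by rewrite (dot_Jvl (bas c)) [dot (bas c) (Jv z)]dotC dot_basr mulNr.
rewrite /Lap; under eq_bigr do rewrite e2.
rewrite sumrN !big_split/= sumrN -!mulr_sumr.
rewrite -[\sum_i crd i z * _]/(dot z (hproj z w)) dot_hproj0//.
rewrite -[\sum_i crd i (Jv z) * _]/(dot (Jv z) (hproj z (Jv w))) dot_Jv_hproj0//.
rewrite subr0 addr0 mulNr; congr (- _).
have -> : \sum_c hp c (bas c) = N - 2.
  under eq_bigr => c _ do
    rewrite /hp /hproj !crdB !crdZ crd_bas eqxx ![dot (bas c) _]dotC !dot_basr.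
  rewrite !sumrB -[X in _ - X - _]/(dot z z) -[X in _ - _ - X]/(dot (Jv z) (Jv z)).
  by rewrite dot_JvJv z1 sumr_const card_sum card_ord -addrA -opprD.
have -> : \sum_c hp c (Jv (bas c)) = 0.
  under eq_bigr => c _.
    rewrite /hp /hproj !crdB !crdZ -dot_basr [dot (Jv (bas c)) (bas c)]dotC dot_Jv.
    rewrite dot_JvJv dot_Jvl ![dot (bas c) _]dotC !dot_basr; over.
  rewrite big1// => c _; move: (crd c z) (crd c (Jv z)) => *; ring.
by rewrite mulr0 addr0 mulrC.
Qed.

Lemma gam_dot w w' z : sphere z ->
  gam (fun z => dot w z) (fun z => dot w' z) z =
  dot w w' - dot w z * dot w' z - dot w (Jv z) * dot w' (Jv z).
Proof.
move=> z1; rewrite -dot_hproj//; apply: eq_bigr => c _; by rewrite !Zop_dot.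
Qed.

(* With zeta the Hermitian product of z and P, qk P e z is |1 - zeta|^2 + e and
   rk P z is |zeta|^2. *)
Definition qk P (e : R) z : R := e + ((1 - dot P z) ^+ 2 + dot (Jv P) z ^+ 2).

Definition rk P z : R := dot P z ^+ 2 + dot (Jv P) z ^+ 2.

Lemma qk_ge P e z : e <= qk P e z.
Proof. by rewrite lerDl addr_ge0 ?sqr_ge0. Qed.

Lemma qk_gt0 P e z : 0 < e -> 0 < qk P e z.
Proof. by move=> /lt_le_trans; apply; exact: qk_ge. Qed.

Lemma Ck_qk k P e : Ck k (qk P e).
Proof.
apply: CkD; first exact: Ck_cst.
apply: CkD; apply: CkX; last exact: Ck_dot.
by apply: CkB; [exact: Ck_cst|exact: Ck_dot].
Qed.

Lemma Ck_rk k P : Ck k (rk P).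
Proof. by apply: CkD; apply: CkX; exact: Ck_dot. Qed.

Section at_points.
Variables (P z : E).
Hypotheses (P1 : sphere P) (z1 : sphere z).
Let A := dot P z.
Let B := dot (Jv P) z.

Let PJz : dot P (Jv z) = - B. Proof. by rewrite /B dot_Jvl opprK. Qed.
Let JPJz : dot (Jv P) (Jv z) = A. Proof. exact: dot_JvJv. Qed.
Let PP : dot P P = 1. Proof. exact/sphere_dotP. Qed.

(** With the next two lemmas this says that zeta is horizontally conformal, with factor 1 -
    |zeta|^2. *)
Lemma gam_re_re : gam (fun z => dot P z) (fun z => dot P z) z = 1 - rk P z.
Proof. rewrite gam_dot// PP PJz /rk -/A -/B; move: A B => *; ring. Qed.

Lemma gam_im_im : gam (fun z => dot (Jv P) z) (fun z => dot (Jv P) z) z = 1 - rk P z.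
Proof. rewrite gam_dot// dot_JvJv PP JPJz /rk -/A -/B; move: A B => *; ring. Qed.

Lemma gam_re_im : gam (fun z => dot P z) (fun z => dot (Jv P) z) z = 0.
Proof. rewrite gam_dot// dot_Jv PJz JPJz -/A -/B; move: A B => *; ring. Qed.

Lemma Lap_qk e : Lap (qk P e) z = 2 * (N - 2) * (A - rk P z) + 4 * (1 - rk P z).
Proof.
have kd w : Ck 2 (fun z : E => dot w z) by exact: Ck_dot.
rewrite (_ : qk P e = fun z => (e + 1) + (-2 * dot P z + (dot P z * dot P z + dot (Jv P) z *
  dot (Jv P) z))); last first.
  by apply/funext => v; rewrite /qk; move: (dot P v) (dot (Jv P) v) => *; ring.
rewrite LapD; [|exact: Ck_cst|]; last first.
  by apply: CkD; [exact: CkZ|apply: CkD; exact: CkM].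
rewrite Lap_cst add0r LapD; [|exact: CkZ|by apply: CkD; exact: CkM].
rewrite LapZ// LapD; [|exact: CkM|exact: CkM].
rewrite !LapM// gam_re_re gam_im_im !Lap_dot// -/A -/B /rk -/A -/B; move: A B => *; ring.
Qed.

Lemma Zop_qk c e : Zop c (qk P e) z =
  - 2 * (1 - A) * Zop c (fun z => dot P z) z + 2 * B * Zop c (fun z => dot (Jv P) z) z.
Proof.
have kd w : Ck 1 (fun z : E => dot w z) by exact: Ck_dot.
rewrite (_ : qk P e = fun z => (e + 1) + (-2 * dot P z + (dot P z * dot P z + dot (Jv P) z *
  dot (Jv P) z))); last first.
  by apply/funext => v; rewrite /qk; move: (dot P v) (dot (Jv P) v) => *; ring.
rewrite ZopD; [|exact: Ck_cst|]; last first.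
  by apply: CkD; [exact: CkZ|apply: CkD; exact: CkM].
rewrite Zop_cst add0r ZopD; [|exact: CkZ|by apply: CkD; exact: CkM].
rewrite ZopZ// ZopD; [|exact: CkM|exact: CkM].
rewrite !ZopM// -/A -/B; move: A B (Zop _ _ _) (Zop _ _ _) => *; ring.
Qed.

Lemma gam_qk e : gam (qk P e) (qk P e) z = 4 * (qk P e z - e) * (1 - rk P z).
Proof.
have H (a b : R) (F G : J -> R) :
    \sum_c (- 2 * (1 - a) * F c + 2 * b * G c) * (- 2 * (1 - a) * F c + 2 * b * G c) =
    4 * (1 - a) ^+ 2 * (\sum_c F c * F c) + 4 * b ^+ 2 * (\sum_c G c * G c)
    - 8 * (1 - a) * b * (\sum_c F c * G c).
  by rewrite !mulr_sumr -big_split/= -sumrB; apply: eq_bigr => c _; ring.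
rewrite /gam; under eq_bigr do rewrite Zop_qk.
rewrite H -!/(gam _ _ _).
rewrite gam_re_re gam_im_im gam_re_im /qk -/A -/B /rk -/A -/B; move: A B => *; ring.
Qed.

Lemma rk_le1 : rk P z <= 1.
Proof.
have : 0 <= gam (fun z => dot P z) (fun z => dot P z) z.
  by apply: sumr_ge0 => c _; rewrite -expr2 sqr_ge0.
by rewrite gam_re_re subr_ge0.
Qed.

End at_points.

Definition hk (n : nat) P e z : R := qk P e z `^ (- (n%:R / 2)).

(** The closed form of (- L + n^2) h_e on the sphere ([Lap_hk]). Both terms carry a factor [e],
    hence are small away from [P], and both are nonnegative because |zeta| <= 1. *)
Definition Kk (n : nat) P e z : R :=
  n%:R ^+ 2 * e * qk P e z `^ (- (n%:R / 2) - 1) +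
  n%:R * (n%:R + 2) * e * (1 - rk P z) * qk P e z `^ (- (n%:R / 2) - 1 - 1).

Lemma Ck_hk k n P e : 0 < e -> Ck k (hk n P e).
Proof. by move=> e0; apply: Ck_powR; [move=> z; exact: qk_gt0|exact: Ck_qk]. Qed.

Lemma Ck_Kk k n P e : 0 < e -> Ck k (Kk n P e).
Proof.
move=> e0; have kq p : Ck k (fun z => qk P e z `^ p).
  by apply: Ck_powR; [move=> z; exact: qk_gt0|exact: Ck_qk].
apply: CkD; first exact: CkZ.
by apply: CkM => //; apply: CkZ; apply: CkB; [exact: Ck_cst|exact: Ck_rk].
Qed.

(** After division by q^(- n/2 - 2) this is a polynomial identity; the terms without a factor [e]
    cancel because N - 2 = 2 n matches the exponent - n/2. *)
Lemma Lap_hk n P e z : m = n.+1 -> sphere P -> sphere z -> 0 < e ->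
  n%:R ^+ 2 * hk n P e z - Lap (hk n P e) z = Kk n P e z.
Proof.
move=> mn P1 z1 e0; rewrite /hk Lap_powR; last 2 first.
- by move=> w; exact: qk_gt0.
- exact: Ck_qk.
rewrite gam_qk// Lap_qk// /Kk.
set p := - (n%:R / 2); set q := qk P e z.
have q0 : 0 < q by exact: qk_gt0.
have e1 : q `^ (p - 1) = q * q `^ (p - 1 - 1).
  rewrite -[X in X * _](powRr1 (ltW q0)) -powRD; last by rewrite (gt_eqF q0) implybT.
  by congr (_ `^ _); ring.
have e2 : q `^ p = q * q `^ (p - 1).
  rewrite -[X in X * _](powRr1 (ltW q0)) -powRD; last by rewrite (gt_eqF q0) implybT.
  by congr (_ `^ _); ring.
have -> : N - 2 = 2 * n%:R by rewrite mn natrD -natr1; move: (n%:R : R) => *; ring.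
rewrite e2 e1; set Q := q `^ _.
(* From |1 - zeta|^2 = 1 - 2 Re zeta + |zeta|^2. Only [q], [rk P z] and [e] remain as variables. *)
have -> : dot P z = (1 + rk P z - (q - e)) / 2.
  by rewrite /q /qk /rk; move: (dot P z) (dot (Jv P) z) => *; field.
by rewrite /p; clear e1 e2 q0; move: (rk P z) Q; clearbody q => *; field.
Qed.

Lemma Kk_ge0 n P e z : sphere P -> sphere z -> 0 < e -> 0 <= Kk n P e z.
Proof.
move=> P1 z1 e0; rewrite addr_ge0//.
  by rewrite !mulr_ge0 ?powR_ge0 ?exprn_ge0 ?(ltW e0).
rewrite mulr_ge0 ?powR_ge0// mulr_ge0 ?subr_ge0 ?rk_le1//.
by rewrite mulr_ge0 ?(ltW e0)// mulr_ge0// addr_ge0.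
Qed.

End carre_du_champ.

(** * The complex sub-Laplacian as a real sum of squares *)

Section sublaplacian_real.
Local Opaque derive Zop.
Context {R : realType} {m : nat}.
Local Open Scope complex_scope.
Local Notation E := (Cspace R m).
Implicit Types (u v : E -> R) (f : E -> R[i]) (z : E) (j : 'I_m).

Lemma csumE (I : Type) (r : seq I) (F G : I -> R) :
  \sum_(i <- r) (F i +i* G i) = (\sum_(i <- r) F i) +i* (\sum_(i <- r) G i).
Proof.
elim: r => [|i r IH]; first by rewrite !big_nil.
by rewrite !big_cons IH.
Qed.

Lemma complex_half (a b : R) : (a +i* b) / 2 = (a / 2) +i* (b / 2).
Proof.
have -> : (2 : R[i]) = 2%:C by rewrite rmorph_nat.
by rewrite -fmorphV; simpc.
Qed.

Lemma half_sums_re (a b c d : R) :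
  (2^-1 * (a - b) + 2^-1 * (c + d)) / 2 + (2^-1 * (a + b) - 2^-1 * (c - d)) / 2 =
  2^-1 * (a + d).
Proof. by field. Qed.

Lemma half_sums_im (a b c d : R) :
  (2^-1 * (a + b) - 2^-1 * (c - d)) / 2 + (2^-1 * (a - b) + 2^-1 * (c + d)) / 2 =
  2^-1 * (a + d).
Proof. by field. Qed.

Lemma two_half (a b : R) : 2 * ((2^-1 * a) +i* (2^-1 * b)) = a +i* b.
Proof.
have -> : (2 : R[i]) = 2%:C by rewrite rmorph_nat.
by simpc; congr (_ +i* _); field.
Qed.

Lemma Lap_split u z : Lap u z =
  \sum_(j < m) (Zop (inl j) (Zop (inl j) u) z + Zop (inr j) (Zop (inr j) u) z).
Proof. by rewrite /Lap big_sumType big_split. Qed.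

(** [Zop c u] expanded in coordinate derivatives. The two agree when [u] is C^1, whereas [opT] and
    [opTbar] are expressed through this form for every [f]. *)
Definition Zsum c u z : R := 'D_(bas c) u z - crd c z * (\sum_d crd d z * 'D_(bas d) u z)
  - crd c (Jv z) * (\sum_d crd d (Jv z) * 'D_(bas d) u z).

Lemma ZsumE c u z : Ck 1 u -> Zsum c u z = Zop c u z.
Proof. by move=> ku; rewrite ZopE// /Zsum -!derive_bas. Qed.

Lemma dzE j f z : dz j f z =
  (('D_(bas (inl j)) (fun p => complex.Re (f p)) z + 'D_(bas (inr j)) (fun p => complex.Im (f
    p)) z) / 2) +i*
  (('D_(bas (inl j)) (fun p => complex.Im (f p)) z - 'D_(bas (inr j)) (fun p => complex.Re (f
    p)) z) / 2).
Proof.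
rewrite /dz /dx /dy /dirD /bas -complex_half; congr (_ / _); simpc.
by congr (_ +i* _); ring.
Qed.

Lemma dzbarE j f z : dzbar j f z =
  (('D_(bas (inl j)) (fun p => complex.Re (f p)) z - 'D_(bas (inr j)) (fun p => complex.Im (f
    p)) z) / 2) +i*
  (('D_(bas (inl j)) (fun p => complex.Im (f p)) z + 'D_(bas (inr j)) (fun p => complex.Re (f
    p)) z) / 2).
Proof.
rewrite /dzbar /dx /dy /dirD /bas -complex_half; congr (_ / _); simpc.
by congr (_ +i* _); ring.
Qed.

(** In complex form [opT j] is (Zx - i Zy) / 2, where Zx and Zy are the projected fields of the two
    real coordinates of index [j]; [opTbar j] is (Zx + i Zy) / 2. *)
Lemma opTE j f z : opT j f z =
  ((Zsum (inl j) (fun p => complex.Re (f p)) z + Zsum (inr j) (fun p => complex.Im (f p)) z) /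
    2) +i*
  ((Zsum (inl j) (fun p => complex.Im (f p)) z - Zsum (inr j) (fun p => complex.Re (f p)) z) /
    2).
Proof.
set u := fun p => complex.Re (f p); set v := fun p => complex.Im (f p).
pose Eu w := \sum_c crd c z * 'D_(bas c) w z.
pose Tu w := \sum_c crd c (Jv z) * 'D_(bas c) w z.
have eS : opS f z = ((Eu u + Tu v) / 2) +i* ((Eu v - Tu u) / 2).
  rewrite /opS; under eq_bigr => k _.
    rewrite dzE -/u -/v /coordC -[z.1 0 k]/(crd (inl k) z) -[z.2 0 k]/(crd (inr k) z).
    simpc; over.
  rewrite csumE /Eu /Tu !big_sumType/= -!big_split/= -?sumrB !mulr_suml.
  by congr (_ +i* _); apply: eq_bigr => k _; rewrite ?mxE;
    move: (z.1 0 k) (z.2 0 k) ('D_(delta_mx 0 k, 0) u z) ('D_(0, delta_mx 0 k) u z)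
      ('D_(delta_mx 0 k, 0) v z) ('D_(0, delta_mx 0 k) v z) => *; field.
rewrite /opT eS dzE -/u -/v /coordC; simpc; congr (_ +i* _).
  rewrite /Zsum crd_Jv_inl crd_Jv_inr /= -!/(Eu _) -!/(Tu _); by field.
by rewrite /Zsum crd_Jv_inl crd_Jv_inr /= -!/(Eu _) -!/(Tu _); field.
Qed.

Lemma opTbarE j f z : opTbar j f z =
  ((Zsum (inl j) (fun p => complex.Re (f p)) z - Zsum (inr j) (fun p => complex.Im (f p)) z) /
    2) +i*
  ((Zsum (inl j) (fun p => complex.Im (f p)) z + Zsum (inr j) (fun p => complex.Re (f p)) z) /
    2).
Proof.
set u := fun p => complex.Re (f p); set v := fun p => complex.Im (f p).
pose Eu w := \sum_c crd c z * 'D_(bas c) w z.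
pose Tu w := \sum_c crd c (Jv z) * 'D_(bas c) w z.
have eS : opSbar f z = ((Eu u - Tu v) / 2) +i* ((Eu v + Tu u) / 2).
  rewrite /opSbar; under eq_bigr => k _.
    rewrite dzbarE -/u -/v /coordC -[z.1 0 k]/(crd (inl k) z) -[z.2 0 k]/(crd (inr k) z).
    simpc; over.
  rewrite csumE /Eu /Tu !big_sumType/= -!big_split/= -?sumrB -?big_split !mulr_suml.
  by congr (_ +i* _); apply: eq_bigr => k _; rewrite ?mxE;
    move: (z.1 0 k) (z.2 0 k) ('D_(delta_mx 0 k, 0) u z) ('D_(0, delta_mx 0 k) u z)
      ('D_(delta_mx 0 k, 0) v z) ('D_(0, delta_mx 0 k) v z) => *; field.
rewrite /opTbar eS dzbarE -/u -/v /coordC; simpc; congr (_ +i* _).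
  by rewrite /Zsum crd_Jv_inl crd_Jv_inr /= -!/(Eu _) -!/(Tu _); field.
by rewrite /Zsum crd_Jv_inl crd_Jv_inr /= -!/(Eu _) -!/(Tu _); field.
Qed.

(** In the symmetrized product of (Zx - i Zy) / 2 and (Zx + i Zy) / 2 the commutators of Zx and Zy
    cancel, leaving (Zx^2 + Zy^2) / 2; the factor 2 of [sublaplacian] clears the denominator. *)
Lemma sublaplacianE f z : smooth f ->
  sublaplacian f z = Lap (fun p => complex.Re (f p)) z +i* Lap (fun p => complex.Im (f p)) z.
Proof.
move=> sf; have ku : Ck 2 (fun p => complex.Re (f p)) by have [] := sf 2%N.
have kv : Ck 2 (fun p => complex.Im (f p)) by have [] := sf 2%N.
move: ku kv; set u := fun p => complex.Re (f p); set v := fun p => complex.Im (f p).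
move=> ku kv; have ku1 := CkS ku; have kv1 := CkS kv.
have kZu c : Ck 1 (Zop c u) by exact: Zop_Ck.
have kZv c : Ck 1 (Zop c v) by exact: Zop_Ck.
pose hD (c d : 'I_m + 'I_m) (w w' : E -> R) p := 2^-1 * (Zop c w p + Zop d w' p).
pose hB (c d : 'I_m + 'I_m) (w w' : E -> R) p := 2^-1 * (Zop c w p - Zop d w' p).
have T1 j : (fun p => complex.Re (opTbar j f p)) = hB (inl j) (inr j) u v.
  by apply/funext => p; rewrite opTbarE /= -/u -/v !ZsumE// mulrC.
have T2 j : (fun p => complex.Im (opTbar j f p)) = hD (inl j) (inr j) v u.
  by apply/funext => p; rewrite opTbarE /= -/u -/v !ZsumE// mulrC.
have T3 j : (fun p => complex.Re (opT j f p)) = hD (inl j) (inr j) u v.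
  by apply/funext => p; rewrite opTE /= -/u -/v !ZsumE// mulrC.
have T4 j : (fun p => complex.Im (opT j f p)) = hB (inl j) (inr j) v u.
  by apply/funext => p; rewrite opTE /= -/u -/v !ZsumE// mulrC.
have khD c d w w' : Ck 1 (Zop c w) -> Ck 1 (Zop d w') -> Ck 1 (hD c d w w').
  by move=> k1 k2; apply: CkZ; exact: CkD.
have khB c d w w' : Ck 1 (Zop c w) -> Ck 1 (Zop d w') -> Ck 1 (hB c d w w').
  by move=> k1 k2; apply: CkZ; exact: CkB.
have ZhD b c d w w' : Ck 1 (Zop c w) -> Ck 1 (Zop d w') ->
    Zop b (hD c d w w') z = 2^-1 * (Zop b (Zop c w) z + Zop b (Zop d w') z).
  move=> k1 k2; rewrite /hD ZopZ; last exact: CkD.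
  by rewrite (ZopD _ _ k1 k2).
have ZhB b c d w w' : Ck 1 (Zop c w) -> Ck 1 (Zop d w') ->
    Zop b (hB c d w w') z = 2^-1 * (Zop b (Zop c w) z - Zop b (Zop d w') z).
  move=> k1 k2; rewrite /hB ZopZ; last exact: CkB.
  by rewrite (ZopB _ _ k1 k2).
have key j : opT j (opTbar j f) z + opTbar j (opT j f) z =
    (2^-1 * (Zop (inl j) (Zop (inl j) u) z + Zop (inr j) (Zop (inr j) u) z)) +i*
    (2^-1 * (Zop (inl j) (Zop (inl j) v) z + Zop (inr j) (Zop (inr j) v) z)).
  have zD b w w' : Ck 1 (Zop (inl j) w) -> Ck 1 (Zop (inr j) w') ->
      Zsum b (hD (inl j) (inr j) w w') z =
      2^-1 * (Zop b (Zop (inl j) w) z + Zop b (Zop (inr j) w') z).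
    by move=> k1 k2; rewrite ZsumE; [exact: ZhD|exact: khD].
  have zB b w w' : Ck 1 (Zop (inl j) w) -> Ck 1 (Zop (inr j) w') ->
      Zsum b (hB (inl j) (inr j) w w') z =
      2^-1 * (Zop b (Zop (inl j) w) z - Zop b (Zop (inr j) w') z).
    by move=> k1 k2; rewrite ZsumE; [exact: ZhB|exact: khB].
  have cD (a b c d : R) : (a +i* b) + (c +i* d) = (a + c) +i* (b + d) by [].
  rewrite opTE opTbarE T1 T2 T3 T4 cD.
  rewrite (zB _ _ _ (kZu _) (kZv _)) (zB _ _ _ (kZu _) (kZv _)).
  rewrite (zB _ _ _ (kZv _) (kZu _)) (zB _ _ _ (kZv _) (kZu _)).
  rewrite (zD _ _ _ (kZu _) (kZv _)) (zD _ _ _ (kZu _) (kZv _)).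
  rewrite (zD _ _ _ (kZv _) (kZu _)) (zD _ _ _ (kZv _) (kZu _)).
  congr (_ +i* _); [exact: half_sums_re|exact: half_sums_im].
rewrite /sublaplacian; under eq_bigr do rewrite key.
have half_Lap w : \sum_(j < m) 2^-1 * (Zop (inl j) (Zop (inl j) w) z +
    Zop (inr j) (Zop (inr j) w) z) = 2^-1 * Lap w z by rewrite Lap_split mulr_sumr.
by rewrite csumE (half_Lap u) (half_Lap v) two_half.
Qed.

End sublaplacian_real.

(** * Concentration at the pole *)

Section approximate_identity.
Context {R : realType} {m : nat}.
Local Notation E := (Cspace R m).
Local Notation mu := (@sphere_measure R m).
Local Notation S := (@pt R m @^-1` @sphere R m).
Local Opaque dot Lap Zop.
Implicit Types (u H : E -> R) (z P : E).

Lemma ler_powR_npos (a b p : R) : 0 < a -> a <= b -> p <= 0 -> b `^ p <= a `^ p.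
Proof.
move=> a0 ab p0; have b0 := lt_le_trans a0 ab.
have np0 : 0 <= - p by rewrite oppr_ge0.
have h : a `^ (- p) <= b `^ (- p).
  by apply: (ge0_ler_powR np0) => //; rewrite nnegrE ltW.
have e x : x `^ p = (x `^ (- p))^-1 by rewrite powRN invrK.
by rewrite !e lef_pV2// posrE powR_gt0.
Qed.

Lemma dot_dist z P : sphere z -> sphere P -> dot (z - P) (z - P) = 2 * (1 - dot P z).
Proof.
move=> /sphere_dotP z1 /sphere_dotP P1.
by rewrite dotBl !dotBr z1 P1 [dot z P]dotC; ring.
Qed.

Lemma crd_sq_le_dot c z : crd c z ^+ 2 <= dot z z.
Proof.
Local Transparent dot.
rewrite /dot (bigD1 c)//= -expr2 lerDl; apply: sumr_ge0 => d _.
by rewrite -expr2 sqr_ge0.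
Local Opaque dot.
Qed.

(** On the sphere |1 - zeta| >= 1 - Re zeta = |z - P|^2 / 2, hence the fourth power of the
    distance. *)
Lemma qk_far P z (d e : R) c : sphere z -> sphere P -> 0 < d -> 0 <= e ->
  d <= `|crd c z - crd c P| -> d ^+ 4 / 4 <= qk P e z.
Proof.
move=> z1 P1 d0 e0 dz.
have h1 : d ^+ 2 <= 2 * (1 - dot P z).
  rewrite -dot_dist//; apply: le_trans (crd_sq_le_dot c _).
  by rewrite crdB -[X in _ <= X]real_normK ?num_real// ler_pXn2r ?nnegrE// ltW.
have h2 : d ^+ 4 / 4 <= (1 - dot P z) ^+ 2.
  rewrite (_ : d ^+ 4 / 4 = (d ^+ 2 / 2) ^+ 2); last by field.
  rewrite ler_pXn2r ?nnegrE ?divr_ge0 ?sqr_ge0//.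
    by rewrite ler_pdivrMr// mulrC.
  by have := sqr_ge0 d; lra.
by rewrite /qk; have := sqr_ge0 (dot (Jv P) z); lra.
Qed.

Lemma Kk_far n P z (d e : R) c : sphere z -> sphere P -> 0 < d -> 0 < e ->
  d <= `|crd c z - crd c P| ->
  Kk n P e z <= e * (n%:R ^+ 2 * (d ^+ 4 / 4) `^ (- (n%:R / 2) - 1) +
    n%:R * (n%:R + 2) * (d ^+ 4 / 4) `^ (- (n%:R / 2) - 1 - 1)).
Proof.
move=> z1 P1 d0 e0 dz; have h := qk_far z1 P1 d0 (ltW e0) dz.
have d4 : 0 < d ^+ 4 / 4 by rewrite divr_gt0 ?exprn_gt0.
have n0 : (0 : R) <= n%:R by [].
have q1 := ler_powR_npos (p := - (n%:R / 2) - 1) d4 h.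
have q2 := ler_powR_npos (p := - (n%:R / 2) - 1 - 1) d4 h.
rewrite mulrDr /Kk lerD//.
  rewrite [e * _]mulrA [e * _]mulrC ler_wpM2l ?mulr_ge0 ?sqr_ge0 ?(ltW e0)//.
  by apply: q1; lra.
have r1 := rk_le1 P1 z1.
have r0 : 0 <= rk P z by rewrite /rk addr_ge0 ?sqr_ge0.
have c0 : 0 <= n%:R * (n%:R + 2) * e :> R by rewrite !mulr_ge0 ?addr_ge0 ?(ltW e0).
rewrite -mulrA [leRHS]mulrA [e * _]mulrC ler_wpM2l//.
rewrite -[leRHS]mul1r ler_pM ?powR_ge0 ?subr_ge0//; first by lra.
by apply: q2; lra.
Qed.

(* Continuity at P is only required along the sphere, in the coordinates. *)
Lemma approximate_identity n P H : m = n.+1 -> sphere P -> sintegrable H ->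
  (forall eta, 0 < eta -> exists2 d, 0 < d & forall z, sphere z ->
     (forall c, `|crd c z - crd c P| < d) -> `|H z - H P| <= eta) ->
  forall eta, 0 < eta -> exists C, forall e, 0 < e ->
    `|sint (fun z => H z * Kk n P e z) - H P * sint (Kk n P e)| <=
      eta * sint (Kk n P e) + e * C.
Proof.
move=> mn P1 IH cH eta eta0; have [d d0 dP] := cH _ eta0.
set C0 := n%:R ^+ 2 * (d ^+ 4 / 4) `^ (- (n%:R / 2) - 1) +
    n%:R * (n%:R + 2) * (d ^+ 4 / 4) `^ (- (n%:R / 2) - 1 - 1).
have C00 : 0 <= C0.
  have n20 : 0 <= n%:R ^+ 2 :> R by exact: sqr_ge0.
  have nn0 : 0 <= n%:R * (n%:R + 2) :> R by apply: mulr_ge0 => //; exact: addr_ge0.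
  by apply: addr_ge0; apply: mulr_ge0 => //; exact: powR_ge0.
exists (C0 * sint (fun z => `|H z| + `|H P|)) => e e0.
have cK : continuous (Kk n P e) := Ck_continuous (Ck_Kk 0 n P e0).
have IK := continuous_sintegrable cK.
have [M M0 KM] := sphere_bounded cK.
have mK : measurable_fun S (fun v => Kk n P e (pt v)).
  by apply: measurable_funTS; exact: measurable_continuous_pt.
have IHK : sintegrable (fun z => H z * Kk n P e z) by exact: (sintegrableM IH mK KM).
have ICst k : sintegrable (fun _ : E => k).
  by apply: continuous_sintegrable => z; exact: cst_continuous.
have IZ k f : sintegrable f -> sintegrable (fun z => k * f z).
  move=> If; rewrite /sintegrable; under eq_fun do rewrite EFinM.
  by apply: integrableZl => //; exact: measurable_preimage_sphere.
have IB f g : sintegrable f -> sintegrable g -> sintegrable (fun z => f z - g z).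
  move=> If Ig; rewrite /sintegrable; under eq_fun do rewrite EFinB.
  by apply: integrableB => //; exact: measurable_preimage_sphere.
have ID f g : sintegrable f -> sintegrable g -> sintegrable (fun z => f z + g z).
  move=> If Ig; rewrite /sintegrable; under eq_fun do rewrite EFinD.
  by apply: integrableD => //; exact: measurable_preimage_sphere.
have IN f : sintegrable f -> sintegrable (fun z => `|f z|) by exact: integrable_norm.
rewrite -sintZ// -sintB//; last exact: IZ.
have ID1 : sintegrable (fun z => H z * Kk n P e z - H P * Kk n P e z) by apply: IB => //;
  exact: IZ.
apply: (le_trans (le_norm_sint ID1)).
have IHH : sintegrable (fun z => `|H z| + `|H P|) by apply: ID => //; exact: IN.
rewrite mulrA -[X in _ + X]sintZ// -sintZ// -sintD; [|exact: IZ|exact: IZ].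
apply: le_sint => [|| z z1]; first exact: IN.
  by apply: ID; exact: IZ.
have K0 : 0 <= Kk n P e z by exact: Kk_ge0.
rewrite -mulrBl normrM (ger0_norm K0).
have [near|] := pselect (forall c, `|crd c z - crd c P| < d).
  rewrite -[leLHS]addr0; apply: lerD; first by rewrite ler_wpM2r// dP.
  by apply: mulr_ge0; [apply: mulr_ge0 => //; exact: ltW|exact: addr_ge0].
move=> /existsNP[c /negP]; rewrite -leNgt => far.
rewrite -[leLHS]add0r; apply: lerD; first by apply: mulr_ge0 => //; exact: ltW.
rewrite [leRHS]mulrC; apply: ler_pM => //; first exact: ler_normB.
exact: Kk_far far.
Qed.

Lemma Green_identity n P (e : R) u : m = n.+1 -> sphere P -> 0 < e -> Ck 2 u ->
  sint (fun z => hk n P e z * (n%:R ^+ 2 * u z - Lap u z)) =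
  sint (fun z => u z * Kk n P e z).
Proof.
move=> mn P1 e0 ku.
have kh : Ck 2 (hk n P e) by exact: Ck_hk.
have kL v : Ck 2 v -> Ck 0 (Lap v) by exact: Lap_Ck.
have k0 v : Ck 2 v -> Ck 0 v by move=> /CkS/CkS.
have sL := Lap_sym ku kh.
have I1 : sintegrable (fun z => n%:R ^+ 2 * (hk n P e z * u z)).
  apply: continuous_sintegrable; apply: (@Ck_continuous _ _ 0).
  by apply: CkZ; apply: CkM; exact: k0.
have I2 v w : Ck 2 v -> Ck 2 w -> sintegrable (fun z => v z * Lap w z).
  move=> kv kw; apply: continuous_sintegrable; apply: (@Ck_continuous _ _ 0).
  by apply: CkM; [exact: k0|exact: kL].
transitivity (sint (fun z => n%:R ^+ 2 * (hk n P e z * u z)) -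
              sint (fun z => hk n P e z * Lap u z)).
  rewrite -(sintB I1 (I2 _ _ kh ku)); apply: eq_sint => z _.
  by rewrite mulrBr mulrCA.
rewrite sL -(sintB I1 (I2 _ _ ku kh)); apply: eq_sint => z z1.
have alg (x h w l : R) : x * (h * w) - w * l = w * (x * h - l) by ring.
by rewrite alg (Lap_hk mn P1 z1 e0).
Qed.

(** The Green identity with u = 1: the mass of the approximate identity is reduced to that of the
    kernel. *)
Lemma sint_Kk n P (e : R) : m = n.+1 -> sphere P -> 0 < e ->
  sint (Kk n P e) = n%:R ^+ 2 * sint (hk n P e).
Proof.
move=> mn P1 e0; have k1 := @Ck_cst R m 2 1.
have := Green_identity mn P1 e0 k1.
rewrite (@eq_sint _ _ _ (fun z => n%:R ^+ 2 * hk n P e z)); last first.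
  by move=> z _; rewrite Lap_cst mulr1 subr0 mulrC.
rewrite (@eq_sint _ _ (fun z => 1 * _) (Kk n P e)); last by move=> z _; rewrite mul1r.
rewrite sintZ//; apply: continuous_sintegrable; exact: (Ck_continuous (Ck_hk 0 n P e0)).
Qed.

End approximate_identity.

(** * Gamma at half-integers *)

Section gamma_function.
Context {R : realType}.
Local Notation leb := (@lebesgue_measure R).
Local Open Scope ereal_scope.
Implicit Types x t u : R.

(** The extended value behind [Gamma], where [fine] would send a divergent integral to 0. The
    functional equation is proved here before finiteness is known. *)
Definition eGamma x : \bar R :=
  \int[leb]_(t in `]0%R, +oo[) (t `^ (x - 1) * expR (- t))%:E.

Lemma GammaE x : Gamma x = fine (eGamma x).
Proof. by []. Qed.

Lemma derive_expRN t : is_derive t (1 : R)%R (fun s : R => - expR (- s))%R (expR (- t)).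
Proof. by apply: is_derive_eq; rewrite /GRing.scale/= mulrN1 opprK. Qed.

Lemma continuous_expRN : continuous (fun s : R => expR (- s)).
Proof.
by move=> s; apply: (@continuous_comp _ _ _ -%R (@expR R));
  [exact: opp_continuous|exact: continuous_expR].
Qed.

Lemma integral_expRN t : \int[leb]_(u in `]t, +oo[) (expR (- u))%:E = (expR (- t))%:E.
Proof.
have mf : measurable_fun setT (fun u : R => (expR (- u))%:E).
  apply/measurable_EFinP; apply: continuous_measurable_fun; exact: continuous_expRN.
rewrite integral_itv_obnd_cbnd; last exact: measurable_funTS.
rewrite (@ge0_continuous_FTC2y _ _ (fun s => - expR (- s))%R t 0%R).
- by rewrite EFinN oppeK add0e.
- by move=> *; exact: expR_ge0.
- exact/continuous_subspaceT/continuous_expRN.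
- by rewrite -oppr0; apply: cvgN; exact: cvgr_expR.
- by move=> s _; have [] := derive_expRN s.
- apply: cvg_at_right_filter; apply: (@continuousN _ _ _ (fun s : R => expR (- s))).
  exact: continuous_expRN.
- by move=> s _; rewrite derive1E; have [_ ->] := derive_expRN s.
Qed.

Lemma measurable_powR_cst x : measurable_fun setT (fun t : R => t `^ x)%R.
Proof. exact: measurable_powR. Qed.

Lemma ge0_integralZl_itv (I : interval R) (k : R) (g : R -> R) : (0 <= k)%R ->
  (forall t, 0 <= g t)%R -> measurable_fun setT g ->
  \int[leb]_(t in [set` I]) (k%:E * (g t)%:E) = k%:E * \int[leb]_(t in [set` I]) (g t)%:E.
Proof.
move=> k0 g0 mg; apply: ge0_integralZl => //.
- by apply: measurable_funTS; exact/measurable_EFinP.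
- by move=> t _; rewrite lee_fin.
Qed.

Lemma integral_powR x u : (0 < x)%R -> (0 < u)%R ->
  \int[leb]_(t in `]0%R, u[) (x * t `^ (x - 1))%:E = (u `^ x)%:E.
Proof.
move=> x0 u0.
have mf : measurable_fun setT (fun t : R => (x * t `^ (x - 1))%:E).
  by apply/measurable_EFinP; apply: measurable_funM => //; exact: measurable_powR_cst.
rewrite integral_itv_bndo_bndc; last exact: measurable_funTS.
(* The integrand may blow up at 0, so the fundamental theorem is applied on [[a i, u]]; the shift by
   2 gives [a i < u] for every [i]. *)
pose a i : R := (u / i.+2%:R)%R.
have a0 i : (0 < a i)%R by rewrite divr_gt0.
have au i : (a i < u)%R by rewrite ltr_pdivrMr// ltr_pMr// ltr1n.
pose F i : set (measurableTypeR R) := `[a i, u]%classic.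
have nF : nondecreasing_seq F.
  move=> i j ij; rewrite subsetEset => t; rewrite /F/= !in_itv/= => /andP[h ->].
  by rewrite andbT (le_trans _ h)// ler_pM2l// lef_pV2 ?posrE// ler_nat.
have UF : \bigcup_i F i = `]0%R, u]%classic.
  apply/seteqP; split => t /=; rewrite in_itv/=.
    by move=> [i _]; rewrite /F/= in_itv/= => /andP[h ->]; rewrite andbT (lt_le_trans (a0 i)).
  move=> /andP[t0 tu]; have [N Nu] : exists N : nat, (u / t < N%:R)%R.
    exists (Num.truncn (u / t)).+1; exact: truncnS_gt.
  exists N => //; rewrite /F /= in_itv/= tu andbT ler_pdivrMr//.
  rewrite mulrC -ler_pdivrMr// (le_trans (ltW Nu))// ler_nat.
  by rewrite -addn2 leq_addr.
have h1 := @ge0_nondecreasing_set_cvg_integral _ _ _ F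
  (fun t : measurableTypeR R => (x * (t : R) `^ (x - 1))%:E) (@lebesgue_measure R) nF.
rewrite -UF; apply/esym; apply: cvg_unique (h1 _ _ _); last first.
- move=> i t _; rewrite lee_fin mulr_ge0 ?powR_ge0 ?(ltW x0)//.
- by move=> i; exact: measurable_funTS.
- by move=> i; exact: measurable_itv.
have dp t : (0 < t)%R -> is_derive t (1 : R)%R (fun t : R => t `^ x)%R (x * t `^ (x - 1))%R.
  by move=> t0; exact: is_derive1_powR.
have cp (p t : R) : (0 < t)%R -> {for t, continuous (fun t : R => t `^ p)%R}.
  move=> t0; apply: differentiable_continuous; apply/derivable1_diffP.
  by have [] := is_derive1_powR p t0.
rewrite (_ : (fun i => _) = (fun i => (u `^ x - a i `^ x)%:E)); last first.
  apply/funext => i; rewrite (@continuous_FTC2 _ _ (fun t : R => t `^ x)%R (a i) u).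
  - by rewrite EFinB.
  - exact: au.
  - apply: continuous_in_subspaceT => t; rewrite inE/= in_itv/= => /andP[t0 _].
    apply: (@cvgM _ _ _ _ (cst x)); first exact: cvg_cst.
    by apply: cp; exact: lt_le_trans t0.
  - split.
    + move=> t; rewrite in_itv/= => /andP[t0 _].
      by have [] := dp _ (lt_trans (a0 i) t0).
    + by apply: cvg_at_right_filter; exact: cp.
    + by apply: cvg_at_left_filter; exact: cp.
  - move=> t; rewrite in_itv/= => /andP[t0 _].
    by rewrite derive1E; have [_ ->] := dp _ (lt_trans (a0 i) t0).
apply: cvg_EFin; first exact: nearW.
rewrite -[X in _ --> X]subr0; apply: cvgB; first exact: cvg_cst.
have /cvg_at_rightP := powR_cvg0 x0; apply; split => //.
rewrite -(mulr0 u); apply: cvgM; first exact: cvg_cst.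
have := @cvg_harmonic R; rewrite -cvg_shiftS; exact.
exact: ereal_hausdorff.
Qed.

(* Tonelli, applied to x t^(x-1) e^(-u) on the region 0 < t < u. *)
Lemma eGammaD1 x : (0 < x)%R -> eGamma (x + 1) = x%:E * eGamma x.
Proof.
move=> x0.
pose D : set (measurableTypeR R * measurableTypeR R) := [set p | (0 < p.1)%R && (p.1 < p.2)%R].
have mD : measurable D.
  rewrite (_ : D = (fst @^-1` `]0%R, +oo[%classic) `&`
      ((fun p : measurableTypeR R * measurableTypeR R => (p.2 : R) - p.1)%R @^-1` `]0%R,
        +oo[%classic)); last first.
    apply/seteqP; split => p; rewrite /D/= !in_itv/= !andbT subr_gt0.
      by move=> /andP[].
    by move=> [-> ->].
  apply: measurableI; rewrite -[X in measurable X]setTI.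
    exact: measurable_fst.
  have := measurable_funB (@measurable_snd _ _ (measurableTypeR R) (measurableTypeR R))
    (@measurable_fst _ _ (measurableTypeR R) (measurableTypeR R)); apply => //.
pose f (p : measurableTypeR R * measurableTypeR R) : \bar R :=
  (x * p.1 `^ (x - 1) * expR (- p.2) * \1_D p)%:E.
have f0 p : 0 <= f p.
  by rewrite lee_fin !mulr_ge0 ?powR_ge0 ?expR_ge0 ?(ltW x0).
have mf : measurable_fun setT f.
  apply/measurable_EFinP; apply: measurable_funM => //.
  apply: measurable_funM.
    apply: measurable_funM => //.
    exact: measurableT_comp (measurable_powR_cst _) measurable_fst.
  have mE : measurable_fun setT (fun u : R => expR (- u)).
    by apply: continuous_measurable_fun; exact: continuous_expRN.
  exact: (measurableT_comp mE measurable_snd).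
have := @fubini_tonelli _ _ _ _ R leb leb f mf f0.
rewrite (_ : (fun _ => _) = fun t : measurableTypeR R => \int[leb]_u f (t, u))//.
have -> : \int[leb]_t fubini_F leb f t = x%:E * eGamma x.
  rewrite /eGamma -(ge0_integralZl_itv _ (g := fun t => t `^ (x - 1) * expR (- t))%R (ltW
    x0)); last 2 first.
  - by move=> t; rewrite mulr_ge0 ?powR_ge0 ?expR_ge0.
  - by apply: measurable_funM;
      [exact: measurable_powR_cst|apply: continuous_measurable_fun; exact: continuous_expRN].
  rewrite [RHS]integral_mkcond; apply: eq_integral => t _; rewrite /fubini_F patchE.
  case: ifPn => [|/negP]; rewrite inE/= in_itv/= andbT.
    move=> t0; transitivity (\int[leb]_(u in `]t, +oo[) ((x * t `^ (x - 1))%:E * (expR (-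
      u))%:E)).
      rewrite [RHS]integral_mkcond; apply: eq_integral => u _; rewrite patchE /f/= indicE.
      rewrite (_ : ((t, u) \in D) = (u \in `]t, +oo[%classic)); last first.
        by apply/idP/idP; rewrite !inE /D/= in_itv/= t0 andbT.
      by case: ifP; rewrite ?mulr1 ?mulr0.
    rewrite (ge0_integralZl_itv _ (g := fun u => expR (- u))); last 3 first.
    - by rewrite mulr_ge0 ?powR_ge0 ?(ltW x0).
    - by move=> u; rewrite expR_ge0.
    - by apply: continuous_measurable_fun; exact: continuous_expRN.
    by rewrite integral_expRN -!EFinM mulrA.
  move=> t0; rewrite integral0_eq// => u _; rewrite /f/= indicE.
  by rewrite (_ : ((t, u) \in D) = false) ?mulr0//; apply/negbTE/negP;
    rewrite inE /D/= => /andP[].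
move=> ->; rewrite /eGamma addrK [LHS]integral_mkcond; apply: eq_integral => u _.
rewrite /fubini_G patchE.
case: ifPn => [|/negP]; rewrite inE/= in_itv/= andbT.
  move=> u0; apply/esym; transitivity (\int[leb]_(t in `]0%R, u[) ((expR (- u))%:E * (x * t `^
    (x - 1))%:E)).
    rewrite [RHS]integral_mkcond; apply: eq_integral => t _; rewrite patchE /f/= indicE.
    rewrite (_ : ((t, u) \in D) = (t \in `]0%R, u[%classic)); last first.
      by apply/idP/idP; rewrite !inE.
    by case: ifP; rewrite ?mulr1 ?mulr0// mulrC.
  rewrite (ge0_integralZl_itv _ (g := fun t => x * t `^ (x - 1))%R); last 3 first.
  - by rewrite expR_ge0.
  - by move=> t; rewrite mulr_ge0 ?powR_ge0 ?(ltW x0).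
  - by apply: measurable_funM => //; exact: measurable_powR_cst.
  by rewrite integral_powR// -EFinM mulrC.
move=> u0; apply/esym; rewrite integral0_eq// => t _; rewrite /f/= indicE.
rewrite (_ : ((t, u) \in D) = false) ?mulr0//; apply/negbTE/negP;
  rewrite inE /D/= => /andP[t0 tu].
by apply: u0; exact: lt_trans tu.
Qed.

Lemma eGamma_ge0 x : 0 <= eGamma x.
Proof.
by apply: integral_ge0 => t _; rewrite lee_fin mulr_ge0 ?powR_ge0 ?expR_ge0.
Qed.

Lemma eGamma1 : eGamma 1 = 1.
Proof.
rewrite /eGamma; under eq_integral do rewrite subrr powRr0 mul1r.
by rewrite integral_expRN oppr0 expR0.
Qed.

(** The integral of the pointwise bound 2 l sqrt t <= 1 + l^2 t. A free [l] keeps it meaningful for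
    infinite values; the optimal one gives log-convexity in [gh_sq]. *)
Lemma eGammaD_half x (l : R) : (0 < x)%R -> (0 <= l)%R ->
  (2 * l)%:E * eGamma (x + 2^-1) <= eGamma x + (l ^+ 2)%:E * eGamma (x + 1).
Proof.
move=> x0 l0.
have mg y : measurable_fun (`]0%R, +oo[ : set R) (fun t : R => (t `^ (y - 1) * expR (- t))%:E).
  apply: measurable_funTS; apply/measurable_EFinP; apply: measurable_funM.
    exact: measurable_powR_cst.
  by apply: continuous_measurable_fun; exact: continuous_expRN.
have g0 y t : 0 <= (t `^ (y - 1) * expR (- t))%:E.
  by rewrite lee_fin mulr_ge0 ?powR_ge0 ?expR_ge0.
have Z y (k : R) : (0 <= k)%R ->
    k%:E * \int[leb]_(t in `]0%R, +oo[) (t `^ (y - 1) * expR (- t))%:E =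
    \int[leb]_(t in `]0%R, +oo[) (k%:E * (t `^ (y - 1) * expR (- t))%:E).
  move=> k0; rewrite (ge0_integralZl_itv _ (g := fun t => t `^ (y - 1) * expR (- t))%R)//.
    by move=> t; rewrite mulr_ge0 ?powR_ge0 ?expR_ge0.
  by apply: measurable_funM;
    [exact: measurable_powR_cst|apply: continuous_measurable_fun; exact: continuous_expRN].
have mZ y (k : R) : measurable_fun (`]0%R, +oo[ : set R)
    (fun t : R => k%:E * (t `^ (y - 1) * expR (- t))%:E).
  by apply: measurable_funeM; exact: mg.
have l20 : (0 <= l ^+ 2)%R by exact: sqr_ge0.
have l21 : (0 <= 2 * l)%R by rewrite mulr_ge0.
rewrite /eGamma !Z// -ge0_integralD//; try exact: mg; try exact: mZ;
  try by move=> t _; rewrite mule_ge0.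
have s0 t : 0 <= (t `^ (x - 1) * expR (- t))%:E +
    (l ^+ 2)%:E * (t `^ (x + 1 - 1) * expR (- t))%:E by rewrite adde_ge0// mule_ge0.
have ms : measurable_fun (`]0%R, +oo[ : set R) (fun t => (t `^ (x - 1) * expR (- t))%:E +
    (l ^+ 2)%:E * (t `^ (x + 1 - 1) * expR (- t))%:E).
  by apply: emeasurable_funD; [exact: mg|exact: mZ].
apply: ge0_le_integral => //; try exact: mZ; try by move=> t _; rewrite mule_ge0.
move=> t; rewrite /= in_itv/= andbT => t0.
rewrite -!EFinM -EFinD lee_fin !mulrA -mulrDl ler_wpM2r ?expR_ge0//.
have t0' : t != 0%R by rewrite gt_eqF.
have -> : (x + 2^-1 - 1 = (x - 1) + 2^-1)%R by ring.
have -> : (x + 1 - 1 = (x - 1) + 1)%R by ring.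
rewrite (@powRD _ t (x - 1) 2^-1) ?t0' ?implybT// (@powRD _ t (x - 1) 1) ?t0' ?implybT//.
rewrite powRr1 ?(ltW t0)// powR12_sqrt ?(ltW t0)//.
set w := (t `^ (x - 1))%R; have w0 : (0 <= w)%R by exact: powR_ge0.
rewrite -subr_ge0 (_ : _ - _ = w * (1 - l * Num.sqrt t) ^+ 2)%R.
  by rewrite mulr_ge0 ?sqr_ge0.
by rewrite -[in X in (_ + X - _)%R](sqr_sqrtr (ltW t0)); ring.
Qed.

Local Opaque eGamma.

Lemma eGamma_half_lty j : eGamma (j.+1%:R / 2) < +oo.
Proof.
have h1 : eGamma 1 < +oo by rewrite eGamma1 ltry.
have hS x : (0 < x)%R -> eGamma x < +oo -> eGamma (x + 1) < +oo.
  by move=> x0 hx; rewrite eGammaD1// lte_mul_pinfty// lee_fin ltW.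
have i2 : (0 < 2^-1 :> R)%R by rewrite invr_gt0.
(* Gamma (1/2) = 2 Gamma (3/2), which is at most Gamma 1 + Gamma 2 by [eGammaD_half] at x = l =
   1. *)
have h2 : eGamma 2^-1 < +oo.
  have := @eGammaD_half 1 1 ltr01 ler01; rewrite expr1n mul1e mulr1.
  rewrite (_ : (1 + 2^-1)%R = (2^-1 + 1)%R :> R); last by rewrite addrC.
  rewrite (eGammaD1 i2) muleA -EFinM divff// mul1e => /le_lt_trans; apply.
  by rewrite lte_add_pinfty// hS.
elim/ltn_ind: j => -[|[|j]] IH; first by rewrite mul1r.
  by rewrite divff.
have -> : (j.+3%:R / 2 = j.+1%:R / 2 + 1 :> R)%R by rewrite -[in LHS]addn2 natrD; field.
by apply: hS; [rewrite divr_gt0|exact: IH].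
Qed.

Local Close Scope ereal_scope.

(** Indexed by twice the argument, so that integers and half-integers form one sequence with a
    two-step recurrence. *)
Definition gh j : R := Gamma (j%:R / 2).

Lemma eGamma_ghE j : (eGamma (j.+1%:R / 2) = (gh j.+1)%:E)%E.
Proof. by rewrite /gh GammaE fineK// ge0_fin_numE ?eGamma_ge0 ?eGamma_half_lty. Qed.

Lemma ghSS j : gh j.+3 = j.+1%:R / 2 * gh j.+1.
Proof.
apply: EFin_inj; rewrite EFinM -!eGamma_ghE -eGammaD1 ?divr_gt0//.
by congr eGamma; rewrite -[in LHS]addn2 natrD; field.
Qed.

Lemma gh_ge0 j : 0 <= gh j.+1.
Proof. by rewrite -lee_fin -eGamma_ghE eGamma_ge0. Qed.

Local Opaque gh.

Lemma gh2 : gh 2 = 1.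
Proof. by apply: EFin_inj; rewrite -eGamma_ghE divff// eGamma1. Qed.

(** Log-convexity of Gamma at the midpoint of x and x + 1, since x Gamma(x)^2 = Gamma(x) Gamma(x +
    1). *)
Lemma gh_sq j : gh j.+2 ^+ 2 <= j.+1%:R / 2 * gh j.+1 ^+ 2.
Proof.
set x : R := j.+1%:R / 2; have x0 : 0 < x by rewrite divr_gt0.
have sx : 0 < Num.sqrt x by rewrite sqrtr_gt0.
have l0 : 0 <= (Num.sqrt x)^-1 by rewrite invr_ge0 ltW.
(* The optimal l = 1 / sqrt x makes the two terms on the right equal. *)
have := eGammaD_half x0 l0; rewrite eGammaD1// /x eGamma_ghE.
have -> : j.+1%:R / 2 + 2^-1 = j.+2%:R / 2 :> R by rewrite -[in RHS]addn1 natrD; field.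
rewrite eGamma_ghE -!EFinM -EFinD lee_fin -/x exprVn sqr_sqrtr ?(ltW x0)//.
rewrite (_ : gh j.+1 + _ = 2 * gh j.+1); last by field; rewrite gt_eqF.
rewrite -mulrA ler_pM2l// mulrC ler_pdivrMr// => h.
rewrite (le_trans (_ : _ <= (gh j.+1 * Num.sqrt x) ^+ 2))//.
  by rewrite ler_pXn2r ?nnegrE ?gh_ge0 ?mulr_ge0 ?gh_ge0 ?(ltW sx).
by rewrite exprMn sqr_sqrtr ?(ltW x0)// mulrC.
Qed.

Lemma gh_gt0 j : 0 < gh j.+1.
Proof.
have h1 : 0 < gh 1.
  rewrite lt_neqAle gh_ge0 andbT eq_sym; apply/eqP => e.
  by have := gh_sq 0; rewrite gh2 e expr1n expr0n mulr0 ler10.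
elim/ltn_ind: j => -[|[|j]] IH //; first by rewrite gh2.
by rewrite ghSS mulr_gt0 ?divr_gt0 ?IH.
Qed.

Lemma Gamma_natS k : Gamma k.+1%:R = k`!%:R :> R.
Proof.
have -> : k.+1%:R = (k.+1).*2%:R / 2 :> R by rewrite -muln2 natrM; field.
rewrite -[LHS]/(gh _); elim: k => [|k IH]; first by rewrite gh2.
rewrite !doubleS ghSS -!doubleS IH factS natrM -muln2 natrM.
by congr (_ * _); field.
Qed.

(** By the recurrence the product of two successive ratios is explicit, so the upper bound on one is
    a lower bound on the next: the square of [tau j] lies between j/2 and (j + 1)/2 for j > 0. *)
Definition tau j : R := gh j.+2 / gh j.+1.

Lemma tau_gt0 j : 0 < tau j.
Proof. by rewrite divr_gt0// gh_gt0. Qed.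

Lemma tau_sq_le j : tau j ^+ 2 <= j.+1%:R / 2.
Proof. by rewrite expr_div_n ler_pdivrMr ?exprn_gt0 ?gh_gt0// gh_sq. Qed.

Lemma tau_sq_ge j : j.+1%:R / 2 <= tau j.+1 ^+ 2.
Proof.
have e : tau j * tau j.+1 = j.+1%:R / 2.
  by rewrite /tau ghSS; field; rewrite !gt_eqF ?gh_gt0.
have h := tau_sq_le j; have t0 := tau_gt0 j; have t1 := tau_gt0 j.+1.
have c0 : 0 < j.+1%:R / 2 :> R by rewrite divr_gt0.
rewrite -(ler_pM2l c0) -expr2 -[in leLHS]e exprMn.
by rewrite ler_wpM2r ?sqr_ge0.
Qed.

Lemma tau_prod j n : \prod_(i < n) tau (j + i) = gh (j + n).+1 / gh j.+1.
Proof.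
elim: n => [|n IH]; first by rewrite big_ord0 addn0 divff// gt_eqF// gh_gt0.
by rewrite big_ord_recr /= IH /tau addnS; field; rewrite !gt_eqF ?gh_gt0.
Qed.

(** The bounds on [tau] concern its square; they transfer because the quotient y satisfies 0 < y <=
    1, whence 1 - y <= 1 - y^2. That y <= 1 uses [0 < n], which orders the two ranges. *)
Lemma tau_ratio_dist j n : (0 < n)%N -> `|tau j.+1 / tau (j.+1 + n) - 1| <= n.+1%:R / j.+1%:R.
Proof.
move=> n0; set y := tau j.+1 / _; have y0 : 0 < y by rewrite divr_gt0 ?tau_gt0.
have h1 := tau_sq_ge j; have h2 := tau_sq_le (j.+1 + n).
have h3 := tau_sq_le j.+1; have h4 := tau_sq_ge (j + n).
have T0 : 0 < tau (j.+1 + n) ^+ 2 by rewrite exprn_gt0 ?tau_gt0.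
have y1 : y ^+ 2 <= 1.
  rewrite /y expr_div_n ler_pdivrMr// mul1r (le_trans h3)// addSn (le_trans _ h4)//.
  by rewrite ler_pM2r ?invr_gt0// ler_nat ltnS -[X in (X < _)%N]addn0 ltn_add2l.
have y1' : y <= 1.
  have : y ^+ 2 <= 1 ^+ 2 by rewrite expr1n.
  by rewrite ler_pXn2r ?nnegrE ?(ltW y0) ?ler01.
rewrite ler0_norm ?subr_le0// opprB.
have le : 1 - y <= 1 - y ^+ 2 by rewrite lerD2l lerN2 expr2 ler_piMr// ltW.
apply: (le_trans le).
have lo : j.+1%:R / (j.+1 + n).+1%:R <= y ^+ 2.
  rewrite /y expr_div_n ler_pdivlMr// mulrAC ler_pdivrMr//.
  have : tau (j.+1 + n) ^+ 2 * j.+1%:R <= ((j.+1 + n).+1%:R / 2) * j.+1%:R.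
    by rewrite ler_wpM2r.
  have : (j.+1%:R / 2) * (j.+1 + n).+1%:R <= tau j.+1 ^+ 2 * (j.+1 + n).+1%:R.
    by rewrite ler_wpM2r.
  rewrite [j.+1%:R * tau _ ^+ 2]mulrC => A1 A2.
  by apply: (le_trans A2); apply: le_trans A1; rewrite mulrAC [X in _ <= X]mulrAC [X in X /
    2]mulrC.
have -> : 1 - y ^+ 2 <= n.+1%:R / j.+1%:R = (1 - n.+1%:R / j.+1%:R <= y ^+ 2).
  by rewrite lerBlDr addrC -lerBlDr.
apply: le_trans lo.
rewrite -addnS natrD; set a : R := j.+1%:R; set b : R := n.+1%:R.
have a0 : 0 < a by []; have b0 : 0 < b by [].
rewrite ler_pdivlMr ?addr_gt0// mulrBl mul1r -subr_ge0.
rewrite (_ : _ - _ = b ^+ 2 / a); last by field; rewrite gt_eqF.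
by rewrite divr_ge0 ?sqr_ge0 ?ltW.
Qed.

Lemma cvg_bigprod n (f : 'I_n -> nat -> R) (l : 'I_n -> R) :
  (forall i, f i @ \oo --> l i) ->
  (fun K => \prod_(i < n) f i K) @ \oo --> \prod_(i < n) l i.
Proof.
elim: n f l => [|n IH] f l fl.
  by under eq_fun do rewrite big_ord0; rewrite big_ord0; exact: cvg_cst.
under eq_fun do rewrite big_ord_recr; rewrite big_ord_recr.
by apply: cvgM; [exact: IH|exact: fl].
Qed.

(** With x = K + 1, both Gamma(x + n/2) / Gamma(x) and Gamma(x + n) / Gamma(x + n/2) are products of
    n factors [tau], which are compared one by one. *)
Lemma gh_ratio_cvg n : (0 < n)%N ->
  (fun K => gh (K.*2.+2 + n) ^+ 2 / (gh K.*2.+2 * gh (K.*2.+2 + n + n))) @ \oo --> (1 : R).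
Proof.
move=> n0.
rewrite (_ : (fun _ => _) = fun K => \prod_(i < n) (tau (K.*2.+1 + i) / tau (K.*2.+1 + i +
  n))); last first.
  apply/funext => K; rewrite prodf_div tau_prod.
  under [X in _ = _ / X]eq_bigr do rewrite addnAC.
  rewrite tau_prod !addSn expr2; field.
  by rewrite !gt_eqF ?gh_gt0.
rewrite [X in _ --> X](_ : 1 = \prod_(i < n) 1); last by rewrite big1.
apply: (@cvg_bigprod n (fun i K => tau (K.*2.+1 + i) / tau (K.*2.+1 + i + n)) (fun=> 1)) => i.
apply/cvgrPdist_le => e e0; near=> K.
rewrite distrC addSn (le_trans (tau_ratio_dist _ n0))//.
rewrite ler_pdivrMr// -ler_pdivrMl// mulrC.
apply: (@le_trans _ _ K%:R).
  by near: K; exact: nbhs_infty_ger.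
by rewrite ler_nat leqW// (leq_trans _ (leq_addr _ _))// -addnn leq_addr.
Unshelve. all: by end_near. Qed.

End gamma_function.

(** * The mass of the Green kernel *)

Section binomial_series.
Context {R : realType}.
Implicit Types (A B s t : R) (k K : nat).

(* The coefficients of (1 - x)^(- n/2). *)
Fixpoint bc (n : nat) k : R :=
  if k is k'.+1 then bc n k' * (n%:R / 2 + k'%:R) / k'.+1%:R else 1.

Lemma bcS n k : k.+1%:R * bc n k.+1 = (n%:R / 2 + k%:R) * bc n k.
Proof. by rewrite /= mulrC divfK// mulrC. Qed.

Lemma bc_ge0 n k : 0 <= bc n k.
Proof.
by elim: k => //= k IH; rewrite divr_ge0// mulr_ge0// addr_ge0// divr_ge0.
Qed.

(** Any polynomial bound is enough against s^K. The induction step is Bernoulli's inequality for ((k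
    + 2) / (k + 1))^n. *)
Lemma bc_le n k : bc n k <= k.+1%:R ^+ n.
Proof.
elim: k => [|k IH]; first by rewrite expr1n.
rewrite /= ler_pdivrMr//.
have k1 : 0 < k.+1%:R :> R by [].
have bern : 1 + n%:R / k.+1%:R <= (k.+2%:R / k.+1%:R) ^+ n :> R.
  have -> : k.+2%:R / k.+1%:R = 1 + k.+1%:R^-1 :> R.
    by rewrite -[k.+2]addn1 natrD mulrDl mul1r divff.
  have h : 0 <= k.+1%:R^-1 :> R by rewrite invr_ge0.
  elim: (n) => [|i IHi]; first by rewrite mul0r addr0 expr0.
  rewrite exprS; apply: le_trans (_ : _ <= (1 + k.+1%:R^-1) * (1 + i%:R / k.+1%:R)) _.
    rewrite -[i.+1%:R]natr1; have : 0 <= i%:R * (k.+1%:R^-1 * k.+1%:R^-1) :> R by rewrite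
      !mulr_ge0.
    by move: (k.+1%:R^-1 : R) h => x _ h; rewrite -subr_ge0 (_ : _ - _ = i%:R * (x * x))//;
      ring.
  by rewrite ler_pM2l// ltr_wpDr.
have e : k.+2%:R ^+ n = k.+1%:R ^+ n * (k.+2%:R / k.+1%:R) ^+ n :> R.
  by rewrite expr_div_n mulrC divfK// expf_neq0.
rewrite e mulrAC; have c0 := bc_ge0 n k.
have n2 : n%:R / 2 + k%:R <= k.+1%:R * (1 + n%:R / k.+1%:R) :> R.
  rewrite mulrDr mulr1 mulrCA divff// mulr1 -[k.+1%:R]natr1.
  have : 0 <= n%:R :> R by [].
  by move: (n%:R : R) (k%:R : R) => x y; lra.
rewrite [leRHS]mulrAC -[leRHS]mulrA ler_pM ?addr_ge0 ?divr_ge0//.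
by rewrite (le_trans n2)// mulrC ler_pM2r.
Qed.

(* The real and imaginary parts of zeta ^ k, where zeta = A + i B. *)
Fixpoint zpow A B k : R * R :=
  if k is k'.+1 then let z := zpow A B k' in (A * z.1 - B * z.2, A * z.2 + B * z.1)
  else (1, 0).

Lemma zpow_norm A B k : (zpow A B k).1 ^+ 2 + (zpow A B k).2 ^+ 2 = (A ^+ 2 + B ^+ 2) ^+ k.
Proof.
elim: k => [|k IH]; first by rewrite /= expr1n expr0n addr0 expr0.
by rewrite [RHS]exprS -IH /=; ring.
Qed.

Section truncation.
Variables (n : nat) (A B : R).
Hypothesis r1 : A ^+ 2 + B ^+ 2 <= 1.
Let a : R := n%:R / 2.

Let A1 : `|A| <= 1.
Proof.
rewrite -(@ler_pXn2r _ 2)// ?nnegrE// real_normK ?num_real// expr1n.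
by apply: le_trans r1; rewrite lerDl sqr_ge0.
Qed.

Let B1 : `|B| <= 1.
Proof.
rewrite -(@ler_pXn2r _ 2)// ?nnegrE// real_normK ?num_real// expr1n.
by apply: le_trans r1; rewrite lerDr sqr_ge0.
Qed.

Lemma zpow_le1 k : `|(zpow A B k).1| <= 1 /\ `|(zpow A B k).2| <= 1.
Proof.
have h : (A ^+ 2 + B ^+ 2) ^+ k <= 1 by rewrite exprn_ile1// addr_ge0 ?sqr_ge0.
rewrite -zpow_norm in h.
split; rewrite -(@ler_pXn2r _ 2)// ?nnegrE// real_normK ?num_real// expr1n;
  by apply: le_trans h; rewrite ?lerDl ?lerDr sqr_ge0.
Qed.

(* tU + i tV is the truncation to order K of (1 - t zeta) ^ (- n/2). *)
Definition tU K t : R := \sum_(k < K) bc n k * (zpow A B k).1 * t ^+ k.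
Definition tV K t : R := \sum_(k < K) bc n k * (zpow A B k).2 * t ^+ k.
Let dU K t : R := \sum_(k < K) bc n k * (zpow A B k).1 * (k%:R * t ^+ k.-1).
Let dV K t : R := \sum_(k < K) bc n k * (zpow A B k).2 * (k%:R * t ^+ k.-1).
Let q t : R := (1 - t * A) ^+ 2 + (t * B) ^+ 2.

Let is_derive_sumX (w : nat -> R) K t :
  is_derive t (1 : R) (fun t => \sum_(k < K) w k * t ^+ k)
    (\sum_(k < K) w k * (k%:R * t ^+ k.-1)).
Proof.
elim: K => [|K IH].
  by rewrite big_ord0; under eq_fun do rewrite big_ord0; exact: is_derive_cst.
rewrite big_ord_recr; under eq_fun do rewrite big_ord_recr.
apply: is_deriveD => //=.
have h : is_derive t (1 : R) (fun t : R => t ^+ K) (K%:R * t ^+ K.-1).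
  by apply: DeriveDef; [exact: exprn_derivable|rewrite exp_derive /GRing.scale/= mulr1].
have := @is_deriveZ _ _ _ (fun t : R => t ^+ K) (w K) t 1 _ h.
exact.
Qed.

(* The truncation g satisfies (1 - t zeta) g' = a zeta g - K b_K zeta^K t^(K-1). *)
Let tode K t :
  dU K t * (1 - t * A) + t * B * dV K t =
    a * (A * tU K t - B * tV K t) - K%:R * bc n K * (zpow A B K).1 * t ^+ K.-1 /\
  dV K t * (1 - t * A) - t * B * dU K t =
    a * (A * tV K t + B * tU K t) - K%:R * bc n K * (zpow A B K).2 * t ^+ K.-1.
Proof.
elim: K => [|K [IH1 IH2]].
  by rewrite /dU /dV /tU /tV !big_ord0; split; ring.
have tK : K%:R * t ^+ K = K%:R * (t * t ^+ K.-1) :> R.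
  by case: (K) => [|k]; rewrite ?mul0r//= exprS.
have b1 := bcS n K.
rewrite /dU /dV /tU /tV !big_ord_recr -!/(dU K t) -!/(dV K t) -!/(tU K t) -!/(tV K t).
rewrite /=.
rewrite -/(bc n K.+1) !b1 -/a.
move: (zpow A B K).1 (zpow A B K).2 IH1 IH2 tK => x y.
move: (dU K t) (dV K t) (tU K t) (tV K t) (bc n K) => du dv u v c.
move: (t ^+ K.-1) (t ^+ K) (K%:R : R) => p p' k IH1 IH2 tK.
split.
  transitivity ((du * (1 - t * A) + t * B * dv) + c * (k * p) * (x - (A * x - B * y) * t));
    first by ring.
  rewrite IH1; transitivity (a * (A * u - B * v) - c * (A * x - B * y) * (k * (t * p)));
    first by ring.
  by rewrite -tK; ring.
transitivity ((dv * (1 - t * A) - t * B * du) + c * (k * p) * (y - (A * y + B * x) * t));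
  first by ring.
rewrite IH2; transitivity (a * (A * v + B * u) - c * (A * y + B * x) * (k * (t * p)));
  first by ring.
by rewrite -tK; ring.
Qed.

Lemma q_bounds s t : 0 <= t <= s -> s < 1 -> (1 - s) ^+ 2 <= q t <= 5.
Proof.
move=> /andP[t0 ts] s1.
have := A1; rewrite ler_norml => /andP[A2 A3].
have := B1; rewrite ler_norml => /andP[B2 B3].
have tA : t * A <= t by rewrite ler_piMr.
have tA' : - t <= t * A by rewrite -mulrN1 ler_wpM2l.
have tB : t * B <= t by rewrite ler_piMr.
have tB' : - t <= t * B by rewrite -mulrN1 ler_wpM2l.
apply/andP; split.
  apply: (@le_trans _ _ ((1 - t * A) ^+ 2)); last by rewrite lerDl sqr_ge0.
  by rewrite ler_pXn2r// ?nnegrE; move: (t * A) tA tA' => x; lra.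
have h1 : (1 - t * A) ^+ 2 <= 4.
  rewrite (_ : 4 = 2 ^+ 2); last by rewrite -natrX.
  by rewrite ler_pXn2r// ?nnegrE; move: (t * A) tA tA' => x; lra.
have h2 : (t * B) ^+ 2 <= 1.
  by rewrite -real_normK ?num_real// exprn_ile1// ler_norml; move: (t * B) tB tB' => x *;
    apply/andP; split; lra.
by move: h1 h2; rewrite /q; lra.
Qed.

(** This is |g|^2 |1 - t zeta|^n for the truncation g. It is 1 at t = 0, and would be constant for
    the full series. *)
Let F K t : R := (tU K t ^+ 2 + tV K t ^+ 2) * q t `^ a.

(** The derivative of the power of [q] cancels the main part of [tode]; only its remainder in
    t^(K-1) survives. *)
Let is_derive_F K t : 0 < q t ->
  is_derive t (1 : R) (F K)
    (- 2 * q t `^ (a - 1) * (K%:R * bc n K * t ^+ K.-1) *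
     (tU K t * ((1 - t * A) * (zpow A B K).1 - t * B * (zpow A B K).2) +
      tV K t * (t * B * (zpow A B K).1 + (1 - t * A) * (zpow A B K).2))).
Proof.
move=> q0.
have hU : is_derive t (1 : R) (tU K) (dU K t).
  by have := is_derive_sumX (fun k => bc n k * (zpow A B k).1) K t.
have hV : is_derive t (1 : R) (tV K) (dV K t).
  by have := is_derive_sumX (fun k => bc n k * (zpow A B k).2) K t.
have hq : is_derive t (1 : R) q (- 2 * A * (1 - t * A) + 2 * B * (t * B)).
  rewrite /q; under eq_fun do rewrite !expr2.
  by apply: is_derive_eq; rewrite /GRing.scale/=; ring.
have hqa : is_derive t (1 : R) (fun t => q t `^ a)
    (a * q t `^ (a - 1) * (- 2 * A * (1 - t * A) + 2 * B * (t * B))).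
  exact: (@is_derive1_comp R (fun x : R => x `^ a) q _ _ _ (is_derive1_powR a q0) hq).
have eF : F K = (fun t => (tU K t * tU K t + tV K t * tV K t) * q t `^ a).
  by apply/funext => x; rewrite /F !expr2.
rewrite eF.
have h2 := is_deriveM (is_deriveD (is_deriveM hU hU) (is_deriveM hV hV)) hqa.
apply: is_derive_eq h2 _; rewrite /GRing.scale/=.
have [e1 e2] := tode K t.
have e3 : q t `^ a = q t * q t `^ (a - 1).
  rewrite -[X in X * _](powRr1 (ltW q0)) -powRD; last by rewrite (gt_eqF q0) implybT.
  by congr (_ `^ _); ring.
rewrite !fctE e3; move: (q t `^ (a - 1)) => Q.
rewrite {e3 hqa eF hq q0} /q.
move: (tU K t) (tV K t) (dU K t) (dV K t) (zpow A B K).1 (zpow A B K).2 e1 e2 {hU hV} => u v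
  du dv x y.
move: (K%:R * bc n K) (t ^+ K.-1) => c p e1 e2.
(* q (u du + v dv) is regrouped as the real part of conj(g) conj(1 - t zeta) times (1 - t zeta) g',
   so that [tode] can be substituted. *)
transitivity (2 * Q * (u * ((1 - t * A) * (du * (1 - t * A) + t * B * dv) - t * B * (dv * (1 -
  t * A) - t * B * du))
   + v * (t * B * (du * (1 - t * A) + t * B * dv) + (1 - t * A) * (dv * (1 - t * A) - t * B *
     du)))
   + (u ^+ 2 + v ^+ 2) * (a * Q * (- 2 * A * (1 - t * A) + 2 * B * (t * B)))); first by ring.
by rewrite e1 e2; ring.
Qed.

Let tUV_le K t : 0 <= t <= 1 ->
  `|tU K t| <= K.+1%:R ^+ n.+1 /\ `|tV K t| <= K.+1%:R ^+ n.+1.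
Proof.
move=> /andP[t0 t1].
have h (w : nat -> R) : (forall k, `|w k| <= 1) ->
    `|\sum_(k < K) bc n k * w k * t ^+ k| <= K.+1%:R ^+ n.+1.
  move=> w1; apply: (le_trans (ler_norm_sum _ _ _)).
  apply: (@le_trans _ _ (\sum_(k < K) K.+1%:R ^+ n)).
    apply: ler_sum => k _; rewrite !normrM (ger0_norm (bc_ge0 _ _)).
    rewrite (ger0_norm (exprn_ge0 _ t0)) -mulrA -[leRHS]mulr1 ler_pM ?bc_ge0 ?mulr_ge0
      ?exprn_ge0//.
      apply: (le_trans (bc_le _ _)); rewrite lerXn2r ?nnegrE// ler_nat.
      by rewrite ltnS ltnW.
    by rewrite mulr_ile1 ?exprn_ge0 ?exprn_ile1.
  by rewrite sumr_const card_ord -[leLHS]mulr_natl exprS ler_wpM2r ?exprn_ge0// ler_nat leqnSn.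
split.
  by apply: (h (fun k => (zpow A B k).1)) => k; have [] := zpow_le1 k.
by apply: (h (fun k => (zpow A B k).2)) => k; have [] := zpow_le1 k.
Qed.

(** The mean value theorem for [F] between 0 and [s]. It serves as the binomial theorem for |1 - s
    zeta|^(-n), uniformly in zeta and with real powers only. The constant 12 is 2 times 3 + 3, where
    3 = 2 + 1 bounds |1 - t A| + |t B|. *)
Lemma truncation_estimate s K : 0 <= s < 1 -> (0 < K)%N ->
  `|(tU K s ^+ 2 + tV K s ^+ 2) * q s `^ a - 1| <=
  12 * (5 `^ a / (1 - s) ^+ 2) * (K.+1%:R ^+ (n.+1 + n.+1) * s ^+ K.-1).
Proof.
move=> /andP[s0 s1] K0.
have s10 : 0 < 1 - s by rewrite subr_gt0.
have s20 : 0 < (1 - s) ^+ 2 by rewrite exprn_gt0.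
have q0 t : 0 <= t <= s -> 0 < q t.
  by move=> /q_bounds/(_ s1)/andP[h _]; exact: lt_le_trans h.
pose dF t := - 2 * q t `^ (a - 1) * (K%:R * bc n K * t ^+ K.-1) *
     (tU K t * ((1 - t * A) * (zpow A B K).1 - t * B * (zpow A B K).2) +
      tV K t * (t * B * (zpow A B K).1 + (1 - t * A) * (zpow A B K).2)).
have F0 : F K 0 = 1.
  rewrite /F /q !mul0r subr0 expr1n expr0n addr0 powR1 mulr1 /tU /tV.
  case: K K0 {dF} => // K _; rewrite !big_ord_recl /= !big1 => [|i _|i _]; last 2 first.
    by rewrite expr0n /= mulr0.
    by rewrite expr0n /= mulr0.
  by rewrite expr0 !mulr1 mulr0 addr0 addr0 expr1n expr0n addr0.
have dF_le t : 0 <= t <= s -> `|dF t| <= 12 * (5 `^ a / (1 - s) ^+ 2) * (K.+1%:R ^+ (n.+1 +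
  n.+1) * s ^+ K.-1).
  move=> ts; have /andP[t0 ts'] := ts; have t01 : 0 <= t <= 1 by rewrite t0 (le_trans ts')//
    ltW.
  have [hU hV] := tUV_le K t01.
  have [x1 y1] := zpow_le1 K.
  have /andP[ql qu] := q_bounds ts s1.
  have qt0 := q0 _ ts.
  have hq : q t `^ (a - 1) <= 5 `^ a / (1 - s) ^+ 2.
    rewrite powRB; last by rewrite (gt_eqF qt0) implybT.
    rewrite powRr1 ?(ltW qt0)// ler_pM ?powR_ge0 ?invr_ge0 ?(ltW qt0)//.
      by apply: ge0_ler_powR => //; rewrite ?nnegrE ?divr_ge0// ltW.
    by rewrite lef_pV2 ?posrE.
  have tA : `|1 - t * A| <= 2.
    have : `|t * A| <= 1 by rewrite normrM mulr_ile1// ger0_norm//; case/andP: t01.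
    by rewrite !ler_norml => /andP[? ?]; apply/andP; split; lra.
  have tB : `|t * B| <= 1 by rewrite normrM mulr_ile1// ger0_norm//; case/andP: t01.
  have b1 x y : `|x| <= 1 -> `|y| <= 1 -> `|(1 - t * A) * x - t * B * y| <= 3.
    move=> hx hy; rewrite (le_trans (ler_normB _ _))// (normrM (1 - t * A)) (normrM (t * B)).
    have : `|1 - t * A| * `|x| <= 2 * 1 by rewrite ler_pM.
    have : `|t * B| * `|y| <= 1 * 1 by rewrite ler_pM.
    lra.
  have b2 : `|t * B * (zpow A B K).1 + (1 - t * A) * (zpow A B K).2| <= 3.
    have -> : t * B * (zpow A B K).1 + (1 - t * A) * (zpow A B K).2 =
      (1 - t * A) * (zpow A B K).2 - t * B * (- (zpow A B K).1) by ring.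
    by apply: b1 => //; rewrite normrN.
  have hc : K%:R * bc n K * t ^+ K.-1 <= K.+1%:R ^+ n.+1 * s ^+ K.-1.
    rewrite exprS ler_pM ?mulr_ge0 ?bc_ge0 ?exprn_ge0//.
      by rewrite ler_pM ?bc_ge0 ?bc_le// ler_nat.
    by rewrite lerXn2r ?nnegrE.
  have hc0 : 0 <= K%:R * bc n K * t ^+ K.-1 by rewrite !mulr_ge0 ?bc_ge0 ?exprn_ge0.
  rewrite /dF !normrM normrN (ger0_norm (powR_ge0 _ _)) -!normrM (ger0_norm hc0).
  rewrite [`|2|]ger0_norm//.
  set W := `|_ + _|; have hW : W <= 6 * K.+1%:R ^+ n.+1.
    rewrite /W (le_trans (ler_normD _ _))// !normrM.
    have p1 : `|tU K t| * `|(1 - t * A) * (zpow A B K).1 - t * B * (zpow A B K).2| <= K.+1%:R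
      ^+ n.+1 * 3.
      by rewrite ler_pM// b1.
    have p2 : `|tV K t| * `|t * B * (zpow A B K).1 + (1 - t * A) * (zpow A B K).2| <= K.+1%:R
      ^+ n.+1 * 3.
      by rewrite ler_pM.
    by move: p1 p2; lra.
  rewrite exprD; move: (5 `^ a / (1 - s) ^+ 2) hq => C hq.
  have -> : 12 * C * (K.+1%:R ^+ n.+1 * K.+1%:R ^+ n.+1 * s ^+ K.-1) =
      2 * C * (K.+1%:R ^+ n.+1 * s ^+ K.-1) * (6 * K.+1%:R ^+ n.+1).
    by move: (K.+1%:R ^+ n.+1) (s ^+ K.-1) => x y; ring.
  have W0 : 0 <= W by rewrite /W normr_ge0.
  have Q0 : 0 <= 2 * q t `^ (a - 1) by rewrite mulr_ge0 ?powR_ge0.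
  apply: ler_pM => //; first exact: mulr_ge0.
  by apply: ler_pM => //; rewrite ler_pM2l.
have dFd t : t \in `]0, s[%R -> is_derive t 1 (F K) (dF t).
  by rewrite in_itv/= => /andP[t0 ts]; apply: is_derive_F; apply: q0; rewrite !ltW.
have cF : {within `[0, s], continuous (F K)}.
  apply: derivable_within_continuous => t; rewrite in_itv/= => ts.
  by have [] := is_derive_F K (q0 _ ts).
have [c cs e] := MVT_segment s0 dFd cF.
rewrite -/(F K s) -[X in `|_ - X|]F0 e.
rewrite subr0 normrM (ger0_norm s0) -[leRHS]mulr1 ler_pM// ?(ltW s1)//.
by apply: dF_le; move: cs; rewrite in_itv.
Qed.

End truncation.

(** With x = s^(1/(p+1)) the sequence is, up to a constant, ((K + 1) x^K)^p x^K. Its first factor is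
    bounded, as each of the K + 1 terms of the geometric sum of ratio x is at least x^K. *)
Lemma cvg_poly_geometric s p : 0 <= s < 1 ->
  (fun K : nat => K.+1%:R ^+ p * s ^+ K.-1) @ \oo --> (0 : R).
Proof.
move=> /andP[s0 s1].
have [->|s00] := eqVneq s 0.
  apply: cvg_near_cst; near=> K.
  rewrite expr0n (_ : (K.-1 == 0)%N = false) ?mulr0//.
  have : (2 <= K)%N by near: K; exact: nbhs_infty_ge.
  by move=> hK; apply/negbTE; rewrite -lt0n -subn1 subn_gt0.
have sp : 0 < s by rewrite lt_neqAle eq_sym s00.
pose x := s `^ (p.+1%:R^-1).
have x0 : 0 < x by rewrite powR_gt0.
have xs : x ^+ p.+1 = s.
  by rewrite -powR_mulrn ?(ltW x0)// -powRrM mulVf// powRr1.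
have x1 : x < 1 by rewrite -(@ltr_pXn2r _ p.+1)// ?nnegrE ?(ltW x0)// expr1n xs.
have lin K : K.+1%:R * x ^+ K <= (1 - x)^-1.
  rewrite -[leRHS]mul1r ler_pdivlMr ?subr_gt0//.
  apply: (@le_trans _ _ ((\sum_(i < K.+1) x ^+ i) * (1 - x))); last first.
    rewrite -[1 - x]opprB mulrN mulrC -subrX1 opprB lerBlDr lerDl exprn_ge0//.
    exact: ltW.
  rewrite ler_wpM2r ?subr_ge0 ?(ltW x1)// -[K.+1 in leLHS]card_ord mulr_natl -sumr_const.
  by apply: ler_sum => i _; rewrite ler_wiXn2l ?(ltW x0) ?(ltW x1)// -ltnS ltn_ord.
apply: (@squeeze_cvgr _ _ _ _ (cst 0) (fun K : nat => ((1 - x)^-1 / x) ^+ p / x * x ^+ K)).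
- near=> K; rewrite /cst /= mulr_ge0 ?exprn_ge0//=.
  have K1 : (1 <= K)%N by near: K; exact: nbhs_infty_ge.
  have -> : K.+1%:R ^+ p * s ^+ K.-1 = (K.+1%:R * x ^+ K / x) ^+ p / x * x ^+ K.
    have -> : x ^+ K = x * x ^+ K.-1 by rewrite -exprS prednK.
    rewrite -xs exprAC; move: (x ^+ K.-1) (K.+1%:R : R) => y k.
    have -> : k * (x * y) / x = k * y by field; rewrite (gt_eqF x0).
    rewrite exprS exprMn.
    by field; rewrite (gt_eqF x0).
  rewrite ler_wpM2r ?exprn_ge0 ?(ltW x0)// ler_wpM2r ?invr_ge0 ?(ltW x0)//.
  rewrite lerXn2r ?nnegrE ?divr_ge0 ?mulr_ge0 ?exprn_ge0 ?invr_ge0 ?subr_ge0 ?(ltW x0) ?(ltW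
    x1)//.
  by rewrite ler_wpM2r ?invr_ge0 ?(ltW x0).
- exact: cvg_cst.
- rewrite -(mulr0 (((1 - x)^-1 / x) ^+ p / x)); apply: cvgM; first exact: cvg_cst.
  by apply: cvg_expr; rewrite ger0_norm// ltW.
Unshelve. all: by end_near. Qed.

End binomial_series.

(** * Moments and orthogonality of the powers of zeta *)

Section sphere_moments.
Context {R : realType} {m : nat}.
Local Notation E := (Cspace R m).
Local Notation J := ('I_m + 'I_m)%type.
Local Notation mu := (@sphere_measure R m).
Local Notation S := (@pt R m @^-1` @sphere R m).
Local Opaque dot Lap Zop.
Implicit Types (f g : E -> R) (z P w : E) (k K : nat).

Lemma ZopX (c : J) f k z : Ck 1 f ->
  Zop c (fun z => f z ^+ k) z = k%:R * f z ^+ k.-1 * Zop c f z.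
Proof.
move=> kf; elim: k => [|k IH].
  by under [X in Zop c X]eq_fun do rewrite expr0; rewrite Zop_cst !mul0r.
under [X in Zop c X]eq_fun do rewrite exprS.
rewrite (ZopM c z kf (CkX k kf)) IH.
rewrite mulrCA -[in RHS]natr1; move: (Zop c f z) => x.
case: k {IH} => [|k] /=; first by rewrite !expr0; ring.
by rewrite exprS; move: (f z) (f z ^+ k) (k.+1%:R : R) => a b d; ring.
Qed.

Section at_point.
Variable P : E.
Hypothesis P1 : sphere P.

(** The function that [momentS] integrates in two ways: the real and imaginary parts of |zeta|^(2k)
    zeta, differentiated along the horizontal projections of [P] and [Jv P]. *)
Lemma sum_Zop_rk k z : sphere z ->
  \sum_c crd c P * Zop c (fun z => rk P z ^+ k * dot P z) z +
  \sum_c crd c (Jv P) * Zop c (fun z => rk P z ^+ k * dot (Jv P) z) z =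
  2 * k.+1%:R * (rk P z ^+ k - rk P z ^+ k.+1).
Proof.
move=> z1; have kd w : Ck 1 (fun z : E => dot w z) by exact: Ck_dot.
have kr : Ck 1 (rk P) by exact: Ck_rk.
have Zr c : Zop c (rk P) z = 2 * dot P z * Zop c (fun z => dot P z) z +
    2 * dot (Jv P) z * Zop c (fun z => dot (Jv P) z) z.
  rewrite (_ : rk P = fun z => dot P z ^+ 2 + dot (Jv P) z ^+ 2)//.
  rewrite (ZopD c z (CkX 2 (kd P)) (CkX 2 (kd (Jv P)))).
  by rewrite (ZopX c 2 z (kd P)) (ZopX c 2 z (kd (Jv P))) /= !expr1.
have PP : dot P P = 1 by exact/sphere_dotP.
have PJz : dot P (Jv z) = - dot (Jv P) z by rewrite dot_Jvl opprK.
have JPJz : dot (Jv P) (Jv z) = dot P z by exact: dot_JvJv.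
have e11 : \sum_c crd c P * Zop c (fun z => dot P z) z = 1 - rk P z.
  under eq_bigr do rewrite Zop_dot.
  rewrite -[LHS]/(dot P (hproj z P)) /hproj !dotBr !dotZr PP PJz /rk.
  by move: (dot P z) (dot (Jv P) z) => *; ring.
have e12 : \sum_c crd c P * Zop c (fun z => dot (Jv P) z) z = 0.
  under eq_bigr do rewrite Zop_dot.
  rewrite -[LHS]/(dot P (hproj z (Jv P))) /hproj !dotBr !dotZr dot_Jv PJz JPJz.
  by move: (dot P z) (dot (Jv P) z) => *; ring.
have e21 : \sum_c crd c (Jv P) * Zop c (fun z => dot P z) z = 0.
  under eq_bigr do rewrite Zop_dot.
  rewrite -[LHS]/(dot (Jv P) (hproj z P)) /hproj !dotBr !dotZr [dot (Jv P) P]dotC dot_Jv PJz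
    JPJz.
  by move: (dot P z) (dot (Jv P) z) => *; ring.
have e22 : \sum_c crd c (Jv P) * Zop c (fun z => dot (Jv P) z) z = 1 - rk P z.
  under eq_bigr do rewrite Zop_dot.
  rewrite -[LHS]/(dot (Jv P) (hproj z (Jv P))) /hproj !dotBr !dotZr dot_JvJv PP JPJz /rk.
  by move: (dot P z) (dot (Jv P) z) => *; ring.
have lin (a b d d' : R) (u F G : J -> R) :
    \sum_c u c * (a * F c + b * (d * F c + d' * G c)) =
    a * (\sum_c u c * F c) + b * (d * (\sum_c u c * F c) + d' * (\sum_c u c * G c)).
  by rewrite !mulr_sumr -big_split/= mulr_sumr -big_split/=; apply: eq_bigr => c _; ring.
have main w : \sum_c crd c w * Zop c (fun z => rk P z ^+ k * dot P z) z =
    rk P z ^+ k * (\sum_c crd c w * Zop c (fun z => dot P z) z) +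
    dot P z * (k%:R * rk P z ^+ k.-1) *
     (2 * dot P z * (\sum_c crd c w * Zop c (fun z => dot P z) z) +
      2 * dot (Jv P) z * (\sum_c crd c w * Zop c (fun z => dot (Jv P) z) z)).
  rewrite -lin; apply: eq_bigr => c _.
  by rewrite (ZopM c z (CkX k kr) (kd P)) (ZopX c k z kr) Zr [in LHS]mulrA.
have main' w : \sum_c crd c w * Zop c (fun z => rk P z ^+ k * dot (Jv P) z) z =
    rk P z ^+ k * (\sum_c crd c w * Zop c (fun z => dot (Jv P) z) z) +
    dot (Jv P) z * (k%:R * rk P z ^+ k.-1) *
     (2 * dot P z * (\sum_c crd c w * Zop c (fun z => dot P z) z) +
      2 * dot (Jv P) z * (\sum_c crd c w * Zop c (fun z => dot (Jv P) z) z)).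
  rewrite (_ : _ * _ + _ = rk P z ^+ k * (\sum_c crd c w * Zop c (fun z => dot (Jv P) z) z) +
    dot (Jv P) z * (k%:R * rk P z ^+ k.-1) *
     (2 * dot (Jv P) z * (\sum_c crd c w * Zop c (fun z => dot (Jv P) z) z) +
      2 * dot P z * (\sum_c crd c w * Zop c (fun z => dot P z) z)));
        last by congr (_ + _ * _); exact: addrC.
  rewrite -lin; apply: eq_bigr => c _.
  by rewrite (ZopM c z (CkX k kr) (kd (Jv P))) (ZopX c k z kr) Zr [in LHS]mulrA [X in _ * _ *
    X]addrC.
rewrite main main' e11 e12 e21 e22 -[k.+1%:R]natr1.
have : k%:R * rk P z ^+ k = k%:R * (rk P z ^+ k.-1 * (dot P z ^+ 2 + dot (Jv P) z ^+ 2)).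
  by case: (k) => [|j]; rewrite ?mul0r// -/(rk P z) /= exprSr.
rewrite (exprS (rk P z)); move: (dot P z) (dot (Jv P) z) (k%:R : R) (rk P z) (rk P z ^+ k.-1)
  (rk P z ^+ k).
move=> x y j r p q e.
transitivity (2 * q * (1 - r) + 2 * (1 - r) * (j * (p * (x ^+ 2 + y ^+ 2)))); first by ring.
by rewrite -e; ring.
Qed.

Definition moment k : R := sint (fun z => rk P z ^+ k).

Lemma moment_ge0 k : 0 <= moment k.
Proof. by apply: sint_ge0 => z _; rewrite exprn_ge0 ?addr_ge0 ?sqr_ge0. Qed.

(** The left side of [sum_Zop_rk] integrates to 2 n m_(k+1) by [sint_Zop], the right side to 2 (k +
    1) (m_k - m_(k+1)). *)
Lemma momentS n k : m = n.+1 -> (n + k.+1)%:R * moment k.+1 = k.+1%:R * moment k.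
Proof.
move=> mn.
have kd w : Ck 1 (fun z : E => dot w z) by exact: Ck_dot.
have kr j : Ck 1 (fun z => rk P z ^+ j) by apply: CkX; exact: Ck_rk.
have cr j : sintegrable (fun z => rk P z ^+ j).
  by apply: continuous_sintegrable; apply: (Ck_continuous (kr j)).
pose g w z := rk P z ^+ k * dot w z.
have kg w : Ck 1 (g w) by exact: CkM.
have cZ w c : Ck 0 (fun z => crd c w * Zop c (g w) z).
  by apply: CkZ; apply: Zop_Ck.
have cZs w : continuous (fun z => \sum_c crd c w * Zop c (g w) z).
  by apply: (@Ck_continuous _ _ 0); apply: Ck_sum => c; exact: cZ.
have ccg w c : Ck 0 (fun z => crd c w * (crd c z * g w z)).
  by apply: CkZ; apply: CkM; [exact: Ck_crd|exact/CkS/kg].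
have Isum w : sint (fun z => \sum_c crd c w * Zop c (g w) z) =
    ((m + m)%:R - 2) * sint (fun z => dot w z * g w z).
  rewrite sint_sum; last by move=> c; exact: (Ck_continuous (cZ w c)).
  transitivity (((m + m)%:R - 2) * sint (fun z => \sum_c crd c w * (crd c z * g w z))).
    rewrite sint_sum; last by move=> c; exact: (Ck_continuous (ccg w c)).
    rewrite mulr_sumr; apply: eq_bigr => c _.
    rewrite sintZ; last by apply: continuous_sintegrable;
      exact: (Ck_continuous (Zop_Ck c (kg w))).
    rewrite sint_Zop// sintZ; last first.
      apply: continuous_sintegrable; apply: (@Ck_continuous _ _ 0).
      by apply: CkM; [exact: Ck_crd|exact/CkS/kg].
    by rewrite mulrCA.
  congr (_ * _); apply: eq_sint => z _.
  by under eq_bigr do rewrite mulrA; rewrite -mulr_suml.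
have N2 : (m + m)%:R - 2 = 2 * n%:R :> R.
  by rewrite mn natrD -natr1; move: (n%:R : R) => *; ring.
have e1 : sint (fun z => \sum_c crd c P * Zop c (g P) z + \sum_c crd c (Jv P) * Zop c (g (Jv
  P)) z) =
    2 * k.+1%:R * (moment k - moment k.+1).
  rewrite (eq_sint (g := fun z => 2 * k.+1%:R * (rk P z ^+ k - rk P z ^+ k.+1))); last first.
    by move=> z z1; exact: sum_Zop_rk.
  rewrite sintZ ?sintB//.
  apply: continuous_sintegrable; apply: (@Ck_continuous _ _ 0).
  by apply: CkB; apply: CkS; exact: kr.
have e2 : sint (fun z => \sum_c crd c P * Zop c (g P) z + \sum_c crd c (Jv P) * Zop c (g (Jv
  P)) z) =
    2 * n%:R * moment k.+1.
  rewrite sintD; [|exact: continuous_sintegrable|exact: continuous_sintegrable].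
  rewrite !Isum N2 -mulrDr -sintD.
  - congr (_ * _); apply: eq_sint => z _; rewrite /g exprSr /rk.
    by move: (dot P z) (dot (Jv P) z) (_ ^+ k) => *; ring.
  - by apply: continuous_sintegrable; apply: (@Ck_continuous _ _ 1); exact: CkM.
  - by apply: continuous_sintegrable; apply: (@Ck_continuous _ _ 1); exact: CkM.
rewrite natrD; move: e1; rewrite e2; move: (n%:R : R) (k.+1%:R : R) (moment k) (moment k.+1)
  => *; lra.
Qed.

Let zp k z := zpow (dot P z) (dot (Jv P) z) k.

Lemma Ck_zpow i k : Ck i (fun z => (zp k z).1) /\ Ck i (fun z => (zp k z).2).
Proof.
elim: k => [|k [IH1 IH2]]; first by split; exact: Ck_cst.
by split; [apply: CkB|apply: CkD]; apply: CkM => //; exact: Ck_dot.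
Qed.

Lemma Top_zpow k z :
  'D_(Jv z) (fun z => (zp k z).1) z = - k%:R * (zp k z).2 /\
  'D_(Jv z) (fun z => (zp k z).2) z = k%:R * (zp k z).1.
Proof.
have kd w : derivable (fun z : E => dot w z) z (Jv z).
  exact: (Ck_derivable _ _ (Ck_dot 1 w)).
have PJz : 'D_(Jv z) (fun z => dot P z) z = - dot (Jv P) z by rewrite derive_dot dot_Jvl opprK.
have JPJz : 'D_(Jv z) (fun z => dot (Jv P) z) z = dot P z by rewrite derive_dot dot_JvJv.
elim: k => [|k [IH1 IH2]]; first by rewrite /= !derive_cst oppr0 !mul0r.
have k1 := Ck_derivable (Jv z) z (Ck_zpow 1 k).1.
have k2 := Ck_derivable (Jv z) z (Ck_zpow 1 k).2.
have d11 := derivableM (kd P) k1.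
have d12 := derivableM (kd P) k2.
have d21 := derivableM (kd (Jv P)) k1.
have d22 := derivableM (kd (Jv P)) k2.
rewrite -natr1; split.
  rewrite (deriveB d11 d22) (deriveM (kd P) k1) (deriveM (kd (Jv P)) k2) IH1 IH2 PJz JPJz.
  rewrite -[(zp k.+1 z).2]/(dot P z * (zp k z).2 + dot (Jv P) z * (zp k z).1) /GRing.scale/=.
  by move: (zp k z).1 (zp k z).2 (dot P z) (dot (Jv P) z) (k%:R : R) => *; ring.
rewrite (deriveD d12 d21) (deriveM (kd P) k2) (deriveM (kd (Jv P)) k1) IH1 IH2 PJz JPJz.
rewrite -[(zp k.+1 z).1]/(dot P z * (zp k z).1 - dot (Jv P) z * (zp k z).2) /GRing.scale/=.
by move: (zp k z).1 (zp k z).2 (dot P z) (dot (Jv P) z) (k%:R : R) => *; ring.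
Qed.

Let zz i j z := (zp i z).1 * (zp j z).1 + (zp i z).2 * (zp j z).2.

Let Ck_zz k i j : Ck k (zz i j).
Proof. by apply: CkD; apply: CkM; have [] := Ck_zpow k i; have [] := Ck_zpow k j. Qed.

Lemma zpow_orthogonal i j : i != j -> sint (zz i j) = 0.
Proof.
move=> ij; have [ki1 ki2] := Ck_zpow 1 i; have [kj1 kj2] := Ck_zpow 1 j.
(* The imaginary part of zeta^i conj(zeta)^j. Its T derivative is i - j times the real part, which
   is [zz i j]. *)
pose g z := (zp i z).2 * (zp j z).1 - (zp i z).1 * (zp j z).2.
have kg : Ck 1 g by apply: CkB; exact: CkM.
have := sint_Top kg.
rewrite (eq_sint (g := fun z => (i%:R - j%:R) * zz i j z)).
  rewrite sintZ; last by apply: continuous_sintegrable; exact: (Ck_continuous (Ck_zz 0 i j)).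
  by move/eqP; rewrite mulf_eq0 subr_eq0 eqr_nat (negbTE ij) => /eqP.
move=> z _; have [i1 i2] := Top_zpow i z; have [j1 j2] := Top_zpow j z.
have di1 := Ck_derivable (Jv z) z ki1; have di2 := Ck_derivable (Jv z) z ki2.
have dj1 := Ck_derivable (Jv z) z kj1; have dj2 := Ck_derivable (Jv z) z kj2.
rewrite (deriveB (derivableM di2 dj1) (derivableM di1 dj2)) (deriveM di2 dj1) (deriveM di1 dj2).
rewrite i1 i2 j1 j2 /zz /GRing.scale/=.
by move: (zp i z).1 (zp i z).2 (zp j z).1 (zp j z).2 => *; ring.
Qed.

(** Parseval's identity for the truncated series. *)
Lemma sint_tUV n K s :
  sint (fun z => tU n (dot P z) (dot (Jv P) z) K s ^+ 2 + tV n (dot P z) (dot (Jv P) z) K s ^+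
    2) =
  \sum_(k < K) bc n k ^+ 2 * moment k * s ^+ k.*2.
Proof.
have cG (i j : 'I_K) : Ck 0 (fun z => bc n i * bc n j * s ^+ (i + j) * zz i j z).
  by apply: CkZ; exact: Ck_zz.
transitivity (sint (fun z => \sum_(i < K) \sum_(j < K) bc n i * bc n j * s ^+ (i + j) * zz i j
  z)).
  apply: eq_sint => z _; rewrite !expr2 /tU /tV !big_distrlr/= -big_split/=.
  apply: eq_bigr => i _; rewrite -big_split/=; apply: eq_bigr => j _.
  by rewrite exprD /zz; move: (s ^+ i) (s ^+ j) (zp i z).1 (zp i z).2 (zp j z).1 (zp j z).2 =>
    *; ring.
rewrite sint_sum; last by move=> i; apply: (@Ck_continuous _ _ 0); apply: Ck_sum.
apply: eq_bigr => i _; rewrite sint_sum; last by move=> j; exact: (Ck_continuous (cG i j)).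
rewrite (bigD1 i)//= big1 => [|j ji]; last first.
  rewrite sintZ; last by apply: continuous_sintegrable; exact: (Ck_continuous (Ck_zz 0 i j)).
  by rewrite zpow_orthogonal ?mulr0// eq_sym.
rewrite addr0 sintZ; last by apply: continuous_sintegrable;
  exact: (Ck_continuous (Ck_zz 0 i i)).
rewrite addnn -expr2 mulrAC; congr (_ * _ * _); apply: eq_sint => z _.
by rewrite /zz -!expr2 zpow_norm.
Qed.

End at_point.
End sphere_moments.

Lemma gh_even (R : realType) k : gh k.*2.+2 = k`!%:R :> R.
Proof. by rewrite -Gamma_natS /gh -doubleS -muln2 natrM mulfK. Qed.

Lemma gh_addn2 (R : realType) j : (0 < j)%N -> gh j.+2 = j%:R / 2 * gh j :> R.
Proof. by case: j => // j _; exact: ghSS. Qed.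

(** * The integral of |1 - zeta|^(-n) *)

Section poisson_integral.
Context {R : realType} {m : nat}.
Local Notation E := (Cspace R m).
Local Notation mu := (@sphere_measure R m).
Local Notation S := (@pt R m @^-1` @sphere R m).
Local Opaque dot Lap Zop gh.
Variables (n : nat) (P : E).
Hypotheses (mn : m = n.+1) (n0 : (0 < n)%N) (P1 : sphere P).
Let a : R := n%:R / 2.
Implicit Types (s : R) (z : E) (K : nat).

Let a0 : 0 < a. Proof. by rewrite divr_gt0// ltr0n. Qed.

Definition qs s z : R := (1 - s * dot P z) ^+ 2 + (s * dot (Jv P) z) ^+ 2.

Lemma qs_bounds s z : sphere z -> 0 <= s < 1 -> (1 - s) ^+ 2 <= qs s z <= 5.
Proof.
move=> z1 /andP[s0 s1]; have r1 := rk_le1 P1 z1.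
by apply: (q_bounds r1 _ s1); rewrite s0 lexx.
Qed.

Lemma qs_gt0 s z : sphere z -> 0 <= s < 1 -> 0 < qs s z.
Proof.
move=> z1 hs; have /andP[h _] := qs_bounds z1 hs; apply: lt_le_trans h.
by rewrite exprn_gt0// subr_gt0; case/andP: hs.
Qed.

(** That is |1 - zeta| <= 2 |1 - s zeta|; it lets a multiple of the limiting kernel dominate those
    with s < 1. *)
Lemma qk0_le_qs s z : sphere z -> 0 <= s < 1 -> qk P 0 z <= 4 * qs s z.
Proof.
move=> z1 hs; have /andP[h _] := qs_bounds z1 hs; have r1 := rk_le1 P1 z1.
have h2 : (1 - s) ^+ 2 * rk P z <= (1 - s) ^+ 2.
  by rewrite ler_piMr// sqr_ge0.
(* The parallelogram law for x = 1 - s zeta and y = (1 - s) zeta: here x - y = 1 - zeta, and [h3]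
   says that |x + y|^2 is nonnegative. *)
have h3 := addr_ge0 (sqr_ge0 (1 + (1 - 2 * s) * dot P z)) (sqr_ge0 ((1 - 2 * s) * dot (Jv P)
  z)).
move: h h2 h3; rewrite /qs /qk /rk; move: (dot P z) (dot (Jv P) z) => x y; nra.
Qed.

Lemma measurable_qs s p : measurable_fun setT (fun v => qs s (pt v) `^ p).
Proof.
apply: (measurableT_comp (measurable_powR _)).
apply: (@measurable_continuous_pt _ _ (qs s)); apply: (@Ck_continuous _ _ 0).
apply: CkD; apply: CkX.
  by apply: CkB; [exact: Ck_cst|apply: CkZ; exact: Ck_dot].
by apply: CkZ; exact: Ck_dot.
Qed.

Lemma qs_powR_le s z : sphere z -> 0 <= s < 1 -> qs s z `^ (- a) <= ((1 - s) ^+ 2) `^ (- a).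
Proof.
move=> z1 hs; have /andP[h _] := qs_bounds z1 hs; apply: ler_powR_npos => //.
  by rewrite exprn_gt0// subr_gt0; case/andP: hs.
by rewrite oppr_le0 ltW.
Qed.

Lemma sintegrable_qs s : 0 <= s < 1 -> sintegrable (fun z => qs s z `^ (- a)).
Proof.
move=> hs; apply: (@bounded_sintegrable _ _ _ (((1 - s) ^+ 2) `^ (- a))).
  by apply: measurable_funTS; exact: measurable_qs.
by move=> z z1; rewrite ger0_norm ?powR_ge0// qs_powR_le.
Qed.

Let F s := sint (fun z => qs s z `^ (- a)).
Let c K : R := bc n K ^+ 2 * moment P K.

Let c_ge0 K : 0 <= c K. Proof. by rewrite mulr_ge0 ?sqr_ge0 ?moment_ge0. Qed.

(** The error of [truncation_estimate] is relative to |1 - s zeta|^(-n), so it integrates to a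
    multiple of [F s]. *)
Lemma cvg_sint_qs s : 0 <= s < 1 ->
  (fun K => \sum_(k < K) c k * s ^+ k.*2) @ \oo --> F s.
Proof.
move=> hs; have /andP[s0 s1] := hs.
pose C := 12 * (5 `^ a / (1 - s) ^+ 2).
pose T K z := tU n (dot P z) (dot (Jv P) z) K s ^+ 2 + tV n (dot P z) (dot (Jv P) z) K s ^+ 2.
have IT K : sintegrable (T K).
  apply: continuous_sintegrable; apply: (@Ck_continuous _ _ 0).
  by apply: CkD; apply: CkX; apply: Ck_sum => k; apply: CkM; try exact: Ck_cst;
     apply: CkZ; have [] := @Ck_zpow R m P 0 k.
have IF := sintegrable_qs hs; have mS := @measurable_preimage_sphere R m.
have bound K : (0 < K)%N -> `|\sum_(k < K) c k * s ^+ k.*2 - F s| <=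
    C * F s * (K.+1%:R ^+ (n.+1 + n.+1) * s ^+ K.-1).
  move=> K0; have -> : \sum_(k < K) c k * s ^+ k.*2 = sint (T K) by rewrite sint_tUV.
  rewrite /F -sintB//.
  have ITF : sintegrable (fun z => T K z - qs s z `^ (- a)).
    rewrite /sintegrable; under eq_fun do rewrite EFinB.
    exact: (integrableB mS (IT K) IF).
  apply: (le_trans (le_norm_sint ITF)).
  rewrite mulrAC -sintZ//; apply: le_sint.
  - by exact: integrable_norm.
  - rewrite /sintegrable; under eq_fun do rewrite EFinM.
    by apply: integrableZl => //; exact: measurable_preimage_sphere.
  move=> z z1; have q0 := qs_gt0 z1 hs.
  have := truncation_estimate n (rk_le1 P1 z1) hs K0.
  rewrite -/(T K z) -/(qs s z) -/a -/C => h.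
  have -> : T K z - qs s z `^ (- a) = (T K z * qs s z `^ a - 1) * qs s z `^ (- a).
    by rewrite powRN; field; rewrite gt_eqF ?powR_gt0.
  by rewrite normrM [X in _ * X]ger0_norm ?powR_ge0// ler_wpM2r ?powR_ge0.
apply/cvgrPdist_le => e e0.
have hC := cvg_poly_geometric (n.+1 + n.+1) hs.
have : (fun K : nat => C * F s * (K.+1%:R ^+ (n.+1 + n.+1) * s ^+ K.-1)) @ \oo --> (0 : R).
  by rewrite -(mulr0 (C * F s)); apply: cvgM => //; exact: cvg_cst.
move=> /cvgrPdist_le/(_ _ e0); apply: filterS2; last exact: (nbhs_infty_gt 0).
move=> K K0 h; rewrite distrC; apply: (le_trans (bound K K0)).
by apply: le_trans h; rewrite sub0r normrN ler_norm.
Unshelve. all: by end_near. Qed.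

(** The right side grows by a^2 [c K] from K to K + 1, because (a + K)^2 - K (n + K) = a^2 when n =
    2 a. *)
Lemma sum_moments K : a ^+ 2 * (\sum_(k < K) c k) =
  bc n K ^+ 2 * (K%:R * (n + K)%:R) * moment P K.
Proof.
elim: K => [|K IH]; first by rewrite big_ord0 mul0r !mulr0 mul0r.
rewrite big_ord_recr/= mulrDr IH /c.
have e1 := momentS P1 K mn; have e2 := bcS n K.
have -> : bc n K.+1 ^+ 2 * (K.+1%:R * (n + K.+1)%:R) * moment P K.+1 =
  (K.+1%:R * bc n K.+1) * bc n K.+1 * ((n + K.+1)%:R * moment P K.+1) by ring.
rewrite e1 e2 -/a.
have -> : (a + K%:R) * bc n K * bc n K.+1 * (K.+1%:R * moment P K) =
  (a + K%:R) * bc n K * (K.+1%:R * bc n K.+1) * moment P K by ring.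
rewrite e2 -/a natrD.
have -> : n%:R = 2 * a :> R by rewrite /a; field.
by move: (bc n K) (moment P K) (K%:R : R) a => *; ring.
Qed.

Lemma moment_factorial K : (n + K)`!%:R * moment P K = n`!%:R * K`!%:R * moment P 0.
Proof.
elim: K => [|K IH]; first by rewrite addn0 mulr1.
rewrite addnS !factS !natrM.
have e1 := momentS P1 K mn; rewrite addnS in e1.
transitivity ((n + K)`!%:R * ((n + K).+1%:R * moment P K.+1)); first by ring.
rewrite e1; transitivity (K.+1%:R * ((n + K)`!%:R * moment P K)); first by ring.
by rewrite IH; ring.
Qed.

Lemma bc_gh K : bc n K * (gh n * K`!%:R) = gh (n + K.*2) :> R.
Proof.
elim: K => [|K IH]; first by rewrite addn0 mul1r mulr1.
rewrite (doubleS K) !(addnS n) gh_addn2 ?addn_gt0 ?n0// -IH factS natrM.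
have := bcS (R := R) n K; move: (bc n K.+1) => b e.
transitivity (gh n * K`!%:R * (K.+1%:R * b)); first by ring.
by rewrite e -muln2 natrD natrM; field.
Qed.

(** The constant c. It comes from [sum_moments] with b_K = Gamma(n/2 + K) / (Gamma(n/2) K!) and m_K
    = n! K! m_0 / (n + K)!; the factor left over is the Gamma quotient that tends to 1. *)
Definition poisson_limit : R := moment P 0 * n`!%:R / (a ^+ 2 * gh n ^+ 2).

Lemma cvg_sum_moments : (fun K => \sum_(k < K) c k) @ \oo --> poisson_limit.
Proof.
(* At rank [K.+1] the quotient involves Gamma(K + 1), so that Gamma at 0 never occurs. *)
rewrite -cvg_shiftS/=.
have gn0 : gh n != 0 :> R by case: n n0 => // k _; rewrite gt_eqF// gh_gt0.
have fac0 k : (k`!%:R : R) != 0 by rewrite pnatr_eq0 -lt0n fact_gt0.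
have a00 : a != 0 by rewrite gt_eqF.
rewrite (_ : (fun _ => _) = fun K => poisson_limit * (gh (K.*2.+2 + n) ^+ 2 / (gh K.*2.+2 * gh
  (K.*2.+2 + n + n)))).
  have := cvgM (cvg_cst poisson_limit) (@gh_ratio_cvg R _ n0); rewrite mulr1; exact.
apply/funext => K.
have -> : (K.*2.+2 + n + n = (K + n).*2.+2)%N by rewrite -addnA addnn doubleD.
have -> : (K.*2.+2 + n = n + K.+1.*2)%N by rewrite addnC doubleS.
rewrite !gh_even -bc_gh factS natrM.
have e1 := moment_factorial K.+1; have e2 := sum_moments K.+1.
rewrite addnS !factS !natrM in e1; rewrite addnS in e2.
have -> : \sum_(k < K.+1) c k = a ^+ 2 * (\sum_(k < K.+1) c k) / a ^+ 2.
  by rewrite mulrC mulKf// sqrf_eq0.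
rewrite e2 /poisson_limit; have fK := fac0 K; have fn := fac0 (n + K)%N.
have -> : moment P K.+1 = n`!%:R * (K.+1%:R * K`!%:R) * moment P 0 / ((n + K).+1%:R * (n +
  K)`!%:R).
  by rewrite -e1 mulrC mulKf// mulf_neq0.
rewrite [(K + n)%N]addnC.
have k1 : K.+1%:R != 0 :> R by [].
have k2 : (n + K).+1%:R != 0 :> R by [].
move: (bc n K.+1) (moment P 0) (n`!%:R : R) fK fn k1 k2.
move: (K`!%:R : R) ((n + K)`!%:R : R) (K.+1%:R : R) ((n + K).+1%:R : R) (gh n) gn0 => x y u v
  g g0 b M f *.
by field; do ?[apply/andP; split].
Qed.

Lemma sint_qs_le s : 0 <= s < 1 -> F s <= poisson_limit.
Proof.
move=> hs; have /andP[s0 s1] := hs.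
apply: (ler_cvg_to (cvg_sint_qs hs) cvg_sum_moments); near=> K.
by apply: ler_sum => k _; rewrite ler_piMr// exprn_ile1// ltW.
Unshelve. all: by end_near. Qed.

Lemma sum_le_sint_qs s K : 0 <= s < 1 -> \sum_(k < K) c k * s ^+ k.*2 <= F s.
Proof.
move=> hs; have /andP[s0 s1] := hs.
rewrite -(cvg_lim _ (cvg_sint_qs hs))//.
apply: (@nondecreasing_cvgn_le _ (fun K => \sum_(k < K) c k * s ^+ k.*2)).
  apply/nondecreasing_seqP => k.
  by rewrite big_ord_recr/= lerDl mulr_ge0 ?exprn_ge0.
by apply/cvg_ex; exists (F s); exact: cvg_sint_qs.
Qed.

Let mS := @measurable_preimage_sphere R m.

Lemma sint_EFin g : sintegrable g -> (\int[mu]_(v in S) (g (pt v))%:E = (sint g)%:E)%E.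
Proof. by move=> Ig; rewrite /sint /Rintegral fineK//; exact: (integrable_fin_num mS Ig). Qed.

Lemma measurable_qk0 p : measurable_fun setT (fun v => qk P 0 (pt v) `^ p).
Proof.
apply: (measurableT_comp (measurable_powR _)).
exact: (@measurable_continuous_pt _ _ _ (Ck_continuous (Ck_qk 0 P 0))).
Qed.

(** On the sphere this is the point [P] alone, where the regularized kernels do not converge to
    [green0]. *)
Definition pole_set := S `&` [set v | qk P 0 (pt v) = 0].

Lemma measurable_pole_set : measurable pole_set.
Proof.
apply: measurableI; first exact: mS.
rewrite -[X in measurable X]setTI.
have h := @measurable_continuous_pt _ _ _ (Ck_continuous (Ck_qk 0 P 0)).
by apply: (h _ [set 0]).
Qed.

(* As s tends to 1, the integrand is of size (1 - s) ^ (- n) on the pole. *)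
Lemma pole_set_null : mu pole_set = 0%E.
Proof.
have mN := measurable_pole_set.
have muS : (mu pole_set <= mu S)%E by apply: le_measure; rewrite ?inE//; exact: subIsetl.
have fN : mu pole_set \is a fin_num.
  by rewrite ge0_fin_numE// (le_lt_trans muS)// sphere_measure_lty.
have bound y : 0 < y < 1 -> fine (mu pole_set) <= poisson_limit * y.
  move=> /andP[y0 y1]; pose s := 1 - y `^ (n%:R^-1).
  have nn : (0 : R) < n%:R by rewrite ltr0n.
  have p0 : 0 < y `^ (n%:R^-1) by rewrite powR_gt0.
  have p1 : y `^ (n%:R^-1) <= 1.
    rewrite -[leRHS](@powRr0 _ y) ; apply: ger_powR; first by rewrite y0 ltW.
    by rewrite invr_ge0 ltW.
  have hs : 0 <= s < 1 by rewrite /s; apply/andP; split; lra.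
  have e1 : ((1 - s) ^+ 2) `^ (- a) = y^-1.
    rewrite /s opprB addrC subrK -powR_mulrn ?powR_ge0// -!powRrM -(powR_inv1 (ltW y0)).
    by congr (_ `^ _); rewrite /a; field; rewrite gt_eqF.
  rewrite -ler_pdivrMr// -lee_fin EFinM fineK// muleC -e1.
  apply: le_trans (_ : (F s)%:E <= _)%E; last by rewrite lee_fin sint_qs_le.
  rewrite -sint_EFin ?sintegrable_qs// -(integral_cst mu mN).
  rewrite (eq_integral (fun v => (qs s (pt v) `^ (- a))%:E)).
    apply: ge0_subset_integral => //.
    - by apply/measurable_EFinP; apply: measurable_funTS; exact: measurable_qs.
    - by move=> v _; rewrite lee_fin powR_ge0.
    - exact: subIsetl.
  move=> v; rewrite inE => -[_ /=]; rewrite /qk add0r => /eqP.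
  rewrite paddr_eq0 ?sqr_ge0// !sqrf_eq0 subr_eq0 => /andP[/eqP h1 /eqP h2].
  by rewrite /qs h2 -h1 mulr1 mulr0 expr0n addr0.
have N0 : fine (mu pole_set) <= 0.
  have L0 : 0 <= poisson_limit.
    by apply: divr_ge0; rewrite mulr_ge0 ?sqr_ge0 ?moment_ge0.
  rewrite leNgt; apply/negP => x0; set x := fine _ in bound x0.
  pose y := Num.min (1 / 2) (x / (2 * (poisson_limit + 1))).
  have y01 : 0 < y < 1.
    rewrite lt_min !divr_gt0//= ?mulr_gt0 ?ltr_wpDl//.
    by rewrite (le_lt_trans (_ : _ <= 1 / 2)) ?ge_min ?lexx//; lra.
  have := bound y y01; apply/negP; rewrite -ltNge.
  have h : y <= x / (2 * (poisson_limit + 1)) by rewrite ge_min lexx orbT.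
  rewrite ler_pdivlMr ?mulr_gt0 ?ltr_wpDl// in h.
  have [yp _] := andP y01; have := mulr_ge0 L0 (ltW yp).
  by move: h yp; clearbody y x; move: poisson_limit => l h yp h'; lra.
rewrite -[LHS]fineK//; congr EFin; apply/eqP; rewrite eq_le N0/=.
exact: fine_ge0.
Qed.

Lemma sint_dominated (f_ : nat -> E -> R) (f g : E -> R) :
  (forall j, measurable_fun S (fun v => f_ j (pt v))) ->
  measurable_fun S (fun v => f (pt v)) -> sintegrable g ->
  (forall z, sphere z -> 0 < qk P 0 z -> (fun j => f_ j z) @ \oo --> f z) ->
  (forall j z, sphere z -> 0 < qk P 0 z -> `|f_ j z| <= g z) ->
  (fun j => sint (f_ j)) @ \oo --> sint f.
Proof.
move=> mf_ mf Ig cf fg.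
have ae (Q : _ -> Prop) : (forall v, S v -> 0 < qk P 0 (pt v) -> Q v) ->
    {ae mu, forall v, S v -> Q v}.
  move=> h; exists pole_set; split; [exact: measurable_pole_set|exact: pole_set_null|].
  move=> v /= nv; apply: contrapT => nN; apply: nv => Sv; apply: h => //.
  by rewrite lt_neqAle qk_ge andbT eq_sym; apply/eqP => e; exact: nN.
have mE (h : _ -> R) : measurable_fun S (fun v => h (pt v)) -> measurable_fun S (fun v => (h
  (pt v))%:E).
  exact: (@measurable_EFinP _ _ _ _ _).2.
have c1 : {ae mu, forall v, S v -> (fun j => (f_ j (pt v))%:E) @ \oo --> (f (pt v))%:E}.
  by apply: ae => v Sv qv; apply: cvg_EFin; [exact: nearW|exact: cf].
have c2 : {ae mu, forall v (j : nat), S v -> (`|(f_ j (pt v))%:E| <= (g (pt v))%:E)%E}.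
  have := ae (fun v => forall j : nat, (`|(f_ j (pt v))%:E| <= (g (pt v))%:E)%E) _.
  move=> /(_ (fun v Sv qv j => fg j _ Sv qv)); apply: filterS => v h j Sv; exact: h.
have [If _ cI] := dominated_convergence mS (fun j => mE _ (mf_ j)) (mE _ mf) c1 Ig c2.
by rewrite (sint_EFin If) in cI; exact: (fine_cvg cI).
Qed.

(* At P itself the value is 0, as 0 `^ x = 0 for x <> 0. *)
Definition green0 z : R := qk P 0 z `^ (- a).

Lemma cvg_powR_pos (f : nat -> R) (l p : R) : 0 < l -> f @ \oo --> l ->
  (fun j => f j `^ p) @ \oo --> l `^ p.
Proof.
move=> l0 fl; apply: (cvg_comp f (fun x : R => x `^ p) fl).
have /derivable1_diffP h : derivable (fun x : R => x `^ p) l 1.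
  by have [] := is_derive1_powR p l0.
exact: (differentiable_continuous h).
Qed.

Let sj (j : nat) : R := 1 - j.+2%:R^-1.

Let sj01 j : 0 <= sj j < 1.
Proof.
rewrite /sj subr_ge0 ltrBlDr ltrDl invr_gt0 ltr0n andbT.
by rewrite invf_le1 ?ltr0n// ler1n.
Qed.

Let cvg_sj : sj @ \oo --> (1 : R).
Proof.
have h := @cvg_harmonic R.
rewrite -(subr0 (1 : R)); apply: cvgB; first exact: cvg_cst.
by rewrite -cvg_shiftS in h.
Qed.

Let cvg_qs z : (fun j => qs (sj j) z) @ \oo --> qk P 0 z.
Proof.
rewrite /qk add0r -[dot P z in X in _ --> X]mul1r -[dot (Jv P) z in X in _ --> X]mul1r.
have h (x : R) : (fun j => sj j * x) @ \oo --> 1 * x by apply: cvgM;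
  [exact: cvg_sj|exact: cvg_cst].
have h1 : (fun j => 1 - sj j * dot P z) @ \oo --> 1 - 1 * dot P z.
  by apply: cvgB; [exact: cvg_cst|exact: h].
rewrite /qs; under eq_fun do rewrite !expr2.
by rewrite !expr2; apply: cvgD; apply: cvgM.
Qed.

(** Fatou's lemma along [sj], with the integrals bounded by [poisson_limit]. Dominated convergence
    comes only afterwards, since the dominating function is a multiple of [green0]. *)
Lemma sintegrable_green0 : sintegrable green0.
Proof.
have mf (j : nat) : measurable_fun S (fun v => (qs (sj j) (pt v) `^ (- a))%:E).
  by apply/measurable_EFinP; apply: measurable_funTS; exact: measurable_qs.
have f0 (j : nat) v : S v -> (0 <= (qs (sj j) (pt v) `^ (- a))%:E)%E.
  by move=> _; rewrite lee_fin powR_ge0.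
have mg : measurable_fun S (fun v => (green0 (pt v))%:E).
  by apply/measurable_EFinP; apply: measurable_funTS; exact: measurable_qk0.
have := fatou mu mS mf f0.
set I := limn_einf _ => h.
have I_le : (I <= poisson_limit%:E)%E.
  rewrite /I limn_einf_lim; apply: lime_le; first exact: is_cvg_einfs.
  apply: nearW => j; apply: (@le_trans _ _ (\int[mu]_(v in S) (qs (sj j) (pt v) `^ (-
    a))%:E)%E).
    by apply: ereal_inf_lbound; exists j => //=.
  by rewrite (sint_EFin (sintegrable_qs (sj01 j))) lee_fin sint_qs_le.
apply/integrableP; split => //.
apply: (@le_lt_trans _ _ poisson_limit%:E); last exact: ltry.
apply: le_trans I_le; apply: le_trans h; apply: ge0_le_integral => //.
- exact: measurableT_comp mg.
- apply: (emeasurable_fun_cvg (fun k v => einfs (fun j => (qs (sj j) (pt v) `^ (- a))%:E) k))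
  => [k|v Sv].
    exact: measurable_fun_einfs.
  by rewrite limn_einf_lim; exact: is_cvg_einfs.
move=> v Sv; rewrite gee0_abs ?lee_fin ?powR_ge0//.
have [q0|q0] := ltP 0 (qk P 0 (pt v)).
  have cq : (fun j => (qs (sj j) (pt v) `^ (- a))%:E) @ \oo --> (green0 (pt v))%:E.
    by apply: cvg_EFin; [exact: nearW|apply: cvg_powR_pos => //; exact: cvg_qs].
  rewrite is_cvg_limn_einfE; last by apply/cvg_ex; exists (green0 (pt v))%:E.
  by rewrite (cvg_lim _ cq).
have e : qk P 0 (pt v) = 0 by apply/eqP; rewrite eq_le q0 qk_ge.
rewrite /green0 e powR0 ?oppr_eq0 ?gt_eqF//.
rewrite limn_einf_lim; apply: lime_ge; first exact: is_cvg_einfs.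
by apply: nearW => j; apply: le_ereal_inf_tmp => _ [k _ <-]; exact: f0.
Qed.

Let sintegrableZ k g : sintegrable g -> sintegrable (fun z => k * g z).
Proof. by move=> Ig; rewrite /sintegrable; under eq_fun do rewrite EFinM;
  exact: (integrableZl mS). Qed.

(** The limits s -> 1 and K -> oo are exchanged by two inequalities: [F s] never exceeds
    [poisson_limit], and each partial sum, as the limit of its values at [sj j], is at most the
    integral of [green0]. *)
Lemma sint_green0 : sint green0 = poisson_limit.
Proof.
have IG := sintegrable_green0.
have cF : (fun j => F (sj j)) @ \oo --> sint green0.
  apply: (@sint_dominated _ _ (fun z => 4^-1 `^ (- a) * green0 z)).
  - by move=> j; apply: measurable_funTS; exact: measurable_qs.
  - by apply: measurable_funTS; exact: measurable_qk0.
  - exact: sintegrableZ.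
  - by move=> z z1 q0; apply: cvg_powR_pos => //; exact: cvg_qs.
  - move=> j z z1 q0; rewrite ger0_norm ?powR_ge0// /green0 -powRM ?(ltW q0)//.
    apply: ler_powR_npos; first by rewrite mulr_gt0.
      by rewrite mulrC ler_pdivrMr// mulrC qk0_le_qs.
    by rewrite oppr_le0 ltW.
apply/eqP; rewrite eq_le; apply/andP; split.
  by apply: (ler_cvg_to cF (cvg_cst poisson_limit)); apply: nearW => j; exact: sint_qs_le.
apply: (ler_cvg_to cvg_sum_moments (cvg_cst (sint green0))); apply: nearW => K.
have cK : (fun j => \sum_(k < K) c k * sj j ^+ k.*2) @ \oo --> \sum_(k < K) c k.
  elim: K => [|K IH].
    by rewrite big_ord0; under eq_fun do rewrite big_ord0; exact: cvg_cst.
  rewrite big_ord_recr; under eq_fun do rewrite big_ord_recr; apply: cvgD => //=.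
  have h : (fun j => sj j ^+ K.*2) @ \oo --> (1 : R).
    have := @continuous_cvg _ _ _ _ _ sj (fun x => x ^+ K.*2) 1 (@exprn_continuous R K.*2 1)
      cvg_sj.
    by rewrite expr1n; exact.
  by have := cvgM (cvg_cst (c K)) h; rewrite mulr1; exact.
by apply: (ler_cvg_to cK cF); apply: nearW => j; exact: sum_le_sint_qs.
Qed.

(** Off the pole [hk] is at most [green0], which provides the dominating function. *)
Lemma sint_hk_cvg f : continuous f ->
  (fun j : nat => sint (fun z => hk n P j.+1%:R^-1 z * f z)) @ \oo -->
  sint (fun z => green0 z * f z).
Proof.
move=> cf; have [M M0 fM] := sphere_bounded cf.
have mf : measurable_fun S (fun v => f (pt v)).
  by apply: measurable_funTS; exact: measurable_continuous_pt.
have e0 j : 0 < j.+1%:R^-1 :> R by rewrite invr_gt0.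
apply: (@sint_dominated _ _ (fun z => M * green0 z)).
- move=> j; apply: measurable_funM => //; apply: measurable_funTS.
  exact: (@measurable_continuous_pt _ _ _ (Ck_continuous (Ck_hk 0 n P (e0 j)))).
- by apply: measurable_funM => //; apply: measurable_funTS; exact: measurable_qk0.
- by apply: sintegrableZ; exact: sintegrable_green0.
- move=> z z1 q0; apply: cvgM; last exact: cvg_cst.
  apply: cvg_powR_pos => //; rewrite /qk; apply: cvgD; last exact: cvg_cst.
  exact: cvg_harmonic.
- move=> j z z1 q0; rewrite normrM mulrC ler_pM//; first exact: fM.
  rewrite ger0_norm ?powR_ge0//; apply: ler_powR_npos => //.
  by rewrite /qk lerD2r ltW.
Qed.

End poisson_integral.

(** * The Green function *)

Section Green_function.
Context {R : realType} {n : nat}.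
Local Notation E := (Cspace R n.+1).
Local Notation mu := (@sphere_measure R n.+1).
Local Notation S := (@pt R n.+1 @^-1` @sphere R n.+1).
Local Opaque dot Lap Zop gh.
Hypothesis n0 : (0 < n)%N.
Implicit Types (P z : E) (H : E -> R).

Lemma nbhs_crd P (A : set E) : nbhs P A ->
  exists2 d : R, 0 < d & forall z, (forall c, `|crd c z - crd c P| < d) -> A z.
Proof.
move=> /nbhs_ballP[d d0 dA]; exists d => // z zP; apply: dA; split; split => //= i j.
  by have := zP (inl j); rewrite (ord1 i) distrC.
by have := zP (inr j); rewrite (ord1 i) distrC.
Qed.

Let K_limit P := n%:R ^+ 2 * poisson_limit n P.

Let ej (j : nat) : R := j.+1%:R^-1.
Let ej0 j : 0 < ej j. Proof. by rewrite invr_gt0. Qed.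

Lemma cvg_sint_Kk P : sphere P -> (fun j => sint (Kk n P (ej j))) @ \oo --> K_limit P.
Proof.
move=> P1; rewrite (_ : (fun _ => _) = fun j => n%:R ^+ 2 * sint (fun z => hk n P (ej j) z *
  1)).
  apply: cvgM; first exact: cvg_cst.
  rewrite -(sint_green0 erefl n0 P1).
  have := sint_hk_cvg erefl n0 P1 (fun z => @cst_continuous E R 1 z).
  by rewrite (@eq_sint _ _ (fun z => green0 n P z * 1) (green0 n P)) => [|z _];
    [exact|exact: mulr1].
apply/funext => j; rewrite (sint_Kk erefl P1 (ej0 j)); congr (_ * _).
by apply: eq_sint => z _; rewrite mulr1.
Qed.

Lemma cvg_sint_mulKk P H : sphere P -> sintegrable H ->
  (forall eta, 0 < eta -> exists2 d, 0 < d & forall z, sphere z ->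
     (forall c, `|crd c z - crd c P| < d) -> `|H z - H P| <= eta) ->
  (fun j => sint (fun z => H z * Kk n P (ej j) z)) @ \oo --> H P * K_limit P.
Proof.
move=> P1 IH cH; have cK := cvg_sint_Kk P1.
pose D j := sint (fun z => H z * Kk n P (ej j) z) - H P * sint (Kk n P (ej j)).
have K0 : 0 <= K_limit P.
  have := ler_cvg_to (cvg_cst 0) cK; apply; apply: nearW => j.
  by apply: sint_ge0 => z z1; exact: Kk_ge0.
suff D0 : D @ \oo --> (0 : R).
  rewrite -[X in _ --> X]add0r (_ : (fun _ => _) = fun j => D j + H P * sint (Kk n P (ej j))).
    by apply: cvgD => //; apply: cvgM => //; exact: cvg_cst.
  by apply/funext => j; rewrite subrK.
apply/cvgrPdist_le => eps eps0.
(* The [+ 1] keeps the denominator positive and makes the limit [eta * K_limit P] strictly smaller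
   than [eps]. *)
pose eta := eps / (K_limit P + 1).
have eta0 : 0 < eta by rewrite divr_gt0// ltr_wpDl.
have [C hC] := approximate_identity erefl P1 IH cH eta0.
have cr : (fun j => eta * sint (Kk n P (ej j)) + ej j * C) @ \oo --> eta * K_limit P + 0 * C.
  apply: cvgD; apply: cvgM => //; try exact: cvg_cst.
  exact: cvg_harmonic.
have lim_lt : eta * K_limit P + 0 * C < eps.
  rewrite mul0r addr0 /eta mulrAC ltr_pdivrMr ?ltr_wpDl// ltr_pM2l//.
  by rewrite ltrDl.
apply: filterS (cvgr_lt _ cr _ lim_lt) => j /ltW h.
by rewrite sub0r normrN (le_trans (hC _ (ej0 j))).
Unshelve. all: by end_near. Qed.

Lemma Green_representation P (u f : E -> R) : sphere P -> Ck 2 u -> continuous f ->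
  (forall z, sphere z -> n%:R ^+ 2 * u z - Lap u z = f z) ->
  u P * K_limit P = sint (fun z => green0 n P z * f z).
Proof.
move=> P1 ku cf uf.
have cu : continuous u := Ck_continuous ku.
have c1 := sint_hk_cvg erefl n0 P1 cf.
have c2 : (fun j => sint (fun z => u z * Kk n P (ej j) z)) @ \oo --> u P * K_limit P.
  apply: cvg_sint_mulKk => //; first exact: continuous_sintegrable.
  move=> eta eta0; have /cvgrPdist_le/(_ _ eta0)/nbhs_crd[d d0 h] := cu P.
  by exists d => // z _ /h; rewrite distrC.
have e : (fun j => sint (fun z => u z * Kk n P (ej j) z)) =
    (fun j => sint (fun z => hk n P (ej j) z * f z)).
  apply/funext => j; rewrite -(Green_identity erefl P1 (ej0 j) ku).
  by apply: eq_sint => z z1; rewrite uf.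
by rewrite e in c2; exact: (cvg_unique (@norm_hausdorff _ R) c2 c1).
Qed.

Lemma resolvent_Re_Im (f u : E -> R[i]) : is_resolvent f u -> forall z, sphere z ->
  n%:R ^+ 2 * complex.Re (u z) - Lap (fun p => complex.Re (u p)) z = complex.Re (f z) /\
  n%:R ^+ 2 * complex.Im (u z) - Lap (fun p => complex.Im (u p)) z = complex.Im (f z).
Proof.
move=> [sf su uf] z z1; rewrite -uf// sublaplacianE//.
have -> : n%:R ^+ 2 = (n%:R ^+ 2)%:C%C :> R[i] by rewrite rmorphXn rmorph_nat.
move: (Lap _ z) (Lap _ z) (n%:R ^+ 2 : R) => x y k; case: (u z) => p q /=.
by split; ring.
Qed.

Lemma sphere_integralE H (f : E -> R[i]) : sphere_integral (fun z => (H z)%:C%C * f z) =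
  (sint (fun z => H z * complex.Re (f z)) +i* sint (fun z => H z * complex.Im (f z)))%C.
Proof.
rewrite /sphere_integral; congr (_ +i* _)%C; apply: eq_Rintegral => v _;
  case: (f (pt v)) => p q /=; ring.
Qed.

Lemma crd_north_pole c : crd c (north_pole R n) = (c == inl ord_max)%:R.
Proof.
case: c => j; rewrite /crd /north_pole /of_coordC /= mxE; last by case: (j == _).
by rewrite -[inl j == inl _]/(j == ord_max); case: (j == _).
Qed.

Lemma north_poleE : north_pole R n = bas (inl ord_max).
Proof. by apply: crd_inj => c; rewrite crd_north_pole crd_bas. Qed.

Lemma dot_north_pole z : dot (north_pole R n) z = z.1 0 ord_max.
Proof. by rewrite north_poleE dotC dot_basr. Qed.

Lemma dot_Jv_north_pole z : dot (Jv (north_pole R n)) z = z.2 0 ord_max.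
Proof.
by rewrite dot_Jvl dot_north_pole mxE opprK. Qed.

Lemma sphere_north_pole : sphere (north_pole R n).
Proof. by apply/sphere_dotP; rewrite north_poleE dot_basr crd_bas eqxx. Qed.

Lemma qk0_gt0 P z : sphere P -> sphere z -> z <> P -> 0 < qk P 0 z.
Proof.
move=> P1 z1 zP; rewrite lt_neqAle qk_ge andbT eq_sym; apply/eqP.
rewrite /qk add0r => /eqP; rewrite paddr_eq0 ?sqr_ge0// sqrf_eq0 subr_eq0 => /andP[/eqP h _].
apply: zP; apply/eqP; rewrite -subr_eq0; apply/eqP; apply: crd_inj => c; rewrite crd0.
apply/eqP; rewrite -sqrf_eq0 eq_le sqr_ge0 andbT.
by rewrite (le_trans (crd_sq_le_dot c _))// dot_dist// -h subrr mulr0.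
Qed.

Let kappa : R := Gamma (n%:R / 2) ^+ 2 / (8 * pi ^+ n.+1).

(** The origin of the 8: n^2 against a^2 = n^2 / 4 leaves 4, and the total mass 2 pi^(n+1) / n!
    brings the 2, its n! cancelling that of [poisson_limit]. *)
Lemma kappaE P : sphere P -> kappa * K_limit P = 1.
Proof.
move=> P1; rewrite /K_limit /poisson_limit /moment.
have -> : sint (fun z => rk P z ^+ 0) = 2 * pi ^+ n.+1 / n`!%:R.
  rewrite (eq_sint (g := fun=> 1)); last by move=> z _; rewrite expr0.
  rewrite sint_cst mul1r; have e := @sphere_measure_sphere R n.+1 isT.
  by have -> : mu S = _ := e; rewrite /= /total_mass Gamma_natS.
have gn0 : gh n != 0 :> R by case: (n) n0 => // k _; rewrite gt_eqF// gh_gt0.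
rewrite /kappa -[Gamma (n%:R / 2)]/(gh n).
have fac0 : (n`!%:R : R) != 0 by rewrite pnatr_eq0 -lt0n fact_gt0.
have nn0 : n%:R != 0 :> R by rewrite pnatr_eq0 -lt0n.
have pi0 : pi ^+ n.+1 != 0 :> R by rewrite expf_neq0// gt_eqF ?pi_gt0.
move: (pi ^+ n.+1) pi0 (gh n) gn0 (n`!%:R : R) fac0 => p p0 g g0 f f0.
by field; rewrite nn0 f0 g0 p0.
Qed.

Let G z := kappa * green0 n (north_pole R n) z.

Let IG : sintegrable G.
Proof.
rewrite /sintegrable; under eq_fun do rewrite EFinM.
apply: integrableZl => //; first exact: measurable_preimage_sphere.
exact: (sintegrable_green0 erefl n0 sphere_north_pole).
Qed.

Let continuous_G z : 0 < qk (north_pole R n) 0 z -> {for z, continuous G}.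
Proof.
move=> q0; apply: (@cvgM R _ (nbhs z) _ (cst kappa) (green0 n (north_pole R n))).
  exact: cvg_cst.
apply: (@cvg_comp _ _ _ (qk (north_pole R n) 0) (fun x : R => x `^ (- (n%:R / 2)))).
  exact: (Ck_continuous (Ck_qk 0 _ 0)).
have /derivable1_diffP h : derivable (fun x : R => x `^ (- (n%:R / 2))) (qk (north_pole R n) 0
  z) 1.
  by have [] := is_derive1_powR (- (n%:R / 2)) q0.
exact: (differentiable_continuous h).
Qed.

Lemma Green_function_green0 : is_Green_function G.
Proof.
have N1 := sphere_north_pole.
split => //.
  apply: continuous_in_subspaceT => z; rewrite inE => -[z1 zN].
  have q0 := qk0_gt0 N1 z1 zN.
  exact: continuous_G.
move=> f u fu; have h := resolvent_Re_Im fu; have [sf su _] := fu.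
have kc : kappa * K_limit (north_pole R n) = 1 by exact: kappaE.
have rep (v g : E -> R) : Ck 2 v -> continuous g ->
   (forall z, sphere z -> n%:R ^+ 2 * v z - Lap v z = g z) ->
   v (north_pole R n) = sint (fun z => G z * g z).
  move=> kv cg vg; have e := Green_representation N1 kv cg vg.
  rewrite (eq_sint (g := fun z => kappa * (green0 n (north_pole R n) z * g z))); last first.
    by move=> z _; rewrite /G mulrA.
  rewrite sintZ -?e; first by rewrite mulrCA kc mulr1.
  have [M M0 gM] := sphere_bounded cg.
  apply: (sintegrableM (sintegrable_green0 erefl n0 N1) _ gM).
  by apply: measurable_funTS; exact: measurable_continuous_pt.
have [su1 su2] := su 2%N; have [sf1 sf2] := sf 0%N.
have e1 : complex.Re (u (north_pole R n)) = sint (fun z => G z * complex.Re (f z)).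
  by apply: (rep (fun p => complex.Re (u p))) => // z z1; have [] := h z z1.
have e2 : complex.Im (u (north_pole R n)) = sint (fun z => G z * complex.Im (f z)).
  by apply: (rep (fun p => complex.Im (u p))) => // z z1; have [] := h z z1.
by rewrite sphere_integralE -e1 -e2; case: (u _).
Qed.

Lemma real_resolvent P (e : R) : sphere P -> 0 < e ->
  is_resolvent (fun z => (Kk n P e z)%:C%C) (fun z => (hk n P e z)%:C%C).
Proof.
move=> P1 e0; have sh : smooth (fun z => (hk n P e z)%:C%C).
  by move=> k; split; [exact: Ck_hk|exact: Ck_cst].
split=> //; first by move=> k; split; [exact: Ck_Kk|exact: Ck_cst].
move=> z z1; rewrite sublaplacianE//= Lap_cst -(Lap_hk erefl P1 z1 e0).
have -> : n%:R ^+ 2 = (n%:R ^+ 2)%:C%C :> R[i] by rewrite rmorphXn rmorph_nat.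
move: (Lap _ z) (hk n P e z) (n%:R ^+ 2 : R) => x y k.
by apply/eqP; rewrite eq_complex /=; apply/andP; split; apply/eqP; ring.
Qed.

Lemma Green_function_unique (G' : E -> R) P : is_Green_function G' ->
  sphere P -> P <> north_pole R n -> G' P = G P.
Proof.
move=> [IG' cG' rG'] P1 PN; have [_ cG rG] := Green_function_green0.
pose H z := G' z - G z.
have IH : sintegrable H.
  rewrite /sintegrable; under eq_fun do rewrite EFinB.
  by apply: integrableB => //; exact: measurable_preimage_sphere.
have cH : forall eta, 0 < eta -> exists2 d, 0 < d & forall z, sphere z ->
     (forall c, `|crd c z - crd c P| < d) -> `|H z - H P| <= eta.
  move=> eta eta0; have N1 := sphere_north_pole; have e20 : 0 < eta / 2 by rewrite divr_gt0.
  have q0 := qk0_gt0 N1 P1 PN.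
  have PA : (@sphere R n.+1 `\ north_pole R n) P by [].
  have nG' : within (@sphere R n.+1 `\ north_pole R n) (nbhs P) [set z | `|G' P - G' z| <= eta
    / 2].
    by rewrite (nbhs_subspace_in PA); have /cvgrPdist_le/(_ _ e20) := cG' P.
  have {}nG' : \forall z \near P, (@sphere R n.+1 `\ north_pole R n) z -> `|G' P - G' z| <=
    eta / 2.
    exact: nG'.
  have /cvgrPdist_le/(_ _ e20) nG := continuous_G q0.
  have cq : continuous (qk (north_pole R n) 0) := Ck_continuous (Ck_qk 0 _ 0).
  (* Positivity keeps the neighbourhood away from the north pole, where nothing is known about the
     continuity of [G']. *)
  have nq : \forall z \near P, 0 < qk (north_pole R n) 0 z by exact: (cvgr_gt _ (cq P) _ q0).
  have [d d0 hd] := nbhs_crd (filterI (filterI nG' nG) nq).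
  exists d => // z z1 /hd[[g' g] q].
  have zN : z <> north_pole R n.
    move=> e; move: q; rewrite e /qk dot_north_pole dot_Jv_north_pole.
    have := crd_north_pole (inl ord_max); have := crd_north_pole (inr ord_max).
    by rewrite /crd /= => -> ->; rewrite eqxx subrr expr0n !addr0 ltxx.
  have {}g' := g' (conj z1 zN).
  rewrite /H (_ : _ - _ = (G P - G z) - (G' P - G' z)); last by ring.
  by rewrite (le_trans (ler_normB _ _))// [eta]splitr lerD.
have K1 := kappaE P1.
have H0 e : 0 < e -> sint (fun z => H z * Kk n P e z) = 0.
  move=> e0; have rs := real_resolvent P1 e0.
  have [M M0 KM] := sphere_bounded (Ck_continuous (Ck_Kk 0 n P e0)).
  have mK : measurable_fun S (fun v => Kk n P e (pt v)).
    by apply: measurable_funTS; apply: measurable_continuous_pt;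
      exact: (Ck_continuous (Ck_Kk 0 n P e0)).
  have := rG' _ _ rs; rewrite (rG _ _ rs) !sphere_integralE => -[/= eK _].
  rewrite (eq_sint (g := fun z => G' z * Kk n P e z - G z * Kk n P e z)); last first.
    by move=> z _; rewrite mulrBl.
  rewrite sintB; [by rewrite eK subrr|exact: (sintegrableM IG' mK KM)|exact: (sintegrableM IG
    mK KM)].
have := cvg_sint_mulKk P1 IH cH.
rewrite (_ : (fun _ => _) = fun=> 0); last by apply/funext => j; exact: H0.
move=> h; have : 0 = H P * K_limit P by apply: (cvg_unique (@norm_hausdorff _ R) (cvg_cst 0) h).
move=> /esym/eqP; rewrite mulf_eq0 => /orP[|/eqP K0]; first by rewrite subr_eq0 => /eqP.
by move: K1; rewrite K0 mulr0 => /eqP; rewrite eq_sym oner_eq0.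
Qed.

Lemma Gamma_formula z : G z =
  Gamma (n%:R / 2) ^+ 2 / (8 * pi ^+ n.+1 * qk (north_pole R n) 0 z `^ (n%:R / 2)).
Proof. by rewrite /G /kappa /green0 powRN -mulrA -invfM. Qed.

End Green_function.

(** * Cylindrical coordinates *)

Section cylindrical_coordinates.
Context {R : realType} {n : nat}.
Local Open Scope complex_scope.
Implicit Types (w : 'I_n -> R[i]) (r theta : R).

Lemma cylindrical_max w theta :
  coordC (cylindrical w theta) ord_max =
  ((Num.sqrt (1 + rho w ^+ 2))^-1 * cos theta) +i* ((Num.sqrt (1 + rho w ^+ 2))^-1 * sin theta).
Proof.
rewrite /coordC /cylindrical /of_coordC !mxE /= unlift_none mulr1 /=.
by rewrite !mul0r subr0 addr0.
Qed.

Lemma sphere_cylindrical w theta : sphere (cylindrical w theta).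
Proof.
rewrite /sphere /= (bigD1_ord ord_max)//= !mxE unlift_none /= .
under eq_bigr do rewrite !mxE liftK.
have D0 : 0 <= \sum_(j < n) (complex.Re (w j) ^+ 2 + complex.Im (w j) ^+ 2).
  by apply: sumr_ge0 => j _; rewrite addr_ge0 ?sqr_ge0.
set k := (Num.sqrt _)^-1.
have k2 : k ^+ 2 * (1 + rho w ^+ 2) = 1.
  rewrite /k exprVn sqr_sqrtr ?mulVf//; last by rewrite addr_ge0 ?sqr_ge0.
  by rewrite gt_eqF// ltr_wpDr ?sqr_ge0.
rewrite /rho sqr_sqrtr// in k2.
rewrite -[RHS]k2 mulrDr mulr1 mulr_sumr; congr (_ + _).
  have := cos2Dsin2 theta; move: (cos theta) (sin theta) => x y h.
  by transitivity (k ^+ 2 * (x ^+ 2 + y ^+ 2)); [ring|rewrite h mulr1].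
apply: eq_bigr => j _; case: (w j) => a b /=.
have := cos2Dsin2 theta; move: (cos theta) (sin theta) => x y h.
by transitivity (k ^+ 2 * (a ^+ 2 + b ^+ 2) * (x ^+ 2 + y ^+ 2)); [ring|rewrite h mulr1].
Qed.

Lemma sqrt_1Dtan2 r : 0 < cos r -> (Num.sqrt (1 + tan r ^+ 2))^-1 = cos r.
Proof.
move=> c0; have -> : 1 + tan r ^+ 2 = (cos r)^-1 ^+ 2.
  rewrite /tan; rewrite exprMn -(divff (x := cos r ^+ 2)) ?expf_neq0 ?gt_eqF// -exprVn -mulrDl.
  by rewrite cos2Dsin2 mul1r.
by rewrite sqrtr_sqr ger0_norm ?invr_ge0 ?(ltW c0)// invrK.
Qed.

End cylindrical_coordinates.

Theorem proposition3p4 (R : realType) (n : nat) (hn : (1 <= n)%N) :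
  (exists G : Cspace R n.+1 -> R, is_Green_function G) /\
  (forall G : Cspace R n.+1 -> R, is_Green_function G ->
   forall (w : 'I_n -> R[i]) (r theta : R),
     0 <= r -> r < pi / 2 -> - pi <= theta -> theta <= pi ->
     (r, theta) <> (0, 0) -> rho w = tan r ->
     G (cylindrical w theta) =
       Gamma (n%:R / 2) ^+ 2 /
       (8 * pi ^+ n.+1 *
        (1 - 2 * cos r * cos theta + cos r ^+ 2) `^ (n%:R / 2))).
Proof.
split; first by eexists; exact: (Green_function_green0 hn).
move=> G GG w r theta r0 rpi th0 thpi rth hrho.
have pi0 := pi_gt0 R.
have c0 : 0 < cos r by apply: cos_gt0_pihalf; lra.
have eP := @cylindrical_max R n w theta.
rewrite hrho sqrt_1Dtan2// in eP.
have eA : (cylindrical w theta).1 0 ord_max = cos r * cos theta := congr1 (@complex.Re R) eP.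
have eB : (cylindrical w theta).2 0 ord_max = cos r * sin theta := congr1 (@complex.Im R) eP.
have P1 := sphere_cylindrical w theta.
have PN : cylindrical w theta <> north_pole R n.
  move=> e; move: eA; rewrite e -dot_north_pole => eA.
  have c1 : cos r * cos theta = 1 by rewrite -eA; have /sphere_dotP := @sphere_north_pole R n; exact.
  have cr1 := cos_le1 r; have ct1 := cos_le1 theta.
  have cr : cos r = 1 by nra.
  have ct : cos theta = 1 by rewrite cr mul1r in c1.
  have rE : r = 0 by apply: cos_inj; rewrite ?cos0// in_itv/=; apply/andP; split; lra.
  (* The absolute value brings [theta] into [0, pi], where [cos] is injective. *)
  have tE : `|theta| = 0.
    apply: cos_inj; rewrite ?cos0 ?cos_norm// in_itv/= ?lexx ?(ltW pi0)//.
    by rewrite normr_ge0 ler_norml th0 thpi.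
  by apply: rth; rewrite rE (normr0_eq0 tE).
rewrite (Green_function_unique hn GG P1 PN) Gamma_formula; congr (_ / (_ * _ `^ _)).
rewrite /qk dot_north_pole dot_Jv_north_pole eA eB.
have := cos2Dsin2 theta; move: (cos theta) (sin theta) (cos r) => x y c h.
transitivity (1 - 2 * c * x + c ^+ 2 * (x ^+ 2 + y ^+ 2)); first by ring.
by rewrite h mulr1.
Qed.
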